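(* Let $a_1,a_2$ be two continuous functions in $\Omega$ such that $a_1<a_2$ in $\Omega$. Suppose $u\in W_0^{1,p}(\Omega)\cap L^\infty(\Omega)$ is a weak solution of $$-H_pu+(-\Delta_p)^su=a_1(x)u^{p-1}\ \text{in }\Omega,\qquad u>0\ \text{in }\Omega.$$ Then any nontrivial weak solution $v\in W_0^{1,p}(\Omega)$ of $$-H_pv+(-\Delta_p)^sv=a_2(x)|v|^{p-2}v\ \text{in }\Omega$$ must vanish in $\Omega$, in the sense that neither $v>0$ a.e. in $\Omega$ nor $v<0$ a.e. in $\Omega$.
   Context: $\Omega\subset\mathbb{R}^N$, $N\ge2$, is a bounded $C^1$ domain, $1<p<\infty$, $0<s<1$, and $d\mu=|x-y|^{-N-ps}\,dx\,dy$. $H:\mathbb{R}^N\to[0,\infty)$ is a Finsler–Minkowski norm: $H\in C^1(\mathbb{R}^N\setminus\{0\})$; $H(x)=0$ iff $x=0$; $H(tx)=|t|H(x)$ for all $t\in\mathbb{R}$, $x\in\mathbb{R}^N$; there are constants $C_1,C_2>0$ with $C_1|x|\le H(x)\le C_2|x|$ for all $x$; and $H$ is strictly convex as a norm, i.e. $H(x+y)<H(x)+H(y)$ for linearly independent $x,y$. The vector field $H(\xi)^{p-1}\nabla H(\xi)$ is understood as $0$ at $\xi=0$. $H_pu=\mathrm{div}(H(\nabla u)^{p-1}\nabla H(\nabla u))$ and $(-\Delta_p)^su(x)=\mathrm{P.V.}\int_{\mathbb{R}^N}|u(x)-u(y)|^{p-2}(u(x)-u(y))|x-y|^{-N-ps}\,dy$.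 $W_0^{1,p}(\Omega)=\{u\in W^{1,p}(\mathbb{R}^N):u=0\text{ in }\mathbb{R}^N\setminus\Omega\}$. $u\in W_0^{1,p}(\Omega)$ is a weak solution of $-H_pu+(-\Delta_p)^su=f(x,u)$ in $\Omega$ if for every $\phi\in W_0^{1,p}(\Omega)$ (the integral $\int_\Omega f(x,u)\phi\,dx$ being finite) $$\int_\Omega H(\nabla u)^{p-1}\nabla H(\nabla u)\cdot\nabla\phi\,dx+\iint_{\mathbb{R}^{2N}}|u(x)-u(y)|^{p-2}(u(x)-u(y))(\phi(x)-\phi(y))\,d\mu=\int_\Omega f(x,u)\phi\,dx.$$ *)

(* Defs.v *)
From HB Require Import structures.
From mathcomp Require Import all_boot all_order all_algebra.
From mathcomp Require Import all_classical all_reals all_analysis.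
Set Implicit Arguments.
Unset Strict Implicit.
Unset Printing Implicit Defensive.
Import Order.TTheory GRing.Theory Num.Theory.
Import numFieldNormedType.Exports.
Local Open Scope classical_set_scope.
Local Open Scope ring_scope.

(* R^n is 'rV[R]_n, with the topology of the library.  Its sigma-algebra is
   generated by the n coordinate maps, as the library does for n.-tuple R;
   it is the Borel sigma-algebra of R^n. *)
Definition measure_rV_display : measure_display -> measure_display.
Proof. exact. Qed.

Section measurable_rV.
Context {R : realType} (n : nat).

Let coord_rV (i : 'I_n) (x : 'rV[R]_n) : R := x ord0 i.

Let rV_set0 : g_sigma_preimage coord_rV set0.
Proof. exact: sigma_algebra0. Qed.

Let rV_setC A : g_sigma_preimage coord_rV A -> g_sigma_preimage coord_rV (~` A).
Proof. exact: sigma_algebraC. Qed.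

Let rV_bigcup (F : (set 'rV[R]_n)^nat) :
  (forall i, g_sigma_preimage coord_rV (F i)) ->
  g_sigma_preimage coord_rV (\bigcup_i (F i)).
Proof. exact: sigma_algebra_bigcup. Qed.

HB.instance Definition _ :=
  @isMeasurable.Build (measure_rV_display default_measure_display)
    'rV[R]_n (g_sigma_preimage coord_rV) rV_set0 rV_setC rV_bigcup.

Lemma measurable_coord_rV (i : 'I_n) :
  measurable_fun [set: 'rV[R]_n] (fun x : 'rV[R]_n => x ord0 i).
Proof.
move=> _ Y mY; rewrite setTI; apply: sub_sigma_algebra => /=.
rewrite -bigcup_seq/=; exists i => /=; first by rewrite mem_index_enum.
by exists Y => //; rewrite setTI.
Qed.

Lemma measurable_fun_rVP d (T : measurableType d) (f : T -> 'rV[R]_n) :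
  (forall i, measurable_fun setT (fun t => f t ord0 i)) ->
  measurable_fun setT f.
Proof.
move=> mf; have : g_sigma_preimage (fun i => coord_rV i \o f) `<=` measurable.
  apply: smallest_sub; first exact: sigma_algebra_measurable.
  rewrite -bigcup_seq; apply: bigcup_sub => i _.
  by move=> A [B mB <-]; exact: mf.
by rewrite g_sigma_preimage_comp => prefS _ A mA; apply: prefS; exists A.
Qed.

End measurable_rV.

(* The library registers this fact only for subprobabilities. *)
Lemma product_measure_sigma_finite d1 d2 (T1 : measurableType d1)
    (T2 : measurableType d2) (R : realType)
    (m1 : {sigma_finite_measure set T1 -> \bar R})
    (m2 : {sigma_finite_measure set T2 -> \bar R}) :
  sigma_finite setT (m1 \x m2)%E.
Proof.
have /sigma_finiteP[F [TF ndF Foo]] := sigma_finiteT m1.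
have /sigma_finiteP[G [TG ndG Goo]] := sigma_finiteT m2.
exists (fun n => F n `*` G n).
  rewrite -setXTT TF TG predeqE => -[x y]; split.
    move=> [/= [n _ Fnx] [k _ Gky]]; exists (maxn n k) => //; split.
    - by move: x Fnx; exact/subsetPset/ndF/leq_maxl.
    - by move: y Gky; exact/subsetPset/ndG/leq_maxr.
  by move=> [n _ []/= ? ?]; split; exists n.
move=> k; have [? ?] := Foo k; have [? ?] := Goo k.
split; first exact: measurableX.
by rewrite product_measure1E// lte_mul_pinfty// ge0_fin_numE.
Qed.

Section pushforward_sigma_finite.
Context d1 d2 (T1 : measurableType d1) (T2 : measurableType d2) (R : realType).
Variables (m : {measure set T1 -> \bar R}) (sfm : sigma_finite setT m).
Variables (f : T1 -> T2) (g : T2 -> T1).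
Hypotheses (mf : measurable_fun setT f) (mg : measurable_fun setT g).
Hypothesis fK : cancel f g.

Let nu : {measure set T2 -> \bar R} :=
  measure_function_pushforward__canonical__measure_function_Measure m mf.

Let nu_sigma_finite : sigma_finite setT nu.
Proof.
have [F FT Foo] := sfm.
exists (fun k => g @^-1` F k).
  by rewrite -preimage_bigcup -FT preimage_setT.
move=> k; have [mFk Fkoo] := Foo k; split.
  by rewrite -[X in measurable X]setTI; exact: mg.
rewrite /nu/= /pushforward (_ : _ @^-1` _ = F k) //.
by apply/seteqP; split => z /=; rewrite fK.
Qed.

Let nu' : set T2 -> \bar R := nu.
HB.instance Definition _ := Measure.on nu'.
HB.instance Definition _ :=
  @Measure_isSigmaFinite.Build _ _ _ nu' nu_sigma_finite.

Lemma pushforward_sigma_finite :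
  exists m' : {sigma_finite_measure set T2 -> \bar R},
    m' = pushforward m f :> (set T2 -> \bar R).
Proof. by exists nu'. Qed.

End pushforward_sigma_finite.

Section lebesgue_rV.
Context {R : realType}.

Definition cons_rV n (z : R * 'rV[R]_n) : 'rV[R]_n.+1 := row_mx z.1%:M z.2.

Fixpoint lebesgue_rV n : set 'rV[R]_n -> \bar R :=
  match n with
  | 0 => dirac (0 : 'rV[R]_0)
  | m.+1 => pushforward (lebesgue_measure \x @lebesgue_rV m)%E (@cons_rV m)
  end.

Let behead_rV n (x : 'rV[R]_n.+1) : R * 'rV[R]_n :=
  (x ord0 ord0, \row_i x ord0 (lift ord0 i)).

Let cons_rVE n (z : R * 'rV[R]_n) (i : 'I_n.+1) :
  cons_rV z ord0 i = oapp (fun j => z.2 ord0 j) z.1 (unlift ord0 i).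
Proof.
rewrite /cons_rV mxE; case: splitP => j ij.
  rewrite (_ : i = ord0) ?unlift_none /=; last first.
    by apply/val_inj; rewrite /= ij; case: j {ij} => -[].
  by rewrite !mxE !ord1 mulr1n.
rewrite (_ : i = lift ord0 j) ?liftK //.
by apply/val_inj.
Qed.

Let cons_rVK n : cancel (@cons_rV n) (@behead_rV n).
Proof.
move=> [t v]; congr pair; first by rewrite cons_rVE unlift_none.
by apply/rowP => i; rewrite mxE cons_rVE liftK.
Qed.

Let measurable_cons_rV n : measurable_fun setT (@cons_rV n).
Proof.
apply: measurable_fun_rVP => i.
apply: (eq_measurable_fun
    (fun z : R * 'rV[R]_n => oapp (fun j => z.2 ord0 j) z.1 (unlift ord0 i))).
  by move=> z _; rewrite cons_rVE.
case: unliftP => [j|] _ /=; last exact: measurable_fst.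
exact: (measurableT_comp (measurable_coord_rV j) measurable_snd).
Qed.

Let measurable_behead_rV n : measurable_fun setT (@behead_rV n).
Proof.
apply/measurable_fun_pairP; split; first exact: measurable_coord_rV.
apply: measurable_fun_rVP => i.
apply: (eq_measurable_fun (fun x : 'rV[R]_n.+1 => x ord0 (lift ord0 i))).
  by move=> x _; rewrite /= mxE.
exact: measurable_coord_rV.
Qed.

Lemma lebesgue_rV_sigma_finite_measure n :
  exists m : {sigma_finite_measure set 'rV[R]_n -> \bar R},
    m = @lebesgue_rV n :> (set 'rV[R]_n -> \bar R).
Proof.
elim: n => [|n [m mE]] /=.
  by exists (dirac (0 : 'rV[R]_0)).
rewrite -mE.
pose mu : {measure set (measurableTypeR R * 'rV[R]_n)%type -> \bar R} :=
  (lebesgue_measure \x m)%E.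
exact: (@pushforward_sigma_finite _ _ _ _ R mu
  (product_measure_sigma_finite (@lebesgue_measure R) m) _ _
  (@measurable_cons_rV n) (@measurable_behead_rV n) (@cons_rVK n)).
Qed.

End lebesgue_rV.

Section lebesgue_rV_measure.
Context {R : realType} (n : nat).

Let mu : {sigma_finite_measure set 'rV[R]_n -> \bar R} :=
  projT1 (cid (@lebesgue_rV_sigma_finite_measure R n)).

Let muE : mu = @lebesgue_rV R n :> (set 'rV[R]_n -> \bar R).
Proof. by rewrite /mu; case: cid. Qed.

Let lebesgue_rV0 : @lebesgue_rV R n set0 = 0%E.
Proof. by rewrite -muE measure0. Qed.

Let lebesgue_rV_ge0 A : (0 <= @lebesgue_rV R n A)%E.
Proof. by rewrite -muE measure_ge0. Qed.

Let lebesgue_rV_sigma_additive : semi_sigma_additive (@lebesgue_rV R n).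
Proof. by rewrite -muE; exact: measure_semi_sigma_additive. Qed.

HB.instance Definition _ := isMeasure.Build _ _ _ (@lebesgue_rV R n)
  lebesgue_rV0 lebesgue_rV_ge0 lebesgue_rV_sigma_additive.

Let lebesgue_rV_sigma_finite : sigma_finite setT (@lebesgue_rV R n).
Proof. by rewrite -muE; exact: sigma_finiteT. Qed.

HB.instance Definition _ := Measure_isSigmaFinite.Build _ _ _
  (@lebesgue_rV R n) lebesgue_rV_sigma_finite.

End lebesgue_rV_measure.

Notation leb := (@lebesgue_rV _ _).

Section euclidean.
Context {R : realType} {n : nat}.
Implicit Types (x y : 'rV[R]_n) (f : 'rV[R]_n -> R).

Definition dotv x y : R := \sum_(i < n) x ord0 i * y ord0 i.

(* The library norm `|x| on 'rV[R]_n is the sup norm. *)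
Definition enorm x : R := Num.sqrt (dotv x x).

Definition partial (i : 'I_n) f : 'rV[R]_n -> R := 'D_(delta_mx ord0 i) f.

Definition gradient f x : 'rV[R]_n := \row_i partial i f x.

(* Meant for open A. *)
Definition C1_on (A : set 'rV[R]_n) f :=
  forall x, A x -> differentiable f x /\
    forall i, {for x, continuous (partial i f)}.

Definition smooth f := forall s : seq 'I_n,
  continuous (foldr partial f s) /\
  forall i x, derivable (foldr partial f s) x (delta_mx ord0 i).

Definition test_function f :=
  smooth f /\ compact (closure [set x | f x != 0]).

End euclidean.

(* Near each boundary point, and up to the choice of an axis and of its
   orientation, Omega is the region above the graph of a C^1 function of the
   n.-1 other coordinates. *)
Definition C1_boundary (R : realType) (n : nat) (Omega : set 'rV[R]_n) :=
  forall x0, (closure Omega `\` Omega°) x0 ->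
  exists (i : 'I_n) (b : bool) (g : 'rV[R]_n.-1 -> R),
    C1_on setT g /\
    \forall x \near x0, Omega x <-> g (col' i x) < (-1) ^+ b * x ord0 i.

Record bounded_C1_domain (R : realType) (n : nat) (Omega : set 'rV[R]_n) : Prop :=
  BoundedC1Domain {
    domain_open : open Omega;
    domain_connected : connected Omega;
    domain_nonempty : Omega !=set0;
    domain_bounded : bounded_set Omega;
    domain_C1 : C1_boundary Omega }.

Record Finsler_Minkowski (R : realType) (n : nat) (H : 'rV[R]_n -> R) : Prop :=
  FinslerMinkowski {
    FM_ge0 : forall x, 0 <= H x;
    FM_C1 : C1_on [set x | x != 0] H;
    FM_eq0 : forall x, H x = 0 <-> x = 0;
    FM_homogeneous : forall (t : R) x, H (t *: x) = `|t| * H x;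
    FM_equiv : exists C1 C2 : R, [/\ 0 < C1, 0 < C2 &
      forall x, C1 * enorm x <= H x <= C2 * enorm x];
    FM_strictly_convex :
      forall x y, free [:: x; y] -> H (x + y) < H x + H y }.

Section sobolev.
Context {R : realType} {n : nat}.
Variable p : R.
Implicit Types (u phi : 'rV[R]_n -> R) (g : 'rV[R]_n -> 'rV[R]_n).

Definition weak_gradient u g :=
  (forall i, (fun x => g x ord0 i) \in Lfun leb p%:E) /\
  forall phi i, test_function phi ->
    (\int[leb]_x (u x * partial i phi x)%:E =
     - \int[leb]_x (g x ord0 i * phi x)%:E)%E.

Definition W1p u :=
  u \in Lfun leb p%:E /\ exists g, weak_gradient u g.

(* A representative of the weak gradient, which is unique up to null sets. *)
Definition wgrad u : 'rV[R]_n -> 'rV[R]_n :=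
  xget (fun=> 0) [set g | weak_gradient u g].

Definition W01p (Omega : set 'rV[R]_n) u :=
  W1p u /\ {ae leb, forall x, ~ Omega x -> u x = 0}.

Definition Linfty (Omega : set 'rV[R]_n) u :=
  (u \_ Omega) \in Lfun leb (+oo%E : \bar R).

End sobolev.

Section weak_solution.
Context {R : realType} {n : nat}.
Variables (p s : R) (Omega : set 'rV[R]_n) (H : 'rV[R]_n -> R).

Definition spow (t : R) : R := `|t| `^ (p - 2) * t.

Definition flux (xi : 'rV[R]_n) : 'rV[R]_n :=
  if xi == 0 then 0 else H xi `^ (p - 1) *: gradient H xi.

Definition kernel (x y : 'rV[R]_n) : R :=
  enorm (x - y) `^ (- (n%:R + p * s)).

(* The integrals are extended-real valued; the library's \int of a measurable
   function is finite only if that function is integrable, so, the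
   other two terms being finite, the equation includes the convergence of the
   double integral. *)
Definition weak_solution (f : 'rV[R]_n -> R -> R) (u : 'rV[R]_n -> R) :=
  W01p p Omega u /\
  forall phi, W01p p Omega phi ->
    leb.-integrable Omega (fun x => (f x (u x) * phi x)%:E) /\
    (\int[leb]_(x in Omega) (dotv (flux (wgrad p u x)) (wgrad p phi x))%:E +
     \int[leb \x leb]_z (spow (u z.1 - u z.2) * (phi z.1 - phi z.2)
                         * kernel z.1 z.2)%:E =
     \int[leb]_(x in Omega) (f x (u x) * phi x)%:E)%E.

End weak_solution.

(* Main.v *)
Require Import Defs.
From HB Require Import structures.
From mathcomp Require Import all_boot all_order all_algebra.
From mathcomp Require Import all_classical all_reals all_analysis.
From mathcomp Require Import measurable_realfun ess_sup_inf.
From mathcomp Require Import ring lra.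
Set Implicit Arguments.
Unset Strict Implicit.
Unset Printing Implicit Defensive.
Import Order.TTheory GRing.Theory Num.Theory.
Import numFieldNormedType.Exports.
Local Open Scope classical_set_scope.
Local Open Scope ring_scope.

(** The argument is a Picone identity.  Suppose that t v > 0 almost everywhere
    in Omega, where t is 1 or -1.  For e > 0 the function
    phi_e = t u^p (t v + e)^(1-p) is admissible in the equation of v, because
    u is bounded and t v + e >= e; its gradient is given by the chain rule.
    Test the equation of v with phi_e and the equation of u with u itself.
    The left-hand sides compare pointwise:
    - for the local terms, Young's inequality and the inequality
      grad H(xi) . eta <= H(eta) give flux(grad v) . grad phi_e <= H(grad u)^p,
      and the right-hand side is flux(grad u) . grad u ([local_picone]);
    - for the nonlocal terms, the joint convexity of x^p a^(1-p) gives
      |v1 - v2|^(p-2) (v1 - v2) (phi_e1 - phi_e2) <= |u1 - u2|^p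
      ([discrete_picone]).
    Hence the integral of a2 |v|^(p-2) v phi_e is at most that of a1 u^p
    ([picone_comparison]).  As e tends to 0 the integrand a2 |v|^(p-2) v phi_e
    tends to a2 u^p, and Fatou's lemma yields that the integral of
    (a2 - a1) u^p is at most 0 ([no_signed_solution]).  The integrand is
    positive in Omega, so Omega is null, and then v is trivial.

    The larger part of the file is the chain rule for weak derivatives, for a
    function F(u1, u2) that is Lipschitz only on the range of (u1, u2)
    ([weak_partial_chain]).  It rests on difference quotients.  If g is the i-th weak derivative of u,
    then (u(x + h e_i) - u(x)) / h is, for almost every x, the average of g over
    the segment from x to x + h e_i ([difference_quotient]); these averages
    converge to g almost everywhere ([line_avg_cvg_ae]) and against test
    functions ([cvg_integral_line_avg]).  Along h = 1/(k+1), the difference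
    quotients of F(u1, u2) then converge almost everywhere to the expected
    derivative and are dominated by the averages of |g1| and |g2|, so that
    Pratt's dominated convergence theorem ([pratt]) identifies the limit of
    their integrals against a test function. *)

(** * Boxes and Borel sets *)

Definition box (R : realType) n (a b : 'I_n -> R) : set 'rV[R]_n :=
  [set x | forall i, a i < x ord0 i < b i].

(** Cubes of integer half-side exhaust R^n and serve as the bounded sets on
    which local integrability is tested. *)
Definition cube (R : realType) n (r : R) : set 'rV[R]_n :=
  box (fun=> - r) (fun=> r).
Arguments cube {R} n r _ : simpl never.

Lemma measurable_box (R : realType) n (a b : 'I_n -> R) : measurable (box a b).
Proof.
rewrite (_ : box a b = \bigcap_(i in [set: 'I_n])
   ((fun x : 'rV[R]_n => x ord0 i) @^-1` `]a i, b i[)); last first.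
  apply/seteqP; split => x /= H i; first by move=> _; rewrite /= in_itv; exact: H.
  by have := H i I; rewrite /= in_itv.
apply: fin_bigcap_measurable => // i _.
by rewrite -[X in measurable X]setTI; exact: measurable_coord_rV.
Qed.

(** The boxes with rational centres and half-sides 1/(k+1) form a countable base
    of the topology. *)
Lemma open_measurable_rV (R : realType) n (A : set 'rV[R]_n) : open A -> measurable A.
Proof.
move=> oA.
pose Q (z : 'rV[rat]_n * nat) : set 'rV[R]_n := [set x | forall i,
   ratr (z.1 ord0 i) - z.2.+1%:R^-1 < x ord0 i < ratr (z.1 ord0 i) + z.2.+1%:R^-1].
rewrite (_ : A = \bigcup_(z in [set z | Q z `<=` A]) Q z); last first.
  apply/seteqP; split=> [x Ax|x [z /=]]; last by apply.
  have /nbhs_ballP[e /= e0 eA] := oA _ Ax.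
  have [k ke] : exists k : nat, 2 * k.+1%:R^-1 < e.
    exists (Num.bound (2 / e)).
    have := archi_boundP (ltW (divr_gt0 (@ltr0n R 2) e0)).
    set K := Num.bound _ => hK.
    rewrite ltr_pdivrMr// mulrC -ltr_pdivrMr//.
    by rewrite (lt_trans hK)// ltr_nat.
  have H i : {q : rat | x ord0 i - k.+1%:R^-1 < ratr q < x ord0 i + k.+1%:R^-1}.
    apply: cid; have [] := @rat_in_itvoo R (x ord0 i - k.+1%:R^-1) (x ord0 i + k.+1%:R^-1).
      by rewrite ltrBlDr -addrA ltrDl addr_gt0// invr_gt0.
    by move=> q; rewrite in_itv/= => qH; exists q.
  exists (\row_i projT1 (H i), k) => /=; last first.
    move=> i /=; rewrite mxE; case: (H i) => q /=; move: (ratr q) => r /andP[q1 q2].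
    by rewrite ltrBlDr q2 -ltrBlDr q1.
  move=> y /= yQ; apply: eA; split => // j i; rewrite (ord1 j) /ball/=.
  have := yQ i; rewrite mxE; case: (H i) => q /=; move: (ratr q) => r /andP[q1 q2] /andP[y1 y2].
  have aux (a b d r' : R) : a - d < r' -> r' < a + d -> r' - d < b -> b < r' + d ->
      `|a - b| < 2 * d by rewrite ltr_norml => *; apply/andP; split; lra.
  by rewrite /= (lt_trans _ ke)// (aux _ _ _ r).
rewrite bigcup_mkcond; apply: countable_bigcupT_measurable => [|z].
  exact: countableP.
by case: ifP => // _; exact: measurable_box.
Qed.

Lemma continuous_measurable_rV (R : realType) n (f : 'rV[R]_n -> R) :
  continuous f -> measurable_fun setT f.
Proof.
move=> /continuousP cf.
apply: (measurability _ (RGenOpens.measurableE R)) => _ [_ [a [b ->] <-]].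
by rewrite setTI; apply: open_measurable_rV; apply: cf; exact: interval_open.
Qed.

(** * Invariance of Lebesgue measure *)

(** By uniqueness of Lebesgue measure: the right-hand side is a measure with the
    right value on the intervals. *)
Lemma lebesgue_affine (R : realType) (c d : R) (A : set R) :
  0 < c -> measurable A ->
  (lebesgue_measure A =
   c%:E * lebesgue_measure ((fun t => (c * t + d)%R) @^-1` A))%E.
Proof.
move=> c0 mA.
have mf : measurable_fun setT (fun t : measurableTypeR R => (c * t + d : measurableTypeR R)).
  by apply: measurable_funD => //; apply: measurable_funM.
pose c' := NngNum (ltW c0).
pose nu : {measure set (measurableTypeR R) -> \bar R} := mscale c'
  (measure_function_pushforward__canonical__measure_function_Measure
     (@lebesgue_measure R) mf).
rewrite (@lebesgue_measure_unique R nu)//= => _ [[a b]] _ <-.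
rewrite /nu/mscale/= /pushforward.
have -> : (fun t : measurableTypeR R => c * t + d) @^-1` `]a, b] =
    `](a - d) / c, (b - d) / c]%classic.
  apply/seteqP; split => t /=; rewrite !in_itv/= ltr_pdivrMr// ler_pdivlMr// (mulrC t);
   by rewrite ltrBlDr lerBrDr.
rewrite !lebesgue_measure_itv/= !lte_fin ltr_pM2r ?invr_gt0// ltrD2r.
case: ifP => _; last by rewrite mule0.
by rewrite -EFinM; congr EFin; field; rewrite gt_eqF.
Qed.

Lemma ge0_integral_affine (R : realType) (c d : R) (f : R -> \bar R) :
  0 < c -> measurable_fun setT f -> (forall x, 0 <= f x)%E ->
  (\int[lebesgue_measure]_x f x =
   c%:E * \int[lebesgue_measure]_x f (c * x + d)%R)%E.
Proof.
move=> c0 mf f0.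
have ma : measurable_fun setT (fun t : measurableTypeR R => (c * t + d : measurableTypeR R)).
  by apply: measurable_funD => //; apply: measurable_funM.
pose c' := NngNum (ltW c0).
pose nu : {measure set (measurableTypeR R) -> \bar R} :=
  (measure_function_pushforward__canonical__measure_function_Measure
     (@lebesgue_measure R) ma).
rewrite (@eq_measure_integral _ _ _ setT (mscale c' nu)) => [|A mA _]; last first.
  exact: lebesgue_affine.
by rewrite ge0_integral_mscale//= ge0_integral_pushforward.
Qed.

Lemma cons_rV0 (R : realType) n (z : R * 'rV[R]_n) : cons_rV z ord0 ord0 = z.1.
Proof.
rewrite /cons_rV mxE; case: splitP => // j _.
by rewrite !mxE !ord1 mulr1n.
Qed.

Lemma cons_rV_lift (R : realType) n (z : R * 'rV[R]_n) (j : 'I_n) :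
  cons_rV z ord0 (lift ord0 j) = z.2 ord0 j.
Proof.
rewrite /cons_rV mxE; case: splitP => k /=; first by rewrite ord1.
by rewrite /bump /= !add1n => -[] jk; congr (z.2 _ _); apply/val_inj.
Qed.

Lemma measurable_cons_rV (R : realType) n : measurable_fun setT (@cons_rV R n).
Proof.
apply: measurable_fun_rVP => i; case: (unliftP ord0 i) => [j ->|->].
- under eq_fun do rewrite cons_rV_lift.
  exact: (measurableT_comp (measurable_coord_rV j) measurable_snd).
- under eq_fun do rewrite cons_rV0; exact: measurable_fst.
Qed.

(** By the recursive definition of the measure, translation invariance in
    dimension n reduces to translation invariance on the line. *)
Lemma leb_translation (R : realType) n (c : 'rV[R]_n) (A : set 'rV[R]_n) :
  measurable A -> leb ((fun x => x + c) @^-1` A) = leb A.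
Proof.
elim: n c A => [|n IH] c A mA.
  by congr dirac; apply/seteqP; split => x; rewrite /= (_ : x + c = x)//; apply/rowP => -[].
rewrite /=/pushforward /product_measure1.
pose C := @cons_rV R n @^-1` A.
have mC : measurable C by rewrite -[C]setTI; exact: measurable_cons_rV.
pose f s := leb (xsection C s).
have mf : measurable_fun setT f by exact: measurable_fun_xsection.
rewrite -[RHS]/(\int[lebesgue_measure]_s f s)%E.
rewrite (@ge0_integral_affine _ 1 (c ord0 ord0) f)// mul1e.
apply: eq_integral => s _; rewrite mul1r.
rewrite /f -(IH (\row_i c ord0 (lift ord0 i)))/=; last exact: measurable_xsection.
have E y : cons_rV (s, y) + c =
    cons_rV (s + c ord0 ord0, y + \row_i c ord0 (lift ord0 i)).
  apply/rowP => i; rewrite mxE; case: (unliftP ord0 i) => [j ->|->];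
  by rewrite ?cons_rV0 ?cons_rV_lift/= ?mxE.
congr lebesgue_rV; apply/seteqP; split => y /=; rewrite /xsection/= !in_setE/C/=.
  by rewrite E.
by rewrite -E.
Qed.

Lemma measurable_fun_translation (R : realType) n (c : 'rV[R]_n) :
  measurable_fun setT (fun x : 'rV[R]_n => x + c).
Proof.
apply: measurable_fun_rVP => i.
under eq_fun do rewrite mxE.
by apply: measurable_funD => //; exact: measurable_coord_rV.
Qed.

Lemma ge0_integral_translation (R : realType) n (c : 'rV[R]_n) (f : 'rV[R]_n -> \bar R) :
  measurable_fun setT f -> (forall x, 0 <= f x)%E ->
  (\int[leb]_x f (x + c)%R = \int[leb]_x f x)%E.
Proof.
move=> mf f0.
pose nu : {measure set 'rV[R]_n -> \bar R} :=
  (measure_function_pushforward__canonical__measure_function_Measure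
     leb (measurable_fun_translation c)).
rewrite [RHS](@eq_measure_integral _ _ _ setT nu) => [|A mA _]; last first.
  by rewrite /nu /= /pushforward leb_translation.
by rewrite ge0_integral_pushforward//; exact: measurable_fun_translation.
Qed.

Lemma integral_translation (R : realType) n (c : 'rV[R]_n) (f : 'rV[R]_n -> \bar R) :
  measurable_fun setT f ->
  (\int[leb]_x f (x + c)%R = \int[leb]_x f x)%E.
Proof.
move=> mf; rewrite integralE [RHS]integralE.
rewrite (funepos_comp f (fun x => x + c)) (funeneg_comp f (fun x => x + c)).
congr (_ - _)%E.
  exact: (ge0_integral_translation c (measurable_funepos mf) (funepos_ge0 f)).
exact: (ge0_integral_translation c (measurable_funeneg mf) (funeneg_ge0 f)).
Qed.

Lemma integrable_translation (R : realType) n (c : 'rV[R]_n) (f : 'rV[R]_n -> \bar R) :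
  leb.-integrable setT f -> leb.-integrable setT (fun x => f (x + c)%R).
Proof.
move=> /integrableP[mf fi]; apply/integrableP; split.
  exact: (measurableT_comp mf (measurable_fun_translation c)).
by rewrite (ge0_integral_translation c (f := fun x => `|f x|%E))//; exact: measurableT_comp.
Qed.

Lemma ae_translation (R : realType) n (c : 'rV[R]_n) (P : 'rV[R]_n -> Prop) :
  {ae leb, forall x, P x} -> {ae leb, forall x, P (x + c)}.
Proof.
move=> [A [mA A0 PA]]; exists ((fun x => x + c) @^-1` A); split.
- by rewrite -[X in measurable X]setTI; exact: measurable_fun_translation.
- by rewrite leb_translation.
- by move=> x /= Px; apply: PA.
Qed.

Lemma leb_box_lty (R : realType) n (a b : 'I_n -> R) : (leb (box a b) < +oo)%E.
Proof.
elim: n a b => [|n IH] a b; first by rewrite /= diracE; case: (_ \in _); rewrite ltry.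
rewrite /= /pushforward.
have -> : @cons_rV R n @^-1` box a b =
    `]a ord0, b ord0[%classic `*` box (a \o lift ord0) (b \o lift ord0).
  apply/seteqP; split => -[s y]; rewrite /box/=.
    move=> H; split; first by have := H ord0; rewrite cons_rV0 in_itv.
    by move=> i; have := H (lift ord0 i); rewrite cons_rV_lift.
  move=> [H1 H2] i; case: (unliftP ord0 i) => [j ->|->].
    by rewrite cons_rV_lift.
  by rewrite cons_rV0; move: H1; rewrite in_itv.
rewrite product_measure1E//; last exact: measurable_box.
have ? : lebesgue_measure `]a ord0, b ord0[%classic \is a fin_num.
  by rewrite lebesgue_measure_itv/=; case: ifP => _ //; rewrite -EFinB.
by apply: lte_mul_pinfty => //; exact: IH.
Qed.

(** * Functions with vanishing integrals *)

Lemma boxI (R : realType) n (a b a' b' : 'I_n -> R) :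
  box a b `&` box a' b' =
  box (fun i => Num.max (a i) (a' i)) (fun i => Num.min (b i) (b' i)).
Proof.
apply/seteqP; split => x; rewrite /box/=.
  by move=> [H1 H2] i; rewrite gt_max lt_min; have /andP[-> ->] := H1 i; exact: H2.
move=> H; split => i; have := H i; rewrite gt_max lt_min;
  by move=> /andP[/andP[? ?] /andP[? ?]]; apply/andP; split.
Qed.

Lemma cube_cover (R : realType) n (x : 'rV[R]_n) :
  exists K : nat, cube n K%:R x.
Proof.
exists (Num.bound (\sum_i `|x ord0 i|)) => i.
rewrite -ltr_norml (le_lt_trans _ (archi_boundP _))//.
  by rewrite (bigD1 i)//= lerDl sumr_ge0.
by rewrite sumr_ge0.
Qed.

Lemma measurable_boxE (R : realType) n :
  @measurable _ 'rV[R]_n =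
  <<s [set A | exists a b : 'I_n -> R, A = box a b] >>.
Proof.
apply/seteqP; split; last first.
  apply: smallest_sub; first exact: sigma_algebra_measurable.
  by move=> _ [a [b ->]]; exact: measurable_box.
set G := [set A | _].
apply: smallest_sub; first exact: smallest_sigma_algebra.
rewrite -bigcup_seq; apply: bigcup_sub => i _ _ [B mB <-].
have : measurable_fun setT ((fun x : 'rV[R]_n => x ord0 i) : g_sigma_algebraType G -> R).
  apply: (measurability _ (RGenOpens.measurableE R)) => _ [_ [a [b ->] <-]].
  rewrite setTI.
  rewrite (_ : _ @^-1` _ = \bigcup_(K : nat)
     box (fun j => if j == i then a else - K%:R) (fun j => if j == i then b else K%:R)).
    apply: bigcupT_measurable => K; apply: sub_sigma_algebra.
    by exists (fun j => if j == i then a else - K%:R), (fun j => if j == i then b else K%:R).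
  apply/seteqP; split => x; rewrite /= in_itv/=.
    move=> xab; have [K Kx] := cube_cover x; exists K => // j.
    by case: ifP => [/eqP ->//|_]; exact: Kx.
  by move=> [K _ /(_ i)]; rewrite eqxx.
by move=> /(_ measurableT _ mB).
Qed.

(** Boxes form a pi-system generating the sigma-algebra, and the sets over
    which the integral of f vanishes form a Dynkin system. *)
Lemma ae_eq0_of_integral_box (R : realType) n (f : 'rV[R]_n -> R) :
  measurable_fun setT f ->
  (forall K : nat, leb.-integrable (cube n K%:R) (EFin \o f)) ->
  (forall a b, \int[leb]_(x in box a b) (f x)%:E = 0)%E ->
  {ae leb, forall x, f x = 0}.
Proof.
move=> mf fi f0.
suff H (K : nat) : {ae leb, forall x, cube n K%:R x -> f x = 0}.
  have := ae_foralln H; apply: filterS => x Hx.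
  by have [K Kx] := cube_cover x; exact: Hx Kx.
have mK : measurable (cube n K%:R : set 'rV[R]_n) := measurable_box _ _.
pose g := (EFin \o f) \_ (cube n K%:R).
have gi : leb.-integrable setT g by rewrite -integrable_mkcond.
pose nu : {charge set 'rV[R]_n -> \bar R} := induced_charge gi.
have nuE A : measurable A -> nu A = (\int[leb]_(x in A `&` cube n K%:R) (f x)%:E)%E.
  by move=> mA; rewrite /nu/= /induced_charge /g -integral_mkcondr.
pose G : set (set 'rV[R]_n) := [set A | exists a b, A = box a b].
have nu_box A : G A -> nu A = 0%E.
  by move=> [a [b ->]]; rewrite nuE ?boxI ?f0//; exact: measurable_box.
have nuT : nu setT = 0%E by rewrite nuE ?setTI ?f0.
have nu0 A : measurable A -> nu A = 0%E.
  rewrite measurable_boxE -/G -setI_closed_g_dynkin_g_sigma_algebra; last first.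
    by move=> _ _ [a [b ->]] [a' [b' ->]]; rewrite boxI; do 2 eexists.
  suff : <<d G >> `<=` [set B | measurable B /\ nu B = 0%E] by move=> /[apply] -[].
  apply: smallest_sub; last first.
    by move=> B GB; split; [case: GB => a [b ->]; exact: measurable_box|exact: nu_box].
  split => //.
    move=> B [mB B0]; split; first exact: measurableC.
    have := chargeD nu measurableT mB; rewrite setTD setTI nuT B0.
    by rewrite sube0.
  move=> F tF FH; split.
    by apply: bigcupT_measurable => k; have [] := FH k.
  have mF k : measurable (F k) by have [] := FH k.
  have := @charge_semi_sigma_additive _ _ _ nu F mF tF (bigcupT_measurable _ mF).
  rewrite (_ : (fun _ => _) = cst 0%E) => [/cvg_lim <-//|].
    by rewrite lim_cst.
  by apply/funext => k; rewrite big1// => j _; have [] := FH j.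
have : ae_eq leb setT g (cst 0%E).
  apply: (integral_ae_eq measurableT gi) => // E _ mE.
  by rewrite integral0; exact: nu0.
apply: filterS => x /(_ I) + xK; rewrite /g patchE mem_set//=.
by move=> -[].
Qed.

(** * Smooth bumps on the line *)

(** A function is smooth as soon as it lies in some set of functions closed under
    differentiation; this avoids handling the iterated derivatives. *)
Definition smooth1 (R : realType) (f : R -> R) := exists2 D : set (R -> R), D f &
  forall g : R -> R, D g -> exists2 g' : R -> R, D g' & forall x : R, is_derive x 1 g (g' x).

(** The factor x^-j makes the family stable under differentiation, up to linear
    combinations. *)
Definition expinv (R : realType) (j : nat) (x : R) : R :=
  if 0 < x then x^-1 ^+ j * expR (- x^-1) else 0.

Lemma expinv_ge0 (R : realType) j (x : R) : 0 <= expinv j x.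
Proof.
rewrite /expinv; case: ifPn => // x0.
by rewrite mulr_ge0 ?expR_ge0// exprn_ge0// invr_ge0 ltW.
Qed.

Lemma expinv_le1 (R : realType) (x : R) : expinv 0 x <= 1.
Proof.
rewrite /expinv; case: ifPn => // x0.
by rewrite expr0 mul1r -expR0 ler_expR oppr_le0 invr_ge0 ltW.
Qed.

(** With y = 1/x, exp(y) = exp(y / (j+1))^(j+1) >= (y / (j+1))^(j+1). *)
Lemma expinv_bound (R : realType) j : exists2 C : R, 0 <= C & forall x : R, expinv j x <= C * `|x|.
Proof.
exists (j.+1%:R ^+ j.+1); first by rewrite exprn_ge0.
move=> x; rewrite /expinv; case: ifPn => x0; last by rewrite mulr_ge0// exprn_ge0.
rewrite (gtr0_norm x0) expRN ler_pdivrMr ?expR_gt0//.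
have y0 : 0 < x^-1 by rewrite invr_gt0.
have -> : x = x^-1^-1 by rewrite invrK.
move: (x^-1) y0 => y y0; rewrite invrK.
have : (y / j.+1%:R) ^+ j.+1 <= expR y.
  have -> : expR y = expR (y / j.+1%:R) ^+ j.+1.
    by rewrite -expRM_natl mulrC divfK// pnatr_eq0.
  apply: lerXn2r; rewrite ?nnegrE ?expR_ge0 ?divr_ge0// ?(ltW y0)//.
  by rewrite (le_trans _ (expR_ge1Dx _))// lerDr.
rewrite expr_div_n ler_pdivrMr ?exprn_gt0// => H.
rewrite -mulrA [y^-1 * _]mulrC mulrA ler_pdivlMr// -exprSr.
by rewrite (le_trans H)// mulrC.
Qed.

Lemma cvg_is_derive (R : realType) (V : normedModType R) (f : V -> R) (x v : V) (l : R) :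
  h^-1 *: (f (h *: v + x) - f x) @[h --> 0^'] --> l -> is_derive x v f l.
Proof.
by move=> H; apply: DeriveDef; [apply/cvg_ex; exists l|apply: cvg_lim].
Qed.

(** At 0 the difference quotient of the j-th function is the value of the
    next one, which [expinv_bound] makes small. *)
Lemma is_derive_expinv (R : realType) j (x : R) :
  is_derive x 1 (expinv j) (expinv j.+2 x - j%:R * expinv j.+1 x).
Proof.
have [x0|x0|->] := ltgtP x 0.
- rewrite {2 3}/expinv ltNge (ltW x0)/= mulr0 subr0.
  apply: (@near_eq_is_derive _ _ _ (cst 0)).
  near=> y; rewrite /expinv ltNge (_ : y <= 0)//.
  by apply: ltW; near: y; exact: lt_nbhsl.
- rewrite {2 3}/expinv x0.
  have iV : is_derive x 1 (fun y : R => y^-1) (- x ^- 2).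
    apply: DeriveDef; first by apply: derivableV => //; rewrite gt_eqF.
    by rewrite deriveV ?gt_eqF// derive_id /GRing.scale/= mulr1.
  have iE : is_derive x 1 (fun y : R => expR (- y^-1)) (expR (- x^-1) * (x ^- 2)).
    have := @is_derive1_comp R expR (fun y => - y^-1) x (expR (- x^-1)) (- - x ^- 2).
    have iN : is_derive x 1 (fun y : R => - y^-1) (- - x ^- 2) by exact: is_deriveN.
    by move=> /(_ (is_derive_expR _) iN); rewrite opprK.
  have iX := @is_deriveX _ _ (fun y : R => y^-1) j x 1 _ iV.
  have H := is_deriveM iX iE.
  have EX k (z : R) : ((fun y : R => y^-1) ^+ k) z = z^-1 ^+ k.
    by elim: k => // k IH; rewrite !exprS -IH.
  apply: (is_derive_eq (near_eq_is_derive _ H)).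
    near=> y; rewrite /expinv ifT; first by rewrite -EX.
    by near: y; exact: lt_nbhsr.
  rewrite EX.
  rewrite /GRing.scale/= -!exprVn; move: (x^-1) (expR _) => y E.
  case: (j) => [|k]; first by rewrite !expr0 !exprS; ring.
  by rewrite !exprS /=; move: (y ^+ k) (k.+1%:R) => a b; rewrite expr0; ring.
- rewrite {2 3}/expinv ltxx mulr0 subr0.
  apply: cvg_is_derive.
  have [C C0 HC] := @expinv_bound R j.+1.
  apply/cvgr0Pnorm_le => e e0; near=> h.
  have h0 : h != 0 by near: h; exact: nbhs_dnbhs_neq.
  rewrite {2}/expinv ltxx subr0 addr0 [_%:A]mulr1 /GRing.scale/= normrM.
  have [hp|hn] := ltP 0 h; last first.
    by rewrite /expinv ltNge hn/= normr0 mulr0 ltW.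
  rewrite (ger0_norm (expinv_ge0 _ _)) gtr0_norm ?invr_gt0//.
  rewrite (_ : _ * _ = expinv j.+1 h); last first.
    by rewrite /expinv hp exprS mulrA.
  rewrite (le_trans (HC h))// (@le_trans _ _ ((C + 1) * `|h|))//.
    by rewrite ler_wpM2r// lerDl.
  rewrite -ler_pdivlMl ?ltr_wpDl// mulrC; near: h.
  by apply: dnbhs0_le; rewrite divr_gt0// ltr_wpDl.
Unshelve. all: by end_near. Qed.

(** A set of functions closed under differentiation that contains the bumps
    below. *)
Inductive expinv_algebra (R : realType) : (R -> R) -> Prop :=
| expinv_algebra_atom j c d : expinv_algebra (fun x => expinv j (c * x + d))
| expinv_algebra_cst k : expinv_algebra (fun=> k)
| expinv_algebra_add f g : expinv_algebra f -> expinv_algebra g ->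
    expinv_algebra (fun x => f x + g x)
| expinv_algebra_mul f g : expinv_algebra f -> expinv_algebra g ->
    expinv_algebra (fun x => f x * g x).

Lemma expinv_algebra_smooth1 (R : realType) (f : R -> R) :
  expinv_algebra f -> smooth1 f.
Proof.
exists (@expinv_algebra R) => // g; elim => {f g H} [j c d|k|f g _ [f' f'A df] _ [g' g'A dg]|f g fA [f' f'A df] gA [g' g'A dg]].
- exists (fun x => c * (expinv j.+2 (c * x + d) + (- j%:R) * expinv j.+1 (c * x + d))).
    apply: expinv_algebra_mul; first exact: expinv_algebra_cst.
    apply: expinv_algebra_add; first exact: expinv_algebra_atom.
    by apply: expinv_algebra_mul; [exact: expinv_algebra_cst|exact: expinv_algebra_atom].
  move=> x.
  have da : is_derive x 1 (fun x : R => c * x + d) c.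
    have := is_deriveD (is_deriveM (is_derive_cst c x 1) (is_derive_id x 1)) (is_derive_cst d x 1).
    by rewrite /GRing.scale/= mulr1 mulr0 !addr0; apply.
  have := @is_derive1_comp _ _ (fun x : R => c * x + d) x _ _ (is_derive_expinv j (c * x + d)) da.
  by rewrite mulrC mulNr.
- by exists (fun=> 0); [exact: expinv_algebra_cst|move=> x; exact: is_derive_cst].
- exists (fun x => f' x + g' x); first exact: expinv_algebra_add.
  by move=> x; exact: is_deriveD.
- exists (fun x => f x * g' x + g x * f' x).
    by apply: expinv_algebra_add; exact: expinv_algebra_mul.
  by move=> x; exact: is_deriveM.
Qed.

Lemma smooth1_continuous (R : realType) (f : R -> R) : smooth1 f -> continuous f.
Proof.
move=> [D Df DD] x; have [f' _ /(_ x) [df _]] := DD f Df.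
exact/differentiable_continuous/derivable1_diffP.
Qed.

(** It increases with k to the indicator function of the interval from a to b. *)
Definition bump (R : realType) (a b : R) (k : nat) (x : R) : R :=
  expinv 0 (k.+1%:R * x + - (k.+1%:R * a)) * expinv 0 (- k.+1%:R * x + k.+1%:R * b).

Lemma bump_smooth1 (R : realType) (a b : R) k : smooth1 (bump a b k).
Proof.
apply: expinv_algebra_smooth1; apply: expinv_algebra_mul; exact: expinv_algebra_atom.
Qed.

Lemma bump_ge0 (R : realType) (a b : R) k x : 0 <= bump a b k x.
Proof. by rewrite mulr_ge0// expinv_ge0. Qed.

Lemma bump_le1 (R : realType) (a b : R) k x : bump a b k x <= 1.
Proof. by rewrite mulr_ile1// ?expinv_ge0// expinv_le1. Qed.

Lemma bump_eq0 (R : realType) (a b : R) k x : ~~ (a < x < b) -> bump a b k x = 0.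
Proof.
rewrite negb_and -!leNgt /bump /expinv => /orP[xa|bx].
  by rewrite ifF ?mul0r// -mulrBr pmulr_rgt0// subr_gt0 ltNge xa.
by rewrite [X in _ * X]ifF ?mulr0// mulNr addrC -mulrBr pmulr_rgt0// subr_gt0 ltNge bx.
Qed.

Lemma cvg_expinv0 (R : realType) (c : R) : 0 < c ->
  (fun k => expinv 0 (k.+1%:R * c)) @ \oo --> (1 : R).
Proof.
move=> c0.
rewrite (_ : (fun _ => _) = (fun k => expR (- (k.+1%:R^-1 * c^-1)))); last first.
  by apply/funext => k; rewrite /expinv mulr_gt0// expr0 mul1r invfM.
rewrite -[X in _ --> X]expR0 -[X in expR X]oppr0 -[X in expR (- X)](mul0r c^-1).
apply: continuous_cvg; first exact: continuous_expR.
by apply: cvgN; apply: cvgMl; exact: cvg_harmonic.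
Qed.

Lemma cvg_bump (R : realType) (a b x : R) :
  (fun k => bump a b k x) @ \oo --> ((a < x < b)%R%:R : R).
Proof.
case: (boolP (a < x < b)) => [/andP[ax xb]|nx]; last first.
  rewrite (_ : (fun _ => _) = (fun=> 0)); first exact: cvg_cst.
  by apply/funext => k; rewrite bump_eq0.
rewrite (_ : (fun _ => _) = (fun k => expinv 0 (k.+1%:R * (x - a)) * expinv 0 (k.+1%:R * (b - x)))); last first.
  by apply/funext => k; rewrite /bump; congr (expinv _ _ * expinv _ _); ring.
rewrite -[X in _ --> X](mulr1 1).
by apply: cvgM; apply: cvg_expinv0; rewrite subr_gt0.
Qed.

Definition test_function1 (R : realType) (f : R -> R) :=
  smooth1 f /\ exists r : R, forall x, r < `|x| -> f x = 0.

Lemma bump_test_function1 (R : realType) (a b : R) k : test_function1 (bump a b k).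
Proof.
split; first exact: bump_smooth1.
exists (`|a| + `|b|) => x xr; apply: bump_eq0; apply/negP => /andP[ax xb].
move: xr; apply/negP; rewrite -leNgt ler_norml.
have := ler_norm b; have := ler_norm (- a); rewrite normrN.
have := normr_ge0 a; have := normr_ge0 b.
by move=> *; apply/andP; split; lra.
Qed.

Lemma test_function1_integrable (R : realType) (f : R -> R) : test_function1 f ->
  lebesgue_measure.-integrable setT (EFin \o f).
Proof.
move=> [sf [r fr]].
have cf := smooth1_continuous sf.
have : lebesgue_measure.-integrable `[- r, r] (EFin \o f).
  apply: continuous_compact_integrable; first exact: segment_compact.
  exact: continuous_subspaceT.
rewrite integrable_mkcond//; congr (_.-integrable _ _).
apply/funext => x; rewrite patchE; case: ifPn => //.
rewrite notin_setE/= in_itv/= => /negP; rewrite -ler_norml -ltNge => xr.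
by rewrite fr.
Qed.

(** The integral of f from -oo, by the fundamental theorem of calculus. *)
Lemma test_function1_antiderivative (R : realType) (f : R -> R) : test_function1 f ->
  exists B : R -> R, forall x : R, is_derive x 1 B (f x).
Proof.
move=> bf; have [sf _] := bf.
exists (fun x => \int[lebesgue_measure]_(t in `]-oo, x]) f t)%R => x.
have [||||dB dBE] := @continuous_FTC1 R f -oo%O x (x + 1).
- by rewrite ltrDl.
- by apply: integrableS (test_function1_integrable bf).
- by rewrite ltNyr.
- exact: smooth1_continuous.
- by apply: DeriveDef => //; rewrite -derive1E.
Qed.

Definition steklov (R : realType) (h : R) (f : R -> R) (x : R) : R :=
  \int[lebesgue_measure]_(t in `[0, 1]) f (x - t * h).

(** The average is a difference quotient of an antiderivative, so that the
    derivative of the average is a difference quotient of f. *)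
Lemma steklovE (R : realType) (h : R) (f B : R -> R) (x : R) :
  0 < h -> continuous f -> (forall x : R, is_derive x 1 B (f x)) ->
  steklov h f x = h^-1 * (B x - B (x - h)).
Proof.
move=> h0 cf dB; rewrite /steklov /Rintegral.
have da (t : R) : is_derive t 1 (fun t : R => x - t * h) (- h).
  apply: (is_derive_eq (is_deriveB (is_derive_cst x t 1) (is_deriveM (is_derive_id t 1) (is_derive_cst h t 1)))).
  by rewrite /GRing.scale/=; ring.
pose F t := - h^-1 * B (x - t * h).
have dF (t : R) : is_derive t 1 F (f (x - t * h)).
  have H := @is_derive1_comp _ _ (fun t : R => x - t * h) t _ _ (dB (x - t * h)) (da t).
  apply: (is_derive_eq (is_deriveM (is_derive_cst (- h^-1) t 1) H)).
  by rewrite /GRing.scale/=; field; rewrite gt_eqF.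
have cF : continuous F.
  move=> t; apply/differentiable_continuous/derivable1_diffP.
  by have [] := dF t.
rewrite (@continuous_FTC2 _ _ F)//.
- rewrite -EFinB/= /F mul1r mul0r subr0; ring.
- apply: continuous_subspaceT => t.
  apply: continuous_comp; last exact: cf.
  by apply/differentiable_continuous/derivable1_diffP; have [] := da t.
- split.
  + by move=> t _; have [] := dF t.
  + by apply: cvg_at_right_filter; exact: cF.
  + by apply: cvg_at_left_filter; exact: cF.
- by move=> t _; rewrite derive1E; have [_ ->] := dF t.
Qed.

Lemma is_derive_steklov (R : realType) (h : R) (f : R -> R) (x : R) :
  0 < h -> test_function1 f -> is_derive x 1 (steklov h f) (h^-1 * (f x - f (x - h))).
Proof.
move=> h0 bf; have [B dB] := test_function1_antiderivative bf.
have cf : continuous f by case: bf => /smooth1_continuous.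
rewrite (_ : steklov h f = fun x => h^-1 * (B x - B (x - h))); last first.
  by apply/funext => y; exact: steklovE.
have ds : is_derive x 1 (fun x : R => x - h) 1.
  have := is_deriveB (is_derive_id x 1) (is_derive_cst h x 1).
  by rewrite subr0; apply.
have H := @is_derive1_comp _ B (fun x : R => x - h) x _ _ (dB (x - h)) ds.
have := is_deriveM (is_derive_cst h^-1 x 1) (is_deriveB (dB x) H).
by rewrite /GRing.scale/= mulr0 addr0 mulr1; apply.
Qed.

(** The derivatives of a Steklov average are the difference quotients of those of
    f, hence a set closed under differentiation. *)
Lemma steklov_test_function1 (R : realType) (h : R) (f : R -> R) :
  0 < h -> test_function1 f -> test_function1 (steklov h f).
Proof.
move=> h0 bf; have [[D Df DD] [r fr]] := bf; split.
  exists [set g | g = steklov h f \/ exists2 d, D d & g = fun x => h^-1 * (d x - d (x - h))].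
    by left.
  move=> _ [->|[d Dd ->]].
    exists (fun x => h^-1 * (f x - f (x - h))); first by right; exists f.
    by move=> x; exact: is_derive_steklov.
  have [d' Dd' dd'] := DD _ Dd.
  exists (fun x => h^-1 * (d' x - d' (x - h))); first by right; exists d'.
  move=> x.
  have ds : is_derive x 1 (fun x : R => x - h) 1.
    have := is_deriveB (is_derive_id x 1) (is_derive_cst h x 1).
    by rewrite subr0; apply.
  have H := @is_derive1_comp _ d (fun x : R => x - h) x _ _ (dd' (x - h)) ds.
  have := is_deriveM (is_derive_cst h^-1 x 1) (is_deriveB (dd' x) H).
  by rewrite /GRing.scale/= mulr0 addr0 mulr1; apply.
exists (r + h) => x xr; rewrite /steklov.
rewrite (@eq_Rintegral _ _ _ _ _ (cst 0)); last first.
  move=> t; rewrite inE/= in_itv/= => /andP[t0 t1].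
  apply: fr; have := ler_normD (x - t * h) (t * h); rewrite subrK (ger0_norm (_ : 0 <= t * h)); last first.
    by rewrite mulr_ge0// ltW.
  have : t * h <= h by rewrite ler_piMl// ltW.
  by move=> *; lra.
by rewrite Rintegral_cst// mul0r.
Qed.

(** * Product test functions *)

Definition prodf (R : realType) n (c : 'I_n -> R -> R) (x : 'rV[R]_n) : R :=
  \prod_(i < n) c i (x ord0 i).

Definition upd (R : realType) n (c : 'I_n -> R -> R) (i : 'I_n) (d : R -> R) :=
  fun j => if j == i then d else c j.

Lemma prodf_updE (R : realType) n (c : 'I_n -> R -> R) i d (x : 'rV[R]_n) :
  prodf (upd c i d) x = d (x ord0 i) * \prod_(j < n | j != i) c j (x ord0 j).
Proof.
rewrite /prodf (bigD1 i)//= /upd eqxx; congr (_ * _).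
by apply: eq_bigr => j /negPf ->.
Qed.

Lemma upd_id (R : realType) n (c : 'I_n -> R -> R) i : upd c i (c i) = c.
Proof. by apply/funext => j; rewrite /upd; case: eqP => // ->. Qed.

Lemma prodf_translate (R : realType) n (c : 'I_n -> R -> R) i (x : 'rV[R]_n) t :
  prodf c (x + t *: delta_mx ord0 i) =
  c i (x ord0 i + t) * \prod_(j < n | j != i) c j (x ord0 j).
Proof.
rewrite -{1}(upd_id c i) prodf_updE !mxE !eqxx mulr1; congr (_ * _).
by apply: eq_bigr => j /negPf ji; rewrite !mxE ji andbF mulr0 addr0.
Qed.

Lemma is_derive_prodf (R : realType) n (c : 'I_n -> R -> R) i (d : R -> R) (x : 'rV[R]_n) :
  is_derive (x ord0 i) 1 (c i) (d (x ord0 i)) ->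
  is_derive x (delta_mx ord0 i) (prodf c) (prodf (upd c i d) x).
Proof.
move=> [dc dcE]; apply: cvg_is_derive.
rewrite prodf_updE -dcE.
have E0 : prodf c x = c i (x ord0 i) * \prod_(j < n | j != i) c j (x ord0 j).
  by rewrite -{1}(upd_id c i) prodf_updE.
rewrite (_ : (fun h => _) = (fun h => h^-1 *: (c i (h *: 1 + x ord0 i) - c i (x ord0 i)) *
   \prod_(j < n | j != i) c j (x ord0 j))); last first.
  apply/funext => h; rewrite (addrC (h *: _)) prodf_translate E0.
  rewrite [_%:A]mulr1 (addrC h) -mulrBl.
  by rewrite /GRing.scale/= mulrA.
by apply: cvgMl; exact: dc.
Qed.

Lemma continuous_prodf (R : realType) n (c : 'I_n -> R -> R) :
  (forall i, continuous (c i)) -> continuous (prodf c).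
Proof.
move=> cc; apply: continuous_big => [| i _]; first exact: mul_continuous.
by move=> x; apply: continuous_comp; [exact: coord_continuous|exact: cc].
Qed.

(** Differentiating a product along one axis differentiates one factor, so the
    iterated partial derivatives are again products. *)
Lemma smooth_prodf (R : realType) n (c : 'I_n -> R -> R) :
  (forall i, smooth1 (c i)) -> smooth (prodf c).
Proof.
move=> sc s.
suff [c' [sc' ->]] : exists c', (forall i, smooth1 (c' i)) /\
    foldr (@partial R n) (prodf c) s = prodf c'.
  split; first by apply: continuous_prodf => i; exact: smooth1_continuous.
  move=> i x; have [D Dc DD] := sc' i; have [d _ /(_ (x ord0 i)) H] := DD _ Dc.
  by have [] := is_derive_prodf H.
elim: s => [|i s [c' [sc' E]]]; first by exists c.
have [D Dc DD] := sc' i; have [d Dd H] := DD _ Dc.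
exists (upd c' i d); split.
  by move=> j; rewrite /upd; case: eqP => // _; exists D.
rewrite /= E; apply/funext => x; rewrite /partial.
by have [_] := is_derive_prodf (H (x ord0 i)).
Qed.

Lemma cube_support_compact (R : realType) n (f : 'rV[R]_n -> R) (r : R) :
  (forall (x : 'rV[R]_n) i, r < `|x ord0 i| -> f x = 0) -> compact (closure [set x | f x != 0]).
Proof.
move=> fr; apply: bounded_closed_compact; last exact: closed_closure.
have cl : closed [set x : 'rV[R]_n | `|x| <= Num.max 0 r].
  apply: (closed_comp (f := fun x : 'rV[R]_n => `|x|)) (@closed_le R (Num.max 0 r)).
  by move=> x _; exact: norm_continuous.
exists (Num.max 0 r); split; first exact: num_real.
move=> M rM x cx; apply: le_trans (ltW rM).
suff : [set x : 'rV[R]_n | `|x| <= Num.max 0 r] x by [].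
move: cl => /closure_id ->; apply: closureS cx => y /= fy.
rewrite [leLHS]mx_normrE; apply: bigmax_le => [|[k j] _]; first by rewrite le_max lexx.
rewrite (ord1 k) /= le_max; apply/orP; right; rewrite leNgt; apply/negP => ry.
by move: fy; rewrite (fr _ _ ry) eqxx.
Qed.

Lemma test_function_prodf (R : realType) n (c : 'I_n -> R -> R) :
  (forall i, test_function1 (c i)) -> test_function (prodf c).
Proof.
move=> bc; split; first by apply: smooth_prodf => i; have [] := bc i.
have /choice[r Hr] : forall i, exists r : R, forall x, r < `|x| -> c i x = 0.
  by move=> i; have [] := bc i.
apply: (@cube_support_compact _ _ _ (\sum_i `|r i|)) => x i xi.
rewrite /prodf (bigD1 i)//= Hr ?mul0r// (le_lt_trans _ xi)//.
by rewrite (bigD1 i)//= (le_trans (ler_norm _))// lerDl sumr_ge0.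
Qed.

Definition loc_int (R : realType) n (f : 'rV[R]_n -> R) :=
  measurable_fun setT f /\
  forall K : nat, leb.-integrable (cube n K%:R) (EFin \o f).

Lemma box_sub_cube (R : realType) n (a b : 'I_n -> R) :
  exists K : nat, box a b `<=` cube n K%:R.
Proof.
exists (Num.bound (\sum_i (`|a i| + `|b i|))) => x xab i.
rewrite -ltr_norml (le_lt_trans _ (archi_boundP _))//; last first.
  by apply: sumr_ge0 => j _; rewrite addr_ge0.
rewrite (bigD1 i)//=; apply: (@le_trans _ _ (`|a i| + `|b i|)); last first.
  by rewrite lerDl; apply: sumr_ge0 => j _; rewrite addr_ge0.
have /andP[x1 x2] := xab i.
have := ler_norm (- a i); have := ler_norm (b i); rewrite normrN.
have := normr_ge0 (a i); have := normr_ge0 (b i).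
by rewrite ler_norml => *; apply/andP; split; lra.
Qed.

Lemma loc_int_box (R : realType) n (f : 'rV[R]_n -> R) (a b : 'I_n -> R) :
  loc_int f -> leb.-integrable (box a b) (EFin \o f).
Proof.
move=> [mf fi]; have [K Kab] := box_sub_cube a b.
by apply: (integrableS _ _ Kab (fi K)); exact: measurable_box.
Qed.

Lemma prodf_bump_box (R : realType) n (a b : 'I_n -> R) k (x : 'rV[R]_n) :
  ~ box a b x -> prodf (fun i => bump (a i) (b i) k) x = 0.
Proof.
move=> /existsNP[i /negP nx].
by rewrite /prodf (bigD1 i)//= bump_eq0 ?mul0r.
Qed.

(** The product bumps of a box increase to its indicator function; by dominated
    convergence the integrals of f over all boxes vanish. *)
Lemma ae_eq0_of_test (R : realType) n (f : 'rV[R]_n -> R) :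
  loc_int f ->
  (forall c, (forall i, test_function1 (c i)) -> (\int[leb]_x (f x * prodf c x)%:E = 0)%E) ->
  {ae leb, forall x, f x = 0}.
Proof.
move=> fi f0; have [mf fiK] := fi.
apply: ae_eq0_of_integral_box => // a b.
pose c k i := bump (a i) (b i) k.
have bc k i : test_function1 (c k i) by exact: bump_test_function1.
have mbox := measurable_box a b.
have [|||||_ _] := @dominated_convergence _ _ R leb setT measurableT
  (fun k x => (f x * prodf (c k) x)%:E) ((EFin \o f) \_ (box a b))
  ((fun x => `|f x|%:E) \_ (box a b)).
- move=> k; apply/measurable_EFinP; apply: measurable_funM => //.
  apply: continuous_measurable_rV; apply: continuous_prodf => i.
  by apply: smooth1_continuous; have [] := bc k i.
- apply/(measurable_restrictT _ _).1 => //.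
  by apply/measurable_EFinP; exact: measurable_funTS.
- apply: aeW => x _.
  rewrite patchE; case: ifPn => [/set_mem xab|]; last first.
    rewrite notin_setE => xab; apply: cvg_near_cst; near=> k.
    by rewrite prodf_bump_box// mulr0.
  apply: cvg_EFin; first exact: nearW.
  rewrite [X in X @ \oo](_ : _ = fun k => f x * prodf (c k) x)//.
  rewrite -[X in _ --> X]mulr1; apply: cvgM; first exact: cvg_cst.
  rewrite [X in _ --> X](_ : _ = \prod_(i < n) (a i < x ord0 i < b i)%R%:R); last first.
    by rewrite big1// => i _; rewrite xab.
  by apply: cvg_big => [|i _]; [exact: mul_continuous|exact: cvg_bump].
- by have := integrable_abse (loc_int_box a b fi); rewrite integrable_mkcond.
- apply: aeW => x k _; rewrite patchE; case: ifPn => [/set_mem xab|]; last first.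
    by rewrite notin_setE => xab; rewrite prodf_bump_box// mulr0 abse0.
  rewrite abse_EFin lee_fin normrM ler_piMr// ger0_norm.
    by apply: prodr_ile1 => i _; rewrite bump_ge0 bump_le1.
  by apply: prodr_ge0 => i _; exact: bump_ge0.
rewrite (_ : [sequence _]_n = cst 0%E); last first.
  by apply/funext => k /=; apply: f0.
move=> /cvg_lim; rewrite lim_cst// => /(_ _)/esym.
by rewrite -integral_mkcond => ->.
Unshelve. all: by end_near. Qed.

(** * Averages along segments *)

(** Unlike the test functions, this class contains the indicator functions of the
    cubes, so that a pairing with it also tests local integrability. *)
Definition bdd_cptsupp (R : realType) n (phi : 'rV[R]_n -> R) :=
  measurable_fun setT phi /\
  exists (M : R) (K : nat), forall x, `|phi x| <= M * \1_(cube n K%:R) x.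

Lemma bdd_cptsupp_integrable (R : realType) n (f phi : 'rV[R]_n -> R) :
  loc_int f -> bdd_cptsupp phi -> leb.-integrable setT (fun x => (f x * phi x)%:E).
Proof.
move=> [mf fi] [mphi [M [K phiM]]].
have mK : measurable (cube n K%:R : set 'rV[R]_n) := measurable_box _ _.
have H : leb.-integrable setT (fun x => M%:E * ((EFin \o f) \_ (cube n K%:R)) x)%E.
  by apply: integrableZl => //; rewrite -integrable_mkcond.
apply: (le_integrable _ _ _ H) => //.
  by apply/measurable_EFinP; apply: measurable_funM.
move=> x _; rewrite patchE; have := phiM x; rewrite indicE.
case: ifPn => xK; rewrite ?mulr1 ?mulr0.
  move=> H1; rewrite -EFinM !abse_EFin lee_fin !normrM mulrC.
  by rewrite ler_wpM2r// (le_trans H1)// ler_norm.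
by rewrite normr_le0 => /eqP ->; rewrite mulr0 mule0.
Qed.

Lemma bdd_cptsupp_cube (R : realType) n (K : nat) : bdd_cptsupp (\1_(cube n K%:R) : 'rV[R]_n -> R).
Proof.
split; first by apply: measurable_indic; exact: measurable_box.
by exists 1, K => x; rewrite mul1r ger0_norm// indicE.
Qed.

Lemma cube_translate (R : realType) n (K : nat) (i : 'I_n) (h : R) :
  exists K' : nat, forall (x : 'rV[R]_n) t, 0 <= t <= 1 ->
   cube n K%:R (x - (t * h) *: delta_mx ord0 i) -> cube n K'%:R x.
Proof.
exists (K + Num.bound `|h|)%N => x t /andP[t0 t1] xK j.
have := xK j; rewrite !mxE eqxx/= -!ltr_norml natrD => H.
have bh : `|h| < (Num.bound `|h|)%:R := archi_boundP (normr_ge0 h).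
have th : `|t * h * (j == i)%:R| < (Num.bound `|h|)%:R.
  rewrite !normrM (le_lt_trans _ bh)// (@le_trans _ _ (1 * `|h| * 1))//.
    apply: ler_pM => //; rewrite ?mulr_ge0//; last by case: eqP => _; rewrite ?normr1 ?normr0.
    by apply: ler_wpM2r => //; rewrite ger0_norm.
  by rewrite mul1r mulr1.
have := ler_normD (x ord0 j - t * h * (j == i)%:R) (t * h * (j == i)%:R).
by rewrite subrK => /le_lt_trans; apply; exact: ltrD.
Qed.

Lemma measurable_shear (R : realType) n (i : 'I_n) (h : R) :
  measurable_fun setT (fun z : R * 'rV[R]_n => z.2 + (z.1 * h) *: delta_mx ord0 i).
Proof.
apply: measurable_fun_rVP => j.
under eq_fun do rewrite !mxE.
apply: measurable_funD.
  exact: (measurableT_comp (measurable_coord_rV j) measurable_snd).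
by apply: measurable_funM => //; apply: measurable_funM.
Qed.

Definition line_avg (R : realType) n (i : 'I_n) (h : R) (g : 'rV[R]_n -> R) (x : 'rV[R]_n) : R :=
  \int[lebesgue_measure]_(t in `[0, 1]) g (x + (t * h) *: delta_mx ord0 i).

Lemma unit_indicE (R : realType) (f : R -> R) :
  (\int[lebesgue_measure]_(t in `[0%R, 1%R]) (f t)%:E =
   \int[lebesgue_measure]_t (\1_`[0%R, 1%R] t * f t)%:E)%E.
Proof.
rewrite integral_mkcond; apply: eq_integral => t _.
by rewrite patchE indicE; case: ifPn => _; rewrite ?mul1r ?mul0r.
Qed.

Lemma measurable_line_avg (R : realType) n (i : 'I_n) (h : R) (g : 'rV[R]_n -> R) :
  measurable_fun setT g -> measurable_fun setT (line_avg i h g).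
Proof.
move=> mg.
pose F (z : R * 'rV[R]_n) : \bar R := (\1_`[0%R, 1%R] z.1 * g (z.2 + (z.1 * h) *: delta_mx ord0 i))%:E.
have mF : measurable_fun setT F.
  apply/measurable_EFinP; apply: measurable_funM.
    by apply: measurableT_comp => //; exact: measurable_indic.
  by apply: measurableT_comp => //; exact: measurable_shear.
pose G x : \bar R := (\int[lebesgue_measure]_t F (t, x))%E.
rewrite (_ : line_avg i h g = fine \o G); last first.
  by apply/funext => x; rewrite /line_avg /Rintegral unit_indicE.
apply: measurableT_comp; first exact: fine_measurable.
rewrite [X in measurable_fun _ X](_ : _ = fun x => (fubini_G lebesgue_measure F^\+ x - fubini_G lebesgue_measure F^\- x)%E); last first.
  apply/funext => x; rewrite /G /fubini_G [LHS]integralE.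
  by rewrite (funepos_comp F (fun t => (t, x))) (funeneg_comp F (fun t => (t, x))).
apply: emeasurable_funB.
  by apply: measurable_fun_fubini_tonelli_G => //; exact: measurable_funepos.
by apply: measurable_fun_fubini_tonelli_G => //; exact: measurable_funeneg.
Qed.

(** The pairing of g with the averages of phi over segments in the direction
    -e_i, as an integrand on the product of [0, 1] and R^n.  The cut-off to
    [0, 1] is a factor so that the domain of integration is the whole space. *)
Definition sheared (R : realType) n (i : 'I_n) (h : R) (g phi : 'rV[R]_n -> R) (z : R * 'rV[R]_n) : \bar R :=
  (\1_`[0%R, 1%R] z.1 * (g z.2 * phi (z.2 - (z.1 * h) *: delta_mx ord0 i)))%:E.

Lemma measurable_sheared (R : realType) n (i : 'I_n) (h : R) (g phi : 'rV[R]_n -> R) :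
  measurable_fun setT g -> measurable_fun setT phi ->
  measurable_fun setT (sheared i h g phi).
Proof.
move=> mg mphi; apply/measurable_EFinP; apply: measurable_funM.
  by apply: measurableT_comp => //; exact: measurable_indic.
apply: measurable_funM; first exact: measurableT_comp.
apply: measurableT_comp => //.
under eq_fun do rewrite -scaleNr -mulrN.
exact: measurable_shear.
Qed.

Lemma sheared_bound (R : realType) n (i : 'I_n) (h : R) (g phi : 'rV[R]_n -> R)
    (M : R) (K K' : nat) :
  (forall x, `|phi x| <= M * \1_(cube n K%:R) x) ->
  (forall (x : 'rV[R]_n) t, 0 <= t <= 1 ->
     cube n K%:R (x - (t * h) *: delta_mx ord0 i) -> cube n K'%:R x) ->
  forall z, (`|sheared i h g phi z| <=
     (\1_`[0%R, 1%R] z.1)%:E * (`|M| * `|g z.2| * \1_(cube n K'%:R) z.2)%:E)%E.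
Proof.
move=> phiM KK' [t x]; rewrite /sheared -EFinM ?abse_EFin lee_fin !normrM /=.
rewrite !indicE; have [/set_mem/= t01|] := boolP (t \in `[0, 1]%classic);
  last by rewrite normr0 !mul0r.
rewrite normr1 !mul1r [leRHS]mulrAC mulrC; apply: ler_wpM2r => //.
have := phiM (x - (t * h) *: delta_mx ord0 i); rewrite indicE.
have [/set_mem xK H|_] := boolP (_ \in _); last first.
  by rewrite mulr0 => H; rewrite (le_trans H)// mulr_ge0.
rewrite mulr1 in H; rewrite mem_set ?mulr1.
  by rewrite (le_trans H)// ler_norm.
by apply: KK' xK; move: t01; rewrite in_itv.
Qed.

Lemma sheared_bound_integrable (R : realType) n (g : 'rV[R]_n -> R) (M : R) (K : nat) :
  loc_int g ->
  (lebesgue_measure \x leb)%E.-integrable setT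
    (fun z : measurableTypeR R * 'rV[R]_n =>
     (\1_`[0%R, 1%R] z.1)%:E * (`|M| * `|g z.2| * \1_(cube n K%:R) z.2)%:E)%E.
Proof.
move=> [mg gi].
have mK : measurable (cube n K%:R : set 'rV[R]_n) := measurable_box _ _.
pose G x := `|M| * `|g x| * \1_(cube n K%:R) x.
have mG : measurable_fun setT G.
  apply: measurable_funM; last exact: measurable_indic.
  by apply: measurable_funM => //; exact: measurableT_comp.
have G0 x : 0 <= G x by rewrite /G !mulr_ge0// indicE.
have iG : (\int[leb]_x (G x)%:E < +oo)%E.
  have : leb.-integrable setT (fun x => (`|M|%:E * ((fun x => `|g x|%:E) \_ (cube n K%:R)) x)%E).
    apply: integrableZl => //; rewrite -integrable_mkcond//.
    exact: integrable_abse (gi K).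
  move=> /integrableP[_]; apply: le_lt_trans.
  apply: ge0_le_integral => //.
  - by move=> x _; rewrite lee_fin.
  - exact/measurable_EFinP.
  - apply: measurableT_comp => //; apply: measurable_funeM => //.
    apply/(measurable_restrictT _ _).1 => //.
    by apply/measurable_EFinP; apply: measurable_funTS; exact: measurableT_comp.
  - move=> x _; rewrite /G patchE indicE; case: ifPn => _; last first.
      by rewrite mulr0 mule0 abse0.
    by rewrite mulr1 -EFinM abse_EFin lee_fin normrM !normr_id.
apply/integrableP; split.
  apply: emeasurable_funM; apply/measurable_EFinP.
    by apply: measurableT_comp => //; exact: measurable_indic.
  exact: (measurableT_comp mG measurable_snd).
rewrite (_ : (fun z => _) = (fun z : measurableTypeR R * 'rV[R]_n => (\1_`[0%R, 1%R] z.1 * G z.2)%:E)); last first.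
  by apply/funext => z; rewrite -EFinM abse_EFin ger0_norm// mulr_ge0.
rewrite fubini_tonelli1.
- rewrite /fubini_F /=.
  under eq_integral => t _.
    under eq_integral do rewrite EFinM.
    rewrite ge0_integralZl//; last 2 first.
      exact/measurable_EFinP.
      by move=> x _; rewrite lee_fin.
    over.
  rewrite ge0_integralZr//; last 2 first.
    by apply/measurable_EFinP; exact: measurable_indic.
    by apply: integral_ge0 => x _; rewrite lee_fin.
  rewrite integral_indic//= setIT lebesgue_measure_itv/= lte01 sube0 mul1e.
  exact: iG.
- apply/measurable_EFinP; apply: measurable_funM.
    by apply: measurableT_comp => //; exact: measurable_indic.
  exact: (measurableT_comp mG measurable_snd).
- by move=> z; rewrite lee_fin mulr_ge0.
Qed.

Lemma sheared_integrable (R : realType) n (i : 'I_n) (h : R) (g phi : 'rV[R]_n -> R) :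
  loc_int g -> bdd_cptsupp phi ->
  (lebesgue_measure \x leb)%E.-integrable setT
    (sheared i h g phi : measurableTypeR R * 'rV[R]_n -> \bar R).
Proof.
move=> lg [mphi [M [K phiM]]].
have [K' KK'] := @cube_translate R n K i h.
apply: (le_integrable _ _ _ (sheared_bound_integrable M K' lg)) => //.
  by apply: measurable_sheared => //; case: lg.
move=> z _; rewrite [leRHS]gee0_abs; first exact: sheared_bound phiM KK' z.
by rewrite -EFinM lee_fin !mulr_ge0// indicE.
Qed.

(** The composite of [sheared] with the translation x |-> x + t h e_i: here the
    averages bear on g. *)
Definition sheared_left (R : realType) n (i : 'I_n) (h : R) (g phi : 'rV[R]_n -> R)
    (z : R * 'rV[R]_n) : \bar R :=
  (\1_`[0%R, 1%R] z.1 * (g (z.2 + (z.1 * h) *: delta_mx ord0 i) * phi z.2))%:E.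

Lemma sheared_left_integrable (R : realType) n (i : 'I_n) (h : R) (g phi : 'rV[R]_n -> R) :
  loc_int g -> bdd_cptsupp phi ->
  (lebesgue_measure \x leb)%E.-integrable setT
    (sheared_left i h g phi : measurableTypeR R * 'rV[R]_n -> \bar R) /\
  (\int[lebesgue_measure \x leb]_z sheared_left i h g phi z =
   \int[lebesgue_measure \x leb]_z sheared i h g phi z)%E.
Proof.
move=> lg bphi; have [mg _] := lg; have [mphi _] := bphi.
have iS := sheared_integrable i h lg bphi.
have mS := measurable_int _ iS.
set S := sheared i h g phi in iS mS *.
set F : measurableTypeR R * 'rV[R]_n -> \bar R := sheared_left i h g phi.
have FS t x : F (t, x) = S (t, x + (t * h) *: delta_mx ord0 i).
  by rewrite /F /S /sheared /sheared_left/= addrK.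
have mF : measurable_fun setT F.
  apply/measurable_EFinP; apply: measurable_funM.
    by apply: measurableT_comp => //; exact: measurable_indic.
  apply: measurable_funM; last exact: (measurableT_comp mphi measurable_snd).
  by apply: measurableT_comp => //; exact: measurable_shear.
have mS2 t : measurable_fun setT (fun x => S (t, x)).
  exact: (measurableT_comp mS (pair1_measurable t)).
have iF : (lebesgue_measure \x leb)%E.-integrable setT F.
  apply/integrableP; split => //.
  have := iS => /integrableP[_].
  rewrite fubini_tonelli1//; last exact: measurableT_comp.
  rewrite fubini_tonelli1//; last exact: measurableT_comp.
  congr (_ < _)%E; apply: eq_integral => t _; rewrite /fubini_F.
  under [RHS]eq_integral do rewrite FS.
  rewrite (ge0_integral_translation _ (f := fun x => `|S (t, x)|%E))//.
  exact: measurableT_comp.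
split => //.
rewrite -!integral12_prod_meas1//.
apply: eq_integral => t _; rewrite /fubini_F.
under eq_integral do rewrite FS.
by rewrite (integral_translation _ (f := fun x => S (t, x))).
Qed.

(** Fubini for the pairing with the indicator functions of the cubes: for almost
    every x the function g is integrable on the segment of origin x. *)
Lemma segment_slice_integrable (R : realType) n (i : 'I_n) (h : R) (g : 'rV[R]_n -> R) :
  loc_int g -> {ae leb, forall x, lebesgue_measure.-integrable setT
    (fun t : measurableTypeR R => (\1_`[0%R, 1%R] t * g (x + (t * h) *: delta_mx ord0 i))%:E)}.
Proof.
move=> lg.
have H (K : nat) := ae_integrable2 (sheared_left_integrable i h lg (@bdd_cptsupp_cube R n K)).1.
have := ae_foralln H; apply: filterS => x Hx.
have [K Kx] := cube_cover x.
apply: eq_integrable (Hx K) => // t _.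
by rewrite /sheared_left/= [X in _ * (_ * X)]indicE mem_set// mulr1.
Qed.

(** Averaging along the i-th axis is moved, by Fubini and translation
    invariance, from one factor of an integral to the other. *)
Lemma line_avg_integral (R : realType) n (i : 'I_n) (h : R) (g phi : 'rV[R]_n -> R) :
  loc_int g -> bdd_cptsupp phi ->
  leb.-integrable setT (fun x => (line_avg i h g x * phi x)%:E) /\
  (\int[leb]_x (line_avg i h g x * phi x)%:E =
   \int[lebesgue_measure \x leb]_z sheared i h g phi z)%E.
Proof.
move=> lg bphi; have [mg _] := lg; have [mphi _] := bphi.
have [iF FSE] := sheared_left_integrable i h lg bphi.
have mF := measurable_int _ iF.
set F : measurableTypeR R * 'rV[R]_n -> \bar R := sheared_left i h g phi in iF FSE mF.
have mG := measurable_fubini_G iF.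
have aeG : ae_eq leb setT (fubini_G lebesgue_measure F) (fun x => (line_avg i h g x * phi x)%:E).
  have := segment_slice_integrable i h lg; apply: filterS => x ig _.
  rewrite /fubini_G /line_avg /Rintegral unit_indicE EFinM fineK; last exact: integrable_fin_num.
  rewrite muleC -integralZl//; apply: eq_integral => t _.
  by rewrite /F/= -EFinM; congr EFin; rewrite mulrA mulrC.
have mavg : measurable_fun setT (fun x => (line_avg i h g x * phi x)%:E).
  by apply/measurable_EFinP; apply: measurable_funM => //; exact: measurable_line_avg.
split; last first.
  rewrite -FSE -integral21_prod_meas1//; apply: ae_eq_integral => //.
  by apply: filterS aeG => x /[apply] ->.
apply/integrableP; split => //.
apply: (@le_lt_trans _ _ (\int[leb]_x \int[lebesgue_measure]_t `|F (t, x)|)%E).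
  apply: ae_ge0_le_integral => //.
  - exact: measurableT_comp.
  - by move=> x _; exact: integral_ge0.
  - apply: (measurable_fun_fubini_tonelli_G (fun z => `|F z|%E)) => //.
    exact: measurableT_comp.
  apply: filterS aeG => x /[apply] <-; apply: le_abse_integral => //.
  exact: (measurableT_comp mF (pair2_measurable x)).
by have /integrable21ltyP := iF; exact.
Qed.

Lemma normr_coord_le (R : realType) n (x : 'rV[R]_n) i : `|x ord0 i| <= `|x|.
Proof.
rewrite [leRHS]mx_normrE.
exact: (le_bigmax _ (fun k : 'I_1 * 'I_n => `|x k.1 k.2|) (ord0, i)).
Qed.

Lemma bdd_cptsupp_of_continuous (R : realType) n (phi : 'rV[R]_n -> R) (A : set 'rV[R]_n) :
  continuous phi -> compact A -> (forall x, ~ A x -> phi x = 0) -> bdd_cptsupp phi.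
Proof.
move=> cphi cA phi0; split; first exact: continuous_measurable_rV.
have [r [_ Hr]] := compact_bounded cA.
have [M [_ HM]] := compact_bounded (continuous_compact (continuous_subspaceT cphi) cA).
exists (Num.max 0 M + 1), (Num.bound `|Num.max 0 r + 1|) => x.
have M0 : 0 <= Num.max 0 M + 1 by rewrite addr_ge0// le_max lexx.
have [Ax|nAx] := pselect (A x); last first.
  by rewrite phi0// normr0 mulr_ge0// indicE.
rewrite indicE mem_set ?mulr1.
  apply: HM; last by exists x.
  by rewrite (@le_lt_trans _ _ (Num.max 0 M)) ?ltrDl// le_max lexx orbT.
move=> i; rewrite -ltr_norml; apply: (le_lt_trans (normr_coord_le x i)).
apply: le_lt_trans (archi_boundP (normr_ge0 _)).
apply: le_trans (ler_norm _); apply: Hr => //.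
by rewrite (@le_lt_trans _ _ (Num.max 0 r)) ?ltrDl// le_max lexx orbT.
Qed.

Lemma test_function_bdd_cptsupp (R : realType) n (phi : 'rV[R]_n -> R) :
  test_function phi -> bdd_cptsupp phi.
Proof.
move=> [sphi cphi]; apply: (bdd_cptsupp_of_continuous _ cphi); first by have [] := sphi [::].
move=> x nx; apply/eqP; apply: contra_notT nx => px.
exact: subset_closure.
Qed.

Lemma partial_bdd_cptsupp (R : realType) n (phi : 'rV[R]_n -> R) i :
  test_function phi -> bdd_cptsupp (partial i phi).
Proof.
move=> [sphi cphi]; apply: (bdd_cptsupp_of_continuous _ cphi); first by have [] := sphi [:: i].
move=> x nx; rewrite /partial (@near_eq_derive _ _ _ _ (cst 0)) ?derive_cst//.
have : open (~` closure [set x : 'rV[R]_n | phi x != 0]) by apply: closed_openC; exact: closed_closure.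
move=> /(_ _ nx); apply: filterS => y ny; apply/eqP; apply: contra_notT ny => py.
exact: subset_closure.
Qed.

Lemma bdd_cptsupp_norm (R : realType) n (phi : 'rV[R]_n -> R) : bdd_cptsupp phi -> bdd_cptsupp (fun x => `|phi x|).
Proof.
move=> [mphi [M [K H]]]; split; first exact: measurableT_comp.
by exists M, K => x; rewrite normr_id.
Qed.

Lemma loc_int_indic (R : realType) n (f : 'rV[R]_n -> R) :
  measurable_fun setT f ->
  (forall K : nat, leb.-integrable setT (fun x => (f x * \1_(cube n K%:R) x)%:E)) ->
  loc_int f.
Proof.
move=> mf H; split => // K; rewrite integrable_mkcond; last exact: measurable_box.
rewrite (_ : _ \_ _ = fun x => (f x * \1_(cube n K%:R) x)%:E)//; apply/funext => x.
by rewrite patchE indicE; case: ifPn => _; rewrite ?mulr1 ?mulr0.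
Qed.

Lemma loc_int_line_avg (R : realType) n i h (g : 'rV[R]_n -> R) :
  loc_int g -> loc_int (line_avg i h g).
Proof.
move=> lg; apply: loc_int_indic; first by apply: measurable_line_avg; case: lg.
by move=> K; have [] := line_avg_integral i h lg (@bdd_cptsupp_cube R n K).
Qed.

Lemma loc_intB (R : realType) n (f g : 'rV[R]_n -> R) :
  loc_int f -> loc_int g -> loc_int (fun x => f x - g x).
Proof.
move=> [mf fi] [mg gi]; split; first exact: measurable_funB.
by move=> K; apply: (integrableB _ (fi K) (gi K)); exact: measurable_box.
Qed.

Lemma loc_intZ (R : realType) n (k : R) (f : 'rV[R]_n -> R) :
  loc_int f -> loc_int (fun x => k * f x).
Proof.
move=> [mf fi]; split; first exact: measurable_funM.
by move=> K; exact: (integrableZl (measurable_box _ _) k (fi K)).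
Qed.

Lemma loc_int_norm (R : realType) n (f : 'rV[R]_n -> R) :
  loc_int f -> loc_int (fun x => `|f x|).
Proof.
move=> [mf fi]; split; first exact: measurableT_comp.
by move=> K; exact: (integrable_abse (fi K)).
Qed.

Lemma loc_int_translation (R : realType) n (c : 'rV[R]_n) (f : 'rV[R]_n -> R) :
  loc_int f -> loc_int (fun x => f (x + c)).
Proof.
move=> lf; have [mf fi] := lf; split.
  exact: (measurableT_comp mf (measurable_fun_translation c)).
move=> K.
pose a (j : 'I_n) := - K%:R + c ord0 j; pose b (j : 'I_n) := K%:R + c ord0 j.
have := loc_int_box a b lf; rewrite integrable_mkcond; last exact: measurable_box.
move=> /(integrable_translation c).
rewrite [X in _ -> X]integrable_mkcond; last exact: measurable_box.
congr (_.-integrable _ _); apply/funext => x; rewrite !patchE.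
have -> : (x + c \in box a b) = (x \in cube n K%:R) => //.
by apply/idP/idP; rewrite !inE => H j; have := H j; rewrite /a/b mxE ltrD2r ltrD2r.
Qed.

Lemma prodfD1 (R : realType) n (c : 'I_n -> R -> R) i (x : 'rV[R]_n) :
  prodf c x = c i (x ord0 i) * \prod_(j < n | j != i) c j (x ord0 j).
Proof. by rewrite -{1}(upd_id c i) prodf_updE. Qed.

(** * Difference quotients of weakly differentiable functions *)

Definition weak_partial (R : realType) n (i : 'I_n) (u g : 'rV[R]_n -> R) :=
  forall phi, test_function phi ->
    (\int[leb]_x (u x * partial i phi x)%:E = - \int[leb]_x (g x * phi x)%:E)%E.

Lemma line_avg_prodf (R : realType) n (i : 'I_n) (h : R) (g : 'rV[R]_n -> R) (c : 'I_n -> R -> R) :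
  0 < h -> loc_int g -> (forall j, test_function1 (c j)) ->
  (\int[leb]_x (line_avg i h g x * prodf c x)%:E =
   \int[leb]_x (g x * prodf (upd c i (steklov h (c i))) x)%:E)%E.
Proof.
move=> h0 lg bc.
have bphi := test_function_bdd_cptsupp (test_function_prodf bc).
have [_ ->] := line_avg_integral i h lg bphi.
rewrite -integral21_prod_meas1; last exact: sheared_integrable.
apply: eq_integral => x _; rewrite /fubini_G /sheared/= prodf_updE /steklov /Rintegral.
set P := \prod_(j < n | _) _.
have ci : lebesgue_measure.-integrable `[0%R, 1%R] (fun t => (c i (x ord0 i - t * h))%:E).
  apply: continuous_compact_integrable; first exact: segment_compact.
  apply: continuous_subspaceT => t; apply: continuous_comp.
    by apply: cvgB; [exact: cvg_cst|apply: cvgMl; exact: cvg_id].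
  by have [/smooth1_continuous cc _] := bc i; exact: cc.
have fi : (\int[lebesgue_measure]_(t in `[0%R, 1%R]) (c i (x ord0 i - t * h))%:E)%E \is a fin_num.
  exact: integrable_fin_num.
rewrite EFinM EFinM fineK// muleA muleAC -EFinM -integralZl// integral_mkcond.
apply: eq_integral => t _; rewrite patchE indicE -scaleNr prodf_translate.
by case: ifPn => _; rewrite ?mul0r// mul1r -EFinM; congr EFin; rewrite -/P; ring.
Qed.

(** Discrete integration by parts, by translation invariance of the integral. *)
Lemma translation_adjoint (R : realType) n (e : 'rV[R]_n) (c : R) (w phi : 'rV[R]_n -> R) :
  loc_int w -> bdd_cptsupp phi ->
  (\int[leb]_x (c * (w (x + e) - w x) * phi x)%:E =
   \int[leb]_x (w x * (c * (phi (x - e) - phi x)))%:E)%E.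
Proof.
move=> lw bphi.
have iwe := bdd_cptsupp_integrable (loc_int_translation e lw) bphi.
have iw := bdd_cptsupp_integrable lw bphi.
have iwet : leb.-integrable setT (fun x => (w x * phi (x - e))%:E).
  have := integrable_translation (- e) iwe.
  by apply: eq_integrable => // x _; rewrite subrK.
have tE : (\int[leb]_x (w (x + e) * phi x)%:E = \int[leb]_x (w x * phi (x - e))%:E)%E.
  rewrite -(integral_translation e (f := fun x => (w x * phi (x - e))%:E)).
    by apply: eq_integral => x _; rewrite addrK.
  exact: measurable_int iwet.
have lin (F G : 'rV[R]_n -> R) : leb.-integrable setT (EFin \o F) ->
    leb.-integrable setT (EFin \o G) ->
    (\int[leb]_x (c * (F x - G x))%:E =
     c%:E * (\int[leb]_x (F x)%:E - \int[leb]_x (G x)%:E))%E.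
  move=> iF iG; rewrite -integralB_EFin// -integralZl//.
  exact: (integrableB measurableT iF iG).
under eq_integral do rewrite -mulrA mulrBl.
under [RHS]eq_integral do rewrite mulrCA mulrBr.
by rewrite !lin// tE.
Qed.

(** Testing with the Steklov average of a product bump turns the weak partial
    derivative into a difference quotient. *)
Lemma difference_quotient (R : realType) n (i : 'I_n) (h : R) (u g : 'rV[R]_n -> R) :
  0 < h -> loc_int u -> loc_int g -> weak_partial i u g ->
  {ae leb, forall x, h^-1 * (u (x + h *: delta_mx ord0 i) - u x) = line_avg i h g x}.
Proof.
move=> h0 lu lg ug.
pose e : 'rV[R]_n := h *: delta_mx ord0 i.
have lue := loc_int_translation e lu.
have ldq : loc_int (fun x => h^-1 * (u (x + e) - u x)).
  by apply: loc_intZ; exact: loc_intB.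
have lavg := loc_int_line_avg i h lg.
suff : {ae leb, forall x, h^-1 * (u (x + e) - u x) - line_avg i h g x = 0}.
  by apply: filterS => x /eqP; rewrite subr_eq0 => /eqP.
apply: ae_eq0_of_test => [|c bc]; first exact: loc_intB.
have tphi := test_function_prodf bc.
have bphi := test_function_bdd_cptsupp tphi.
pose d := upd c i (steklov h (c i)).
have bd j : test_function1 (d j).
  rewrite /d /upd; case: eqP => [_|_]; last exact: bc.
  by apply: steklov_test_function1.
have tpsi := test_function_prodf bd.
have di : d i = steklov h (c i) by rewrite /d /upd eqxx.
have dpsi x : partial i (prodf d) x = h^-1 * (prodf c x - prodf c (x - e)).
  have H := @is_derive_steklov _ h (c i) (x ord0 i) h0 (bc i).
  have := @is_derive_prodf _ _ d i (fun y => h^-1 * (c i y - c i (y - h))) x.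
  rewrite di => /(_ H)[_]; rewrite /partial => ->.
  rewrite prodf_updE (prodfD1 c i) /e -scaleNr prodf_translate.
  rewrite (eq_bigr (fun j => c j (x ord0 j))) => [|j /negPf ji]; last by rewrite /d /upd ji.
  ring.
have := ug _ tpsi; rewrite -line_avg_prodf// => uE.
have iavg := bdd_cptsupp_integrable lavg bphi.
have idq := bdd_cptsupp_integrable ldq bphi.
under eq_integral do rewrite mulrBl EFinB.
rewrite integralB_EFin//.
rewrite (_ : (\int[leb]_x _ = - \int[leb]_x (u x * partial i (prodf d) x)%:E)%E).
  by rewrite uE oppeK subee// integrable_fin_num.
rewrite translation_adjoint//.
rewrite -integralN; last exact: integrable_add_def (bdd_cptsupp_integrable lu (partial_bdd_cptsupp i tpsi)).
by apply: eq_integral => x _; rewrite dpsi -EFinN -mulrN -mulrN opprB.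
Qed.

(** * Lebesgue differentiation along lines *)

Lemma fin_num_of_mul (R : realType) (c : R) (z : \bar R) :
  0 < c -> (c%:E * z)%E \is a fin_num -> z \is a fin_num.
Proof. by move=> c0; case: z => [r//||]; rewrite ?gt0_muley ?gt0_muleNy ?lte_fin. Qed.

Lemma integral_affine (R : realType) (c d : R) (f : R -> \bar R) :
  0 < c -> lebesgue_measure.-integrable setT f ->
  (\int[lebesgue_measure]_x f x =
   c%:E * \int[lebesgue_measure]_x f (c * x + d)%R)%E.
Proof.
move=> c0 fi; have mf := measurable_int _ fi.
rewrite integralE [in RHS]integralE.
rewrite (funepos_comp f (fun x => c * x + d)) (funeneg_comp f (fun x => c * x + d)).
have Pp := ge0_integral_affine d c0 (measurable_funepos mf) (funepos_ge0 f).
have Pn := ge0_integral_affine d c0 (measurable_funeneg mf) (funeneg_ge0 f).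
have fp : (\int[lebesgue_measure]_x f^\+ x \is a fin_num)%E.
  by apply: integrable_fin_num => //; exact: integrable_funepos.
have fn : (\int[lebesgue_measure]_x f^\- x \is a fin_num)%E.
  by apply: integrable_fin_num => //; exact: integrable_funeneg.
have fp' : (\int[lebesgue_measure]_x f^\+ (c * x + d)%R \is a fin_num)%E.
  by apply: (fin_num_of_mul c0); rewrite -Pp.
have fn' : (\int[lebesgue_measure]_x f^\- (c * x + d)%R \is a fin_num)%E.
  by apply: (fin_num_of_mul c0); rewrite -Pn.
rewrite Pp Pn.
have key (y z : \bar R) : y \is a fin_num -> z \is a fin_num ->
    (c%:E * y - c%:E * z = c%:E * (y - z))%E.
  by case: y z => [y||] [z||]// _ _; rewrite -EFinB -!EFinM mulrBr EFinB.
exact: key fp' fn'.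
Qed.

Lemma cvg_seq_dnbhs0 (R : realType) (a_ : nat -> R) :
  (forall k, a_ k != 0) -> a_ @ \oo --> (0 : R) -> a_ @ \oo --> (0 : R)^'.
Proof.
move=> a0 ca P P0; have H := ca _ P0.
apply: (@filterS _ \oo _ (fun k => (a_ k != 0 -> P (a_ k)) : Prop)) H => k.
by apply; exact: a0.
Qed.

Lemma cvg_harmonic_dnbhs (R : realType) :
  (fun k : nat => k.+1%:R^-1 : R) @ \oo --> (0 : R)^'.
Proof.
apply: cvg_seq_dnbhs0; last exact: cvg_harmonic.
by move=> k; rewrite invr_eq0 pnatr_eq0.
Qed.

(** The Lebesgue differentiation theorem for the restriction of g to the segment
    from x to x + e_i.  Only the first half of the segment is considered, so that
    the segments of length 1/(k+1) <= 1/2 starting there stay inside. *)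
Lemma line_avg_cvg_line (R : realType) n (i : 'I_n) (g : 'rV[R]_n -> R) (x : 'rV[R]_n) :
  measurable_fun setT g ->
  lebesgue_measure.-integrable setT
    (fun t : measurableTypeR R => (\1_`[0%R, 1%R] t * g (x + (t * 1) *: delta_mx ord0 i))%:E) ->
  {ae lebesgue_measure, forall s, s \in `]0, 2^-1[ ->
    (fun k => line_avg i k.+1%:R^-1 g (x + s *: delta_mx ord0 i)) @ \oo -->
    g (x + s *: delta_mx ord0 i)}.
Proof.
pose G t := \1_`[0%R, 1%R] t * g (x + (t * 1) *: delta_mx ord0 i).
move=> mg Gi; have {}Gi : lebesgue_measure.-integrable setT (EFin \o G) by [].
have Giy y : lebesgue_measure.-integrable `]-oo, y] (EFin \o G).
  by apply: integrableS Gi.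
have Gl : locally_integrable setT G.
  by apply: open_integrable_locally => //; exact: openT.
have [A [mA A0 HA]] := @FTC1 _ G -oo%O Giy Gl.
exists A; split => //; apply: subset_trans HA => s /=; apply: contra_not.
move=> /(_ (ltNyr _))[dF F'].
rewrite in_itv/= => /andP[s0 s1].
set F := fun x => _ in dF F'.
have Gs : G s = g (x + s *: delta_mx ord0 i).
  rewrite /G mulr1 indicE mem_set ?mul1r//= in_itv/= (ltW s0)/=.
  by rewrite (le_trans (ltW s1))// invf_le1// ler1n.
have FE (d : R) : 0 < d -> d <= 2^-1 ->
    line_avg i d g (x + s *: delta_mx ord0 i) = d^-1 *: (F (d *: 1 + s) - F s).
  move=> d0 d1.
  rewrite [d *: 1]mulr1 (addrC d) /F Rintegral_itvB//; last by rewrite bnd_simp lerDl ltW.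
  rewrite [in RHS]/Rintegral integral_mkcond.
  have iG : lebesgue_measure.-integrable setT ((EFin \o G) \_ `]s, (s + d)]).
    by rewrite -integrable_mkcond//; exact: integrableS Gi.
  have := integrable_fin_num measurableT iG.
  rewrite (integral_affine s d0 iG).
  rewrite [X in (d%:E * X)%E](_ : _ =
      \int[lebesgue_measure]_(t in `]0%R, 1%R]) (g (x + s *: delta_mx ord0 i + (t * d) *: delta_mx ord0 i))%:E)%E; last first.
    rewrite [RHS]integral_mkcond; apply: eq_integral => t _.
    rewrite !patchE.
    have -> : (d * t + s \in `]s, s + d]%classic) = (t \in `]0%R, 1%R]%classic).
      have E : (s < d * t + s <= s + d) = (0 < t <= 1).
        by rewrite (addrC _ s) ltrDl lerD2l pmulr_rgt0// ger_pMr.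
      by apply/idP/idP; rewrite !inE/= !in_itv/= E.
    case: ifPn => //; rewrite inE/= in_itv/= => /andP[t0 t1].
    congr EFin; rewrite /G indicE mem_set ?mul1r.
      by congr g; rewrite mulr1 -addrA -scalerDl; congr (_ + _ *: _); ring.
    rewrite /= in_itv/= addr_ge0 ?mulr_ge0// ?ltW//=.
    have : d * t <= d by rewrite ger_pMr.
    by move=> *; lra.
  rewrite /line_avg /Rintegral integral_itv_obnd_cbnd; last first.
    apply/measurable_EFinP; apply: measurable_funTS; apply: measurableT_comp => //.
    exact: (measurableT_comp (measurable_shear i d) (pair2_measurable _)).
  rewrite /GRing.scale/=.
  set I := (\int[_]_(t in _) _)%E => fI.
  by rewrite -(fineK (fin_num_of_mul d0 fI)) -EFinM/= mulKf// gt_eqF.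
have dl : h^-1 *: (F (h *: 1 + s) - F s) @[h --> 0^'] --> G s.
  by rewrite -F' derive1E; exact: dF.
rewrite -Gs.
apply: cvg_trans (cvg_comp _ _ (@cvg_harmonic_dnbhs R) dl).
apply: near_eq_cvg; near=> k; rewrite /= FE//.
rewrite lef_pV2 ?posrE// ler_nat ltnS.
by near: k; exists 1%N.
Unshelve. all: by end_near. Qed.

Lemma measurable_cvg_set (R : realType) d (T : measurableType d) (f : nat -> T -> R) (g : T -> R) :
  (forall k, measurable_fun setT (f k)) -> measurable_fun setT g ->
  measurable [set x | (fun k => f k x) @ \oo --> g x].
Proof.
move=> mf mg.
rewrite (_ : [set x | _] = \bigcap_m \bigcup_N \bigcap_k
   [set x | (N <= k)%N -> `|g x - f k x| < m.+1%:R^-1]); last first.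
  apply/seteqP; split => x /=.
    move=> /cvgrPdist_lt fg m _.
    have /fg[N _ HN] : 0 < m.+1%:R^-1 :> R by rewrite invr_gt0.
    by exists N => // k _ /= Nk; exact: HN.
  move=> H; apply/cvgrPdist_lt => e e0.
  have [m me] : exists m : nat, m.+1%:R^-1 < e.
    have := @cvg_harmonic R => /cvgrPdist_lt/(_ _ e0)[m _ /(_ m (leqnn _))].
    rewrite /= sub0r normrN ger0_norm// => me; exists m; exact: me.
  have [N _ HN] := H m I; exists N => // k /= Nk.
  exact: lt_trans (HN k I Nk) me.
apply: bigcapT_measurable => m; apply: bigcupT_measurable => N; apply: bigcapT_measurable => k.
case: (leqP N k) => Nk; last first.
  by rewrite (_ : [set _ | _] = setT)//; apply/seteqP; split.
rewrite (_ : [set _ | _] = (fun x => `|g x - f k x|) @^-1` `]-oo, m.+1%:R^-1[); last first.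
  by apply/seteqP; split => x /=; rewrite in_itv/= => H; [exact: H|move=> _].
rewrite -[X in measurable X]setTI.
have mgf : measurable_fun setT (fun x => `|g x - f k x|).
  by apply: measurableT_comp => //; apply: measurable_funB.
exact: mgf.
Qed.

(** On almost every line parallel to the i-th axis this is the one-dimensional
    Lebesgue differentiation theorem; since the exceptional set B is measurable
    and its translates all have the measure of B, Tonelli applied to the pairs
    (s, x) with x + s e_i in B shows that B is null. *)
Lemma line_avg_cvg_ae (R : realType) n (i : 'I_n) (g : 'rV[R]_n -> R) :
  loc_int g ->
  {ae leb, forall x, (fun k => line_avg i k.+1%:R^-1 g x) @ \oo --> g x}.
Proof.
move=> lg; have [mg _] := lg.
pose C := [set x | (fun k => line_avg i k.+1%:R^-1 g x) @ \oo --> g x].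
have mC : measurable C.
  by apply: measurable_cvg_set => // k; exact: measurable_line_avg.
pose B := ~` C; have mB : measurable B := measurableC mC.
have m1B : measurable_fun setT (\1_B : 'rV[R]_n -> R) by exact: measurable_indic.
suff B0 : leb B = 0%E by exists B; split.
pose f (z : measurableTypeR R * 'rV[R]_n) : \bar R :=
  (\1_`]0%R, 2^-1[ z.1 * \1_B (z.2 + (z.1 * 1) *: delta_mx ord0 i))%:E.
have mf : measurable_fun setT f.
  apply/measurable_EFinP; apply: measurable_funM.
    by apply: measurableT_comp => //; exact: measurable_indic.
  exact: (measurableT_comp m1B (measurable_shear i 1)).
have f0 z : (0 <= f z)%E by rewrite lee_fin mulr_ge0// indicE.
have := @fubini_tonelli _ _ _ _ R lebesgue_measure leb f mf f0.
rewrite [X in X = _ -> _](_ : _ = (2^-1)%:E * leb B)%E; last first.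
  rewrite /fubini_F; under eq_integral => s _.
    rewrite (_ : (\int[leb]_y f (s, y) = (\1_`]0%R, 2^-1[ s)%:E * leb B)%E); last first.
      rewrite /f /=; under eq_integral do rewrite EFinM.
      have B0 x : (0 <= (\1_B x : R)%:E)%E by rewrite lee_fin indicE.
      have mB' : measurable_fun setT (fun x => (\1_B x : R)%:E) by exact/measurable_EFinP.
      have mBs : measurable_fun setT (fun x : 'rV[R]_n => (\1_B (x + (s * 1) *: delta_mx ord0 i) : R)%:E).
        exact: (measurableT_comp mB' (measurable_fun_translation _)).
      rewrite ge0_integralZl//.
      by rewrite (ge0_integral_translation _ mB' B0) integral_indic// setIT.
    over.
  rewrite ge0_integralZr//; last by apply/measurable_EFinP; exact: measurable_indic.
  by rewrite integral_indic//= setIT lebesgue_measure_itv/= lte_fin invr_gt0 ltr0n sube0.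
rewrite [X in _ = X -> _](_ : _ = 0)%E; last first.
  rewrite (ae_eq_integral (cst 0%E)) ?integral0//.
    exact: measurable_fun_fubini_tonelli_G.
  have := segment_slice_integrable i 1 lg; apply: filterS => x /(line_avg_cvg_line mg) cx _.
  rewrite /fubini_G (ae_eq_integral (cst 0%E)) ?integral0//.
    exact: (measurableT_comp mf (pair2_measurable x)).
  case: cx => A [mA A0 HA]; exists A; split => //; apply: subset_trans HA.
  move=> s /=; apply: contra_not => sC _; rewrite /f/= indicE.
  have [|_] := boolP (s \in _); last by rewrite mul0r.
  rewrite inE/= => /sC; rewrite mulr1 indicE => H.
  by rewrite memNset ?mulr0//; apply: contrapT => /contrapT.
by move=> /eqP; rewrite mule_eq0 eqe invr_eq0 pnatr_eq0/= => /eqP.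
Qed.

(** * Dominated convergence with varying bounds *)

Lemma ae_le_integrable d (T : measurableType d) (R : realType)
    (mu : {measure set T -> \bar R}) (h k : T -> R) :
  measurable_fun setT h -> mu.-integrable setT (EFin \o k) ->
  {ae mu, forall x, `|h x| <= k x} -> mu.-integrable setT (EFin \o h).
Proof.
move=> mh ik hk; have := ik => /integrableP[mk ikoo].
apply/integrableP; split; first exact/measurable_EFinP.
apply: le_lt_trans ikoo; apply: ae_ge0_le_integral => //.
- by apply: measurableT_comp => //; exact/measurable_EFinP.
- exact: measurableT_comp.
- apply: filterS hk => x hkx _ /=; rewrite lee_fin (le_trans hkx)//.
  exact: ler_norm.
Qed.

Definition pospart (R : realType) (x : R) : R := (`|x| + x) / 2.

Lemma pospart_ge0 (R : realType) (x : R) : 0 <= pospart x.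
Proof.
by rewrite divr_ge0//; have := ler_norm (- x); rewrite normrN; lra.
Qed.

Lemma pospart_le (R : realType) (x y : R) : 0 <= y -> x <= y -> pospart x <= y.
Proof.
move=> y0 xy; rewrite ler_pdivrMr//; have [x0|x0] := leP 0 x.
  by rewrite ger0_norm//; lra.
by rewrite ltr0_norm//; lra.
Qed.

Lemma le_pospart (R : realType) (x : R) : x <= pospart x.
Proof. by rewrite ler_pdivlMr//; have := ler_norm x; lra. Qed.

Lemma cvg_pospart (R : realType) (u : nat -> R) (l : R) :
  u @ \oo --> l -> (fun k => pospart (u k)) @ \oo --> pospart l.
Proof. by move=> ul; apply: cvgMl; apply: cvgD => //; exact: cvg_norm. Qed.

Lemma measurable_pospart d (T : measurableType d) (R : realType) (h : T -> R) :
  measurable_fun setT h -> measurable_fun setT (fun x => pospart (h x)).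
Proof.
move=> mh; apply: measurable_funM => //; apply: measurable_funD => //.
exact: measurableT_comp.
Qed.

Lemma dominated_cvg0 d (T : measurableType d) (R : realType)
    (mu : {measure set T -> \bar R}) (h_ : nat -> T -> R) (g : T -> R) :
  mu.-integrable setT (EFin \o g) ->
  (forall k, measurable_fun setT (h_ k)) ->
  {ae mu, forall x k, `|h_ k x| <= g x} ->
  {ae mu, forall x, (fun k => h_ k x) @ \oo --> (0 : R)} ->
  (forall k, mu.-integrable setT (EFin \o h_ k)) /\
  (fun k => \int[mu]_x (h_ k x)%:E)%E @ \oo --> 0%E.
Proof.
move=> ig mh hg h0; split.
  by move=> k; apply: (ae_le_integrable (mh k) ig); apply: filterS hg => x; exact.
have [|||||_ _] := @dominated_convergence _ _ R mu setT measurableT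
  (fun k x => (h_ k x)%:E) (cst 0%E) (EFin \o g).
- by move=> k; exact/measurable_EFinP.
- exact: measurable_cst.
- apply: filterS h0 => x hx _; apply: cvg_EFin => //; exact: nearW.
- exact: ig.
- by apply: filterS hg => x hx k _; rewrite abse_EFin lee_fin.
by rewrite integral0.
Qed.

(** Pratt's generalised dominated convergence theorem: with d = |f_k - f| and
    c = |g_k - g| one has d <= (d - c)^+ + c, where (d - c)^+ is dominated by
    2 g, and c = (g_k - g) + 2 (g - g_k)^+. *)
Lemma pratt d (T : measurableType d) (R : realType)
    (mu : {measure set T -> \bar R}) (f_ g_ : nat -> T -> R) (f g : T -> R) :
  (forall k, measurable_fun setT (f_ k)) -> mu.-integrable setT (EFin \o f) ->
  (forall k, mu.-integrable setT (EFin \o g_ k)) -> mu.-integrable setT (EFin \o g) ->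
  {ae mu, forall x k, `|f_ k x| <= g_ k x} ->
  {ae mu, forall x, (fun k => f_ k x) @ \oo --> f x} ->
  {ae mu, forall x, (fun k => g_ k x) @ \oo --> g x} ->
  (fun k => \int[mu]_x (g_ k x)%:E)%E @ \oo --> (\int[mu]_x (g x)%:E)%E ->
  (fun k => \int[mu]_x (f_ k x)%:E)%E @ \oo --> (\int[mu]_x (f x)%:E)%E.
Proof.
move=> mf_ if0 ig_ ig fg cf cg ci.
have mf : measurable_fun setT f by apply/measurable_EFinP; exact: measurable_int if0.
have mg : measurable_fun setT g by apply/measurable_EFinP; exact: measurable_int ig.
have mg_ k : measurable_fun setT (g_ k) by apply/measurable_EFinP; exact: measurable_int (ig_ k).
have if_ k : mu.-integrable setT (EFin \o f_ k).
  by apply: (ae_le_integrable (mf_ k) (ig_ k)); apply: filterS fg => x; exact.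
have fgx : {ae mu, forall x, `|f x| <= g x}.
  apply: filterS3 fg cf cg => x fgx cfx cgx.
  by apply: ler_cvg_to (cvg_norm cfx) cgx _; exact: nearW.
have p0 : pospart (0 : R) = 0 by rewrite /pospart normr0 addr0 mul0r.
have [iA cA] : (forall k, mu.-integrable setT (EFin \o (fun x => pospart (g x - g_ k x)))) /\
    (fun k => \int[mu]_x (pospart (g x - g_ k x))%:E)%E @ \oo --> 0%E.
  apply: (dominated_cvg0 ig).
  - by move=> k; apply: measurable_pospart; exact: measurable_funB.
  - apply: filterS2 fg fgx => x fgk fgx k.
    rewrite ger0_norm ?pospart_ge0// pospart_le//; first exact: le_trans fgx.
    by rewrite gerBl (le_trans _ (fgk k)).
  - apply: filterS cg => x cgx; rewrite -p0 -(subrr (g x)).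
    by apply: cvg_pospart; apply: cvgB => //; exact: cvg_cst.
have iB k : mu.-integrable setT (EFin \o (fun x => `|g_ k x - g x|)).
  exact: (integrable_abse (integrableB measurableT (ig_ k) ig)).
have cB : (fun k => \int[mu]_x (`|g_ k x - g x|)%:E)%E @ \oo --> 0%E.
  rewrite (_ : (fun k => _) = (fun k => (\int[mu]_x (g_ k x)%:E - \int[mu]_x (g x)%:E)
      + 2%:E * \int[mu]_x (pospart (g x - g_ k x))%:E)%E); last first.
    apply/funext => k.
    have i1 := integrableB measurableT (ig_ k) ig.
    have i2 := integrableZl measurableT 2 (iA k).
    rewrite -(integralB_EFin measurableT (ig_ k) ig) -(integralZl measurableT (iA k)).
    rewrite -(integralD measurableT i1 i2).
    apply: eq_integral => x _; rewrite /= -EFinB -EFinM -EFinD; congr EFin.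
    by rewrite /pospart (distrC (g x)); field.
  rewrite -[X in _ --> X](_ : (\int[mu]_x (g x)%:E - \int[mu]_x (g x)%:E) + 2%:E * 0 = 0)%E; last first.
    by rewrite mule0 adde0 subee// integrable_fin_num.
  apply: cvgeD; first by rewrite mule0 fin_num_adde_defl.
    apply: cvgeB => //; last exact: cvg_cst.
    by rewrite fin_num_adde_defr// integrable_fin_num.
  exact: cvgeZl.
have [iC cC] : (forall k, mu.-integrable setT
      (EFin \o (fun x => pospart (`|f_ k x - f x| - `|g_ k x - g x|)))) /\
    (fun k => \int[mu]_x (pospart (`|f_ k x - f x| - `|g_ k x - g x|))%:E)%E @ \oo --> 0%E.
  apply: (dominated_cvg0 (g := fun x => 2 * g x)).
  - exact: (integrableZl measurableT 2 ig).
  - move=> k; apply: measurable_pospart; apply: measurable_funB;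
      by apply: measurableT_comp => //; exact: measurable_funB.
  - apply: filterS2 fg fgx => x fgk fgx k.
    have g0 : 0 <= g x := le_trans (normr_ge0 _) fgx.
    rewrite ger0_norm ?pospart_ge0// pospart_le ?mulr_ge0//.
    have := ler_normB (f_ k x) (f x); have := fgk k; have := ler_norm (g_ k x - g x).
    by move=> *; lra.
  - apply: filterS2 cf cg => x cfx cgx.
    have c0 (u : nat -> R) l : u @ \oo --> l -> (fun k => `|u k - l|) @ \oo --> (0 : R).
      move=> ul; rewrite -(normr0 R) -(subrr l).
      by apply: cvg_norm; apply: cvgB => //; exact: cvg_cst.
    rewrite -p0 -(subr0 0); apply: cvg_pospart.
    exact: cvgB (c0 _ _ cfx) (c0 _ _ cgx).
have iD k : mu.-integrable setT (EFin \o (fun x => `|f_ k x - f x|)).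
  exact: (integrable_abse (integrableB measurableT (if_ k) if0)).
have cD : (fun k => \int[mu]_x (`|f_ k x - f x|)%:E)%E @ \oo --> 0%E.
  apply: (@squeeze_cvge _ _ _ _ (cst 0%E) _ (fun k =>
    \int[mu]_x (pospart (`|f_ k x - f x| - `|g_ k x - g x|))%:E + \int[mu]_x (`|g_ k x - g x|)%:E)%E).
  - apply: nearW => k; rewrite integral_ge0//= -(integralD measurableT (iC k) (iB k)).
    apply: le_integral => //; first exact: iD.
      exact: (integrableD measurableT (iC k) (iB k)).
    move=> x _; rewrite -EFinD lee_fin.
    by have := le_pospart (`|f_ k x - f x| - `|g_ k x - g x|); lra.
  - exact: cvg_cst.
  - by rewrite -[X in _ --> X](adde0 0%E); apply: cvgeD.
apply/sube_cvg0; first exact: integrable_fin_num.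
apply/cvg_abse0P.
apply: (@squeeze_cvge _ _ _ _ (cst 0%E) _ (fun k => \int[mu]_x (`|f_ k x - f x|)%:E)%E) => //.
  apply: nearW => k; rewrite abse_ge0/= -(integralB_EFin measurableT (if_ k) if0).
  apply: (le_trans (le_abse_integral _ _ _)) => //.
  exact: measurable_int (integrableB measurableT (if_ k) if0).
exact: cvg_cst.
Qed.

(** * The chain rule for weak derivatives *)

Lemma line_avg0 (R : realType) n (i : 'I_n) (g : 'rV[R]_n -> R) (x : 'rV[R]_n) :
  line_avg i 0 g x = g x.
Proof.
rewrite /line_avg (@eq_Rintegral _ _ _ _ _ (cst (g x))); last first.
  by move=> t _; rewrite mulr0 scale0r addr0.
have E : lebesgue_measure `[0 : R, 1]%classic = 1%E.
  by rewrite lebesgue_measure_itv/= lte01 sube0.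
by rewrite Rintegral_cst// [X in fine X]E mulr1.
Qed.

(** Moving the averages onto the continuous function phi makes this an instance
    of dominated convergence. *)
Lemma cvg_integral_line_avg (R : realType) n (i : 'I_n) (g phi : 'rV[R]_n -> R) :
  loc_int g -> bdd_cptsupp phi -> continuous phi ->
  (fun k => \int[leb]_x (line_avg i k.+1%:R^-1 g x * phi x)%:E)%E @ \oo -->
  (\int[leb]_x (g x * phi x)%:E)%E.
Proof.
move=> lg bphi cphi; have [mg _] := lg; have [mphi [M [K phiM]]] := bphi.
rewrite (_ : (fun k => _) = fun k =>
    \int[lebesgue_measure \x leb]_z sheared i k.+1%:R^-1 g phi z)%E; last first.
  by apply/funext => k; rewrite (line_avg_integral i _ lg bphi).2.
rewrite [X in _ --> X](_ : _ = \int[leb]_x (line_avg i 0 g x * phi x)%:E)%E; last first.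
  by apply: eq_integral => x _; rewrite line_avg0.
rewrite (line_avg_integral i _ lg bphi).2.
have [K' KK'] := @cube_translate R n K i 1.
have K'k k (x : 'rV[R]_n) t : 0 <= t <= 1 ->
    cube n K%:R (x - (t * k.+1%:R^-1) *: delta_mx ord0 i) -> cube n K'%:R x.
  move=> /andP[t0 t1] xK; apply: (KK' x (t * k.+1%:R^-1)); last by rewrite mulr1.
  by rewrite divr_ge0//= ler_pdivrMr// mul1r (le_trans t1)// ler1n.
have [|||||_ _] // := @dominated_convergence _ _ R (lebesgue_measure \x leb)%E setT measurableT
  (fun k => sheared i k.+1%:R^-1 g phi : measurableTypeR R * 'rV[R]_n -> \bar R) (sheared i 0 g phi)
  (fun z => (\1_`[0%R, 1%R] z.1)%:E * (`|M| * `|g z.2| * \1_(cube n K'%:R) z.2)%:E)%E.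
- by move=> k; exact: measurable_sheared.
- exact: measurable_sheared.
- apply: aeW => -[t x] _; rewrite /sheared/=; apply: cvg_EFin; first exact: nearW.
  apply: cvgM; first exact: cvg_cst.
  apply: cvgM; first exact: cvg_cst.
  have hk : (fun k : nat => x - (t * k.+1%:R^-1) *: delta_mx ord0 i : 'rV[R]_n) @ \oo -->
      (x - (t * 0) *: delta_mx ord0 i : 'rV[R]_n).
    apply: cvgB; first exact: cvg_cst.
    apply: cvgZ; last exact: cvg_cst.
    by apply: cvgM; [exact: cvg_cst|exact: cvg_harmonic].
  exact: (cvg_comp _ _ hk (cphi _)).
- exact: sheared_bound_integrable.
- by apply: aeW => z k _; exact: (sheared_bound g phiM (K'k k) z).
Qed.

Lemma is_derive_line (R : realType) n (phi : 'rV[R]_n -> R) (x e : 'rV[R]_n) (t : R) :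
  derivable phi (x + t *: e) e ->
  is_derive t 1 (fun t => phi (x + t *: e)) ('D_e phi (x + t *: e)).
Proof.
move=> dphi; apply: cvg_is_derive.
rewrite (_ : (fun h => _) = (fun h => h^-1 *: (phi (h *: e + (x + t *: e)) - phi (x + t *: e)))); first exact: dphi.
by apply/funext => h; rewrite [h *: 1]mulr1 scalerDl addrCA.
Qed.

(** By the mean value theorem the difference quotients are values of the partial
    derivative at nearby points. *)
Lemma test_difference_bound (R : realType) n (i : 'I_n) (phi : 'rV[R]_n -> R) :
  test_function phi ->
  exists (M : R) (K : nat), forall (k : nat) x,
    `|k.+1%:R * (phi (x - k.+1%:R^-1 *: delta_mx ord0 i) - phi x)| <= M * \1_(cube n K%:R) x.
Proof.
move=> tphi; have [mp [M [K pM]]] := partial_bdd_cptsupp i tphi.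
have [K' KK'] := @cube_translate R n K i 1.
have [sphi _] := tphi.
exists `|M|, K' => k x; set e := delta_mx ord0 i.
have df (t : R) : is_derive t 1 (fun t => phi (x + t *: e)) (partial i phi (x + t *: e)).
  by apply: is_derive_line; have [_] := sphi [::]; apply.
have k0 : - k.+1%:R^-1 < 0 :> R by rewrite oppr_lt0 invr_gt0.
have [|c] := MVT k0 (fun t _ => df t).
  apply: continuous_subspaceT => t; apply/differentiable_continuous/derivable1_diffP.
  by have [] := df t.
rewrite in_itv/= => /andP[c0 c1]; rewrite scale0r addr0 sub0r opprK => E.
rewrite -scaleNr -[X in `|_ * X|]opprB E mulrN normrN mulrCA divff ?mulr1//.
apply: (le_trans (pM _)); rewrite !indicE.
have [/set_mem xK|_] := boolP (_ \in _); last by rewrite mulr0 mulr_ge0.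
rewrite mem_set ?mulr1 ?ler_norm//.
apply: (KK' x (- c)); last by rewrite mulr1 scaleNr opprK.
rewrite oppr_ge0 ltW//= lerNl (le_trans _ (ltW c0))// lerN2.
by rewrite invf_le1// ler1n.
Qed.

Lemma cvg_test_difference (R : realType) n (i : 'I_n) (w phi : 'rV[R]_n -> R) :
  loc_int w -> test_function phi ->
  (fun k => \int[leb]_x (w x * (k.+1%:R * (phi (x - k.+1%:R^-1 *: delta_mx ord0 i) - phi x)))%:E)%E @ \oo
  --> (- \int[leb]_x (w x * partial i phi x)%:E)%E.
Proof.
move=> lw tphi; have [mw _] := lw.
have [M [K bM]] := test_difference_bound i tphi.
have [sphi _] := tphi.
have mphi : measurable_fun setT phi by have [] := test_function_bdd_cptsupp tphi.
have [mp _] := partial_bdd_cptsupp i tphi.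
have bcube := @bdd_cptsupp_cube R n K.
have iw : leb.-integrable setT (fun x => (`|M|%:E * `|(w x * \1_(cube n K%:R) x)%:E|)%E).
  by apply: integrableZl => //; apply: integrable_abse; exact: bdd_cptsupp_integrable.
rewrite -integralN; last first.
  have := bdd_cptsupp_integrable lw (partial_bdd_cptsupp i tphi).
  exact: integrable_add_def.
have [||||_ _] // := @dominated_convergence _ _ R leb setT measurableT
  (fun k x => (w x * (k.+1%:R * (phi (x - k.+1%:R^-1 *: delta_mx ord0 i) - phi x)))%:E)
  (fun x => - (w x * partial i phi x)%:E)%E _ _ _ _ iw.
- move=> k; apply/measurable_EFinP; apply: measurable_funM => //.
  apply: measurable_funM => //; apply: measurable_funB => //.
  exact: (measurableT_comp mphi (measurable_fun_translation _)).
- by apply/measurable_EFinP; apply: measurableT_comp => //; exact: measurable_funM.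
- apply: aeW => x _; rewrite -EFinN -mulrN; apply: cvg_EFin; first exact: nearW.
  apply: cvgM; first exact: cvg_cst.
  have hk : (fun k : nat => - k.+1%:R^-1 : R) @ \oo --> (0 : R)^'.
    apply: cvg_seq_dnbhs0; last by rewrite -oppr0; apply: cvgN; exact: cvg_harmonic.
    by move=> k; rewrite oppr_eq0 invr_eq0 pnatr_eq0.
  have [_ /(_ i x) dp] := sphi [::].
  have H : (fun k : nat => - ((- k.+1%:R^-1)^-1 *:
      (phi ((- k.+1%:R^-1) *: delta_mx ord0 i + x) - phi x))) @ \oo --> - partial i phi x.
    by apply: cvgN; exact: (cvg_comp _ _ hk dp).
  apply: cvg_trans H; apply: near_eq_cvg; apply: nearW => k /=.
  by rewrite invrN invrK scaleNr opprK scaleNr (addrC _ x).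
- apply: aeW => x k _; have := bM k x; move: (k.+1%:R * _) => D bD.
  rewrite -EFinM !abse_EFin lee_fin !normrM [leRHS]mulrCA ler_wpM2l//.
  by rewrite (le_trans bD)// (le_trans (ler_norm _))// normrM.
Qed.

Lemma norm_line_avg_le (R : realType) n (i : 'I_n) (h : R) (g : 'rV[R]_n -> R) :
  loc_int g ->
  {ae leb, forall x, `|line_avg i h g x| <= line_avg i h (fun x => `|g x|) x}.
Proof.
move=> lg; apply: filterS (segment_slice_integrable i h lg) => x ix.
rewrite /line_avg; apply: le_normr_Rintegral => //.
rewrite integrable_mkcond//; apply: eq_integrable ix => // t _.
by rewrite patchE indicE; case: ifPn => _; rewrite ?mul1r ?mul0r.
Qed.

(** The hypotheses on F are those used by the difference quotients along
    h = 1/(k+1): a Lipschitz bound on the range D of (u1, u2), for domination, and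
    differentiability along sequences that stay in D, for the limit. *)
Lemma weak_partial_chain (R : realType) n (i : 'I_n) (u1 g1 u2 g2 : 'rV[R]_n -> R)
    (F F1 F2 : R -> R -> R) (D : R -> R -> Prop) (L : R) :
  0 <= L -> loc_int u1 -> loc_int g1 -> loc_int u2 -> loc_int g2 ->
  weak_partial i u1 g1 -> weak_partial i u2 g2 ->
  {ae leb, forall x, D (u1 x) (u2 x)} ->
  (forall a b a' b', D a b -> D a' b' ->
     `|F a' b' - F a b| <= L * (`|a' - a| + `|b' - b|)) ->
  (forall a b (a_ b_ : nat -> R) alpha beta, D a b -> (forall k, D (a_ k) (b_ k)) ->
     (fun k => k.+1%:R * (a_ k - a)) @ \oo --> alpha ->
     (fun k => k.+1%:R * (b_ k - b)) @ \oo --> beta ->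
     (fun k => k.+1%:R * (F (a_ k) (b_ k) - F a b)) @ \oo -->
     F1 a b * alpha + F2 a b * beta) ->
  loc_int (fun x => F (u1 x) (u2 x)) ->
  loc_int (fun x => F1 (u1 x) (u2 x) * g1 x + F2 (u1 x) (u2 x) * g2 x) ->
  weak_partial i (fun x => F (u1 x) (u2 x))
    (fun x => F1 (u1 x) (u2 x) * g1 x + F2 (u1 x) (u2 x) * g2 x).
Proof.
move=> L0 lu1 lg1 lu2 lg2 ug1 ug2 Du lipF dF lw lG phi tphi.
set w := fun x => F (u1 x) (u2 x) in lw *.
set G := fun x => F1 (u1 x) (u2 x) * g1 x + F2 (u1 x) (u2 x) * g2 x in lG *.
have bphi := test_function_bdd_cptsupp tphi.
have cphi : continuous phi by have [/(_ [::])[]] := tphi.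
have [mphi _] := bphi.
pose e k : 'rV[R]_n := k.+1%:R^-1 *: delta_mx ord0 i.
have DQ u g : loc_int u -> loc_int g -> weak_partial i u g ->
    {ae leb, forall x k, k.+1%:R * (u (x + e k) - u x) = line_avg i k.+1%:R^-1 g x}.
  move=> lu lg ug.
  have H k : {ae leb, forall x, k.+1%:R * (u (x + e k) - u x) = line_avg i k.+1%:R^-1 g x}.
    have h0 : 0 < k.+1%:R^-1 :> R by rewrite invr_gt0.
    by apply: filterS (difference_quotient h0 lu lg ug) => x; rewrite invrK.
  exact: (ae_foralln H).
have Dk : {ae leb, forall x k, D (u1 (x + e k)) (u2 (x + e k))}.
  have H k := ae_translation (e k) Du.
  exact: (ae_foralln H).
have nA (g : 'rV[R]_n -> R) : loc_int g -> {ae leb, forall x k, `|line_avg i k.+1%:R^-1 g x| <= line_avg i k.+1%:R^-1 (fun x => `|g x|) x}.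
  by move=> lg; have H k := norm_line_avg_le i k.+1%:R^-1 lg; exact: (ae_foralln H).
have nphi := bdd_cptsupp_norm bphi.
have cnphi : continuous (fun x => `|phi x|).
  by move=> x; apply: continuous_comp; [exact: cphi|exact: norm_continuous].
have ln1 := loc_int_norm lg1; have ln2 := loc_int_norm lg2.
pose A1 k x := line_avg i k.+1%:R^-1 (fun x => `|g1 x|) x * `|phi x|.
pose A2 k x := line_avg i k.+1%:R^-1 (fun x => `|g2 x|) x * `|phi x|.
have iA1 k : leb.-integrable setT (EFin \o A1 k) := (line_avg_integral i k.+1%:R^-1 ln1 nphi).1.
have iA2 k : leb.-integrable setT (EFin \o A2 k) := (line_avg_integral i k.+1%:R^-1 ln2 nphi).1.
have iY1 : leb.-integrable setT (EFin \o (fun x => `|g1 x| * `|phi x|)) := bdd_cptsupp_integrable ln1 nphi.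
have iY2 : leb.-integrable setT (EFin \o (fun x => `|g2 x| * `|phi x|)) := bdd_cptsupp_integrable ln2 nphi.
have lin (a b : 'rV[R]_n -> R) : leb.-integrable setT (EFin \o a) -> leb.-integrable setT (EFin \o b) ->
   leb.-integrable setT (EFin \o (fun x => L * (a x + b x))) /\
   (\int[leb]_x (L * (a x + b x))%:E = L%:E * (\int[leb]_x (a x)%:E + \int[leb]_x (b x)%:E))%E.
  move=> ia ib; have iab := integrableD measurableT ia ib; split.
    exact: (integrableZl measurableT L iab).
  by rewrite -(integralD measurableT ia ib) -(integralZl measurableT iab).
have Gphi : (fun k => \int[leb]_x (k.+1%:R * (w (x + e k) - w x) * phi x)%:E)%E @ \oo -->
    (\int[leb]_x (G x * phi x)%:E)%E.
  apply: (@pratt _ _ _ leb _ (fun k x => L * (A1 k x + A2 k x)) _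
    (fun x => L * (`|g1 x| * `|phi x| + `|g2 x| * `|phi x|))).
  - move=> k; apply: measurable_funM => //; apply: measurable_funM => //.
    by apply: measurable_funB; [case: (loc_int_translation (e k) lw)|case: lw].
  - exact: bdd_cptsupp_integrable.
  - by move=> k; have [] := lin _ _ (iA1 k) (iA2 k).
  - by have [] := lin _ _ iY1 iY2.
  - have H1 := DQ _ _ lu1 lg1 ug1; have H2 := DQ _ _ lu2 lg2 ug2.
    have K1 := nA _ lg1; have K2 := nA _ lg2.
    apply: filterS3 (filterI H1 H2) (filterI K1 K2) (filterI Du Dk) => x [h1 h2] [k1 k2] [d0 dk] k.
    rewrite /A1 /A2 -mulrDl mulrA normrM ler_wpM2r// normrM ger0_norm//.
    apply: (@le_trans _ _ (k.+1%:R * (L * (`|u1 (x + e k) - u1 x| + `|u2 (x + e k) - u2 x|)))).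
      by rewrite ler_wpM2l//; exact: lipF.
    have E (d : R) : k.+1%:R * `|d| = `|k.+1%:R * d| by rewrite normrM ger0_norm.
    rewrite mulrCA ler_wpM2l// mulrDr !E.
    by rewrite h1 h2 lerD.
  - have H1 := DQ _ _ lu1 lg1 ug1; have H2 := DQ _ _ lu2 lg2 ug2.
    have C1 := line_avg_cvg_ae i lg1; have C2 := line_avg_cvg_ae i lg2.
    apply: filterS3 (filterI H1 H2) (filterI C1 C2) (filterI Du Dk) => x [h1 h2] [c1 c2] [d0 dk].
    apply: cvgM; last exact: cvg_cst.
    apply: dF => //.
      by rewrite (_ : (fun k => _) = fun k => line_avg i k.+1%:R^-1 g1 x)//; apply/funext => k; exact: h1.
    by rewrite (_ : (fun k => _) = fun k => line_avg i k.+1%:R^-1 g2 x)//; apply/funext => k; exact: h2.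
  - have C1 := line_avg_cvg_ae i ln1; have C2 := line_avg_cvg_ae i ln2.
    apply: filterS2 C1 C2 => x c1 c2; apply: cvgM; first exact: cvg_cst.
    by apply: cvgD; apply: cvgM => //; exact: cvg_cst.
  - rewrite (lin _ _ iY1 iY2).2 (_ : (fun k => _) = fun k =>
      L%:E * (\int[leb]_x (A1 k x)%:E + \int[leb]_x (A2 k x)%:E))%E; last first.
      by apply/funext => k; rewrite (lin _ _ (iA1 k) (iA2 k)).2.
    apply: cvgeZl => //; apply: cvgeD.
    + by rewrite fin_num_adde_defl// (integrable_fin_num measurableT iY2).
    + exact: cvg_integral_line_avg.
    + exact: cvg_integral_line_avg.
have Wphi := @cvg_test_difference _ _ i _ _ lw tphi.
rewrite (_ : (fun k => _) = fun k =>
    \int[leb]_x (k.+1%:R * (w (x + e k) - w x) * phi x)%:E)%E in Wphi; last first.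
  by apply/funext => k; rewrite translation_adjoint.
by rewrite -(cvg_unique (@ereal_hausdorff R) Wphi Gphi) oppeK.
Qed.

(** * Weak gradients in Lebesgue spaces *)

Lemma Lfun_powR_integrable d (T : measurableType d) (R : realType)
    (mu : {measure set T -> \bar R}) (p : R) (f : T -> R) :
  1 < p -> f \in Lfun mu p%:E ->
  measurable_fun setT f /\ mu.-integrable setT (fun x => (`|f x| `^ p)%:E).
Proof.
move=> p1 fp; split; last exact: Lfun_integrable (ltW p1) fp.
by have := sub_Lfun_mfun fp; rewrite inE.
Qed.

Lemma powR_integrable_Lfun d (T : measurableType d) (R : realType)
    (mu : {measure set T -> \bar R}) (p : R) (f : T -> R) :
  1 < p -> measurable_fun setT f -> mu.-integrable setT (fun x => (`|f x| `^ p)%:E) ->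
  f \in Lfun mu p%:E.
Proof.
move=> p1 mf fi; apply/andP; split; rewrite inE//=.
rewrite /finite_norm unlock /Lnorm; apply: poweR_lty.
have /integrableP[_] := fi.
by under eq_integral do rewrite gee0_abs ?lee_fin ?powR_ge0//.
Qed.

Lemma Lfun_loc_int (R : realType) n (p : R) (f : 'rV[R]_n -> R) :
  1 < p -> f \in Lfun leb p%:E -> loc_int f.
Proof.
move=> p1 fp; have [mf fi] := Lfun_powR_integrable p1 fp; split => // K.
have mK : measurable (cube n K%:R : set 'rV[R]_n) := measurable_box _ _.
have i1 : leb.-integrable (cube n K%:R) (EFin \o (cst 1 : 'rV[R]_n -> R)).
  apply/integrableP; split; first by apply/measurable_EFinP.
  under eq_integral do rewrite /= normr1.
  by rewrite integral_cst// mul1e; exact: leb_box_lty.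
have ip : leb.-integrable (cube n K%:R) (fun x => (`|f x| `^ p)%:E).
  by apply: integrableS fi.
apply: (le_integrable _ _ _ (integrableD mK i1 ip)) => //.
  exact/measurable_EFinP/measurable_funTS.
move=> x _ /=; rewrite lee_fin [leRHS]ger0_norm ?addr_ge0 ?powR_ge0//.
have [f1|f1] := leP `|f x| 1; first by rewrite (le_trans f1)// lerDl powR_ge0.
rewrite (@le_trans _ _ (`|f x| `^ p))// ?lerDr//.
by rewrite -{1}(powRr1 (normr_ge0 (f x))) ler_powR// ltW.
Qed.

Lemma Lfun_dominated d (T : measurableType d) (R : realType)
    (mu : {measure set T -> \bar R}) (p C : R) (f h : T -> R) :
  1 < p -> f \in Lfun mu p%:E -> measurable_fun setT h ->
  {ae mu, forall x, `|h x| <= C * `|f x|} -> h \in Lfun mu p%:E.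
Proof.
move=> p1 fp mh hf; have [mf fi] := Lfun_powR_integrable p1 fp.
apply: powR_integrable_Lfun => //.
have p0 : 0 <= p by rewrite (le_trans ler01)// ltW.
apply: (@ae_le_integrable _ _ _ _ (fun x => `|h x| `^ p) (fun x => `|C| `^ p * `|f x| `^ p)).
- by apply: (measurableT_comp (measurable_powR _)); exact: measurableT_comp.
- exact: (integrableZl measurableT (`|C| `^ p) fi).
- apply: filterS hf => x hx; rewrite ger0_norm ?powR_ge0// -powRM//.
  apply: ge0_ler_powR; rewrite ?nnegrE ?mulr_ge0// (le_trans hx)// ler_wpM2r//.
  exact: ler_norm.
Qed.

Lemma LfunD d (T : measurableType d) (R : realType)
    (mu : {measure set T -> \bar R}) (p : R) (f g : T -> R) :
  1 < p -> f \in Lfun mu p%:E -> g \in Lfun mu p%:E ->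
  (fun x => f x + g x) \in Lfun mu p%:E.
Proof.
move=> p1 fp gp; have p1' : (1 <= p%:E)%E by rewrite lee_fin ltW.
by have [_] := Lfun_addr_closed mu p1'; exact.
Qed.

Lemma ae_forall_ord d (T : measurableType d) (R : realType)
    (mu : {measure set T -> \bar R}) n (P : 'I_n -> T -> Prop) :
  (forall i, {ae mu, forall x, P i x}) -> {ae mu, forall x, forall i, P i x}.
Proof.
move=> H; have : {ae mu, forall x, forall i, i \in enum 'I_n -> P i x}.
  elim: (enum 'I_n) => [|i s IH]; first exact: aeW.
  by apply: filterS2 (H i) IH => x h1 h2 j; rewrite inE => /orP[/eqP ->//|]; exact: h2.
by apply: filterS => x Hx i; apply: Hx; rewrite mem_enum.
Qed.

(** Two weak gradients have the same integrals against all test functions.  Hence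
    any formula for a weak gradient gives the chosen representative almost
    everywhere. *)
Lemma weak_gradient_unique (R : realType) n (p : R) (u : 'rV[R]_n -> R)
    (g g' : 'rV[R]_n -> 'rV[R]_n) :
  1 < p -> weak_gradient p u g -> weak_gradient p u g' ->
  {ae leb, forall x, g x = g' x}.
Proof.
move=> p1 [gp ug] [gp' ug'].
suff H (i : 'I_n) : {ae leb, forall x, g x ord0 i = g' x ord0 i}.
  by apply: filterS (ae_forall_ord H) => x H'; apply/rowP.
have lg := Lfun_loc_int p1 (gp i); have lg' := Lfun_loc_int p1 (gp' i).
suff : {ae leb, forall x, g x ord0 i - g' x ord0 i = 0}.
  by apply: filterS => x /eqP; rewrite subr_eq0 => /eqP.
apply: ae_eq0_of_test => [|c bc]; first exact: loc_intB.
have tphi := test_function_prodf bc; have bphi := test_function_bdd_cptsupp tphi.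
have i1 := bdd_cptsupp_integrable lg bphi; have i2 := bdd_cptsupp_integrable lg' bphi.
under eq_integral do rewrite mulrBl EFinB.
rewrite (integralB_EFin measurableT i1 i2).
have := ug _ i tphi; rewrite (ug' _ i tphi) => /oppe_inj ->.
by rewrite subee// integrable_fin_num.
Qed.

Lemma wgradP (R : realType) n (p : R) (u : 'rV[R]_n -> R) :
  W1p p u -> weak_gradient p u (wgrad p u).
Proof. by move=> [_ [g ug]]; exact: (xgetI _ ug). Qed.

(** * Picone inequalities *)

(** The tangent inequality of the convex function b |-> b^p at a; it is Young's
    inequality for the conjugate exponents p and p / (p - 1). *)
Lemma young_powR (R : realType) (p a b : R) : 1 < p -> 0 <= a -> 0 <= b ->
  p * (a `^ (p - 1) * b) <= (p - 1) * a `^ p + b `^ p.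
Proof.
move=> p1 a0 b0.
have p0 : 0 < p by rewrite (lt_trans _ p1).
have p10 : 0 < p - 1 by rewrite subr_gt0.
have := @conjugate_powR R b (a `^ (p - 1)) p (p / (p - 1)) b0 (powR_ge0 _ _) p0.
rewrite divr_gt0// => /(_ isT) => H.
have : b * a `^ (p - 1) <= b `^ p / p + (a `^ (p - 1)) `^ (p / (p - 1)) / (p / (p - 1)).
  by apply: H; field; rewrite !gt_eqF.
rewrite -powRrM mulrCA divff ?gt_eqF// mulr1 => {}H.
rewrite (mulrC (a `^ _)) -ler_pdivlMl// (le_trans H)// le_eqVlt; apply/orP; left; apply/eqP.
by field; rewrite !gt_eqF.
Qed.

Lemma powR_inv (R : realType) (c p : R) : 0 < c -> c^-1 `^ p = (c `^ p)^-1.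
Proof. by move=> c0; rewrite -powR_inv1 ?ltW// -powRrM mulN1r powRN. Qed.

Lemma powR_onem (R : realType) (c p : R) : 0 < c -> c `^ (1 - p) = c / c `^ p.
Proof. by move=> c0; rewrite powRB ?(gt_eqF c0) ?implybT// powRr1// ltW. Qed.

Lemma powR_div (R : realType) (z c p : R) : 0 <= z -> 0 < c ->
  (z / c) `^ p = z `^ p / c `^ p.
Proof. by move=> z0 c0; rewrite powRM ?invr_ge0 ?(ltW c0)// powR_inv. Qed.

(** The function (x, a) |-> x^p a^(1-p) is jointly convex and homogeneous of
    degree 1, hence subadditive: it is the supremum over r >= 0 of the linear
    functions p r^(p-1) x - (p-1) r^p a.  Taking r = (x + y) / (a + b) attains
    the supremum at the sum. *)
Lemma powR_perspective (R : realType) (p x y a b : R) : 1 < p ->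
  0 <= x -> 0 <= y -> 0 < a -> 0 < b ->
  (x + y) `^ p * (a + b) `^ (1 - p) <= x `^ p * a `^ (1 - p) + y `^ p * b `^ (1 - p).
Proof.
move=> p1 x0 y0 a0 b0; have p0 : 0 < p by rewrite (lt_trans _ p1).
have key z c r : 0 <= z -> 0 < c -> 0 <= r ->
    p * (r `^ (p - 1) * z) <= (p - 1) * r `^ p * c + z `^ p * c `^ (1 - p).
  move=> z0 c0 r0; have := @young_powR R p r (z / c) p1 r0 (divr_ge0 z0 (ltW c0)).
  rewrite -(ler_pM2r c0) mulrDl powR_div// powR_onem//.
  rewrite (_ : p * _ * c = p * (r `^ (p - 1) * z)); last by field; rewrite gt_eqF.
  rewrite (_ : z `^ p / c `^ p * c = z `^ p * (c / c `^ p))//.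
  by ring.
have s0 : 0 < a + b by rewrite addr_gt0.
have z0 : 0 <= x + y by rewrite addr_ge0.
pose r := (x + y) / (a + b).
have r0 : 0 <= r by rewrite divr_ge0// ltW.
have H := lerD (key x a r x0 a0 r0) (key y b r y0 b0 r0).
have E : r `^ p * (a + b) = (x + y) `^ p * (a + b) `^ (1 - p).
  by rewrite /r powR_div// powR_onem//; ring.
have E' : r `^ (p - 1) * (x + y) = r `^ p * (a + b).
  rewrite -(mulr_powRB1 r0 p0) /r; move: (_ `^ _) => q; field.
  by rewrite gt_eqF.
rewrite -E; move: H E'; move: (r `^ p) (r `^ (p - 1)) => A B.
move: (x `^ p * _) (y `^ p * _) => X Y H E'.
have : p * (B * (x + y)) <= (p - 1) * (A * (a + b)) + (X + Y).
  by apply: le_trans (le_trans _ H) _; lra.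
rewrite E'; lra.
Qed.

Lemma spow_gt0 (R : realType) (p t : R) : 0 < t -> spow p t = t `^ (p - 1).
Proof.
move=> t0; rewrite /spow gtr0_norm// -{2}(powRr1 (ltW t0)) -powRD.
  by congr (_ `^ _); ring.
by rewrite (gt_eqF t0) implybT.
Qed.

Lemma spowN (R : realType) (p t : R) : spow p (- t) = - spow p t.
Proof. by rewrite /spow normrN mulrN. Qed.

Lemma spow0 (R : realType) (p : R) : spow p 0 = 0.
Proof. by rewrite /spow mulr0. Qed.

(** By symmetry y2 < y1.  Write y1 = (y1 - y2) + y2 and x1 <= |x1 - x2| + x2 and
    use the subadditivity of x^p y^(1-p). *)
Lemma discrete_picone (R : realType) (p x1 x2 y1 y2 : R) : 1 < p ->
  0 <= x1 -> 0 <= x2 -> 0 < y1 -> 0 < y2 ->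
  spow p (y1 - y2) * (x1 `^ p * y1 `^ (1 - p) - x2 `^ p * y2 `^ (1 - p))
  <= `|x1 - x2| `^ p.
Proof.
move=> p1; wlog y12 : x1 x2 y1 y2 / y2 < y1 => [H x10 x20 y10 y20|x10 x20 y10 y20].
  have [lt|gt|->] := ltgtP y1 y2; last by rewrite subrr spow0 mul0r powR_ge0.
    rewrite -opprB spowN mulNr -mulrN opprB distrC; exact: H.
  exact: H.
have d0 : 0 < y1 - y2 by rewrite subr_gt0.
rewrite spow_gt0// mulrBr lerBlDr.
have p0 : 0 < p by rewrite (lt_trans _ p1).
have := powR_perspective p1 (normr_ge0 (x1 - x2)) x20 d0 y20.
rewrite subrK => H.
have Hx : x1 `^ p * y1 `^ (1 - p) <= (`|x1 - x2| + x2) `^ p * y1 `^ (1 - p).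
  rewrite ler_wpM2r ?powR_ge0//; apply: ge0_ler_powR; rewrite ?nnegrE ?addr_ge0// ?(ltW p0)//.
  by have := ler_norm (x1 - x2); lra.
have K := le_trans Hx H; rewrite -(ler_pM2l (powR_gt0 (p - 1) d0)) mulrDr in K; apply: (le_trans K).
rewrite lerD2r mulrCA -powRD; last by rewrite (gt_eqF d0) implybT.
by rewrite (_ : p - 1 + (1 - p) = 0) ?powRr0 ?mulr1//; ring.
Qed.

Lemma FM_triangle (R : realType) (n : nat) (H : 'rV[R]_n -> R) :
  Finsler_Minkowski H -> forall x y : 'rV[R]_n, H (x + y) <= H x + H y.
Proof.
move=> hH x y; have [f|] := boolP (free [:: x; y]).
  exact/ltW/(FM_strictly_convex hH).
rewrite free_cons seq1_free negb_and !negbK span_seq1 => /orP[/vlineP[k ->]|/eqP->].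
  rewrite (_ : k *: y + y = (k + 1) *: y); last by rewrite scalerDl scale1r.
  rewrite !(FM_homogeneous hH) -{3}(mul1r (H y)) -mulrDl.
  rewrite ler_wpM2r ?(FM_ge0 hH)//.
  by rewrite (le_trans (ler_normD _ _))// normr1.
by rewrite addr0 lerDl (FM_ge0 hH).
Qed.

Lemma dotv_gradient (R : realType) (n : nat) (f : 'rV[R]_n -> R) x y :
  differentiable f x -> dotv (gradient f x) y = 'D_y f x.
Proof.
move=> df; rewrite deriveE// {2}(row_sum_delta y) linear_sum.
apply: eq_bigr => i _; rewrite linearZ /= mxE /partial deriveE// mulrC//.
Qed.

Lemma FM_derive_cvg (R : realType) (n : nat) (H : 'rV[R]_n -> R) :
  Finsler_Minkowski H -> forall x y : 'rV[R]_n, x != 0 ->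
  (fun k => k.+1%:R * (H (k.+1%:R^-1 *: y + x) - H x)) @ \oo --> dotv (gradient H x) y.
Proof.
move=> hH x y x0; have [df _] := FM_C1 hH x0.
rewrite dotv_gradient//.
have /cvg_ex[l Hl] := @diff_derivable _ _ _ H x y df.
have -> : 'D_y H x = l by exact: cvg_lim Hl.
have := cvg_comp _ _ (@cvg_harmonic_dnbhs R) Hl.
apply: cvg_trans; apply: near_eq_cvg; apply: nearW => k /=.
by rewrite /GRing.scale/= invrK.
Qed.

(** The triangle inequality bounds the differences H(x + h y) - H(x) by h H(y). *)
Lemma FM_gradient_le (R : realType) (n : nat) (H : 'rV[R]_n -> R) :
  Finsler_Minkowski H -> forall x y : 'rV[R]_n, x != 0 -> dotv (gradient H x) y <= H y.
Proof.
move=> hH x y x0; have := @FM_derive_cvg _ _ _ hH x y x0.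
move=> /cvg_lim => /(_ (@Rhausdorff _)) <-.
apply: limr_le; first by apply/cvg_ex; eexists; exact: FM_derive_cvg.
apply: nearW => k; rewrite -(ler_pM2l (x := k.+1%:R^-1)) ?invr_gt0// mulrA mulVf ?mul1r ?pnatr_eq0//.
rewrite lerBlDr (le_trans (FM_triangle hH _ _))// (FM_homogeneous hH) ger0_norm//.
Qed.

(** Euler's identity: H is linear on the ray of x. *)
Lemma FM_euler (R : realType) (n : nat) (H : 'rV[R]_n -> R) :
  Finsler_Minkowski H -> forall x : 'rV[R]_n, x != 0 -> dotv (gradient H x) x = H x.
Proof.
move=> hH x x0; have := @FM_derive_cvg _ _ _ hH x x x0.
move=> /cvg_lim => /(_ (@Rhausdorff _)) <-.
apply: lim_near_cst => //; apply: nearW => k.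
rewrite -{2}(scale1r x) -scalerDl (FM_homogeneous hH) ger0_norm ?addr_ge0//.
by rewrite mulrDl mul1r addrK mulrA divff ?mul1r// pnatr_eq0.
Qed.

Lemma dotvZl (R : realType) (n : nat) (c : R) (x y : 'rV[R]_n) :
  dotv (c *: x) y = c * dotv x y.
Proof. by rewrite /dotv mulr_sumr; apply: eq_bigr => i _; rewrite mxE mulrA. Qed.

Lemma dotvZr (R : realType) (n : nat) (c : R) (x y : 'rV[R]_n) :
  dotv x (c *: y) = c * dotv x y.
Proof. by rewrite /dotv mulr_sumr; apply: eq_bigr => i _; rewrite mxE mulrCA. Qed.

Lemma dotvBr (R : realType) (n : nat) (x y z : 'rV[R]_n) :
  dotv x (y - z) = dotv x y - dotv x z.
Proof. by rewrite /dotv -sumrB; apply: eq_bigr => i _; rewrite !mxE mulrBr. Qed.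

Lemma dotv0l (R : realType) (n : nat) (x : 'rV[R]_n) : dotv 0 x = 0.
Proof. by rewrite /dotv big1// => i _; rewrite mxE mul0r. Qed.

Lemma flux_le (R : realType) (n : nat) (p : R) (H : 'rV[R]_n -> R) :
  Finsler_Minkowski H -> forall x y : 'rV[R]_n, dotv (flux p H x) y <= H x `^ (p - 1) * H y.
Proof.
move=> hH x y; rewrite /flux; case: eqP => [_|/eqP x0].
  by rewrite dotv0l mulr_ge0 ?powR_ge0 ?(FM_ge0 hH).
by rewrite dotvZl ler_wpM2l ?powR_ge0// FM_gradient_le.
Qed.

Lemma flux_self (R : realType) (n : nat) (p : R) (H : 'rV[R]_n -> R) : 1 < p ->
  Finsler_Minkowski H -> forall x, dotv (flux p H x) x = H x `^ p.
Proof.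
move=> p1 hH x; have p0 : 0 < p by rewrite (lt_trans _ p1).
rewrite /flux; case: eqP => [->|/eqP x0].
  rewrite dotv0l (_ : H 0 = 0) ?powR0 ?gt_eqF//.
  exact/(FM_eq0 hH).
rewrite dotvZl FM_euler// mulrC mulr_powRB1// (FM_ge0 hH)//.
Qed.

(** With r = u / V, this is Young's inequality for r H(xi) and H(eta), once the
    terms in xi and eta are bounded by Euler's identity and [FM_gradient_le]. *)
Lemma local_picone (R : realType) (n : nat) (p : R) (H : 'rV[R]_n -> R) : 1 < p ->
  Finsler_Minkowski H -> forall (xi eta : 'rV[R]_n) (t u V : R),
  `|t| = 1 -> 0 <= u -> 0 < V ->
  dotv (flux p H xi) (t *: ((p * u `^ (p - 1) * V `^ (1 - p)) *: eta
    - ((p - 1) * u `^ p * V `^ (- p)) *: (t *: xi))) <= H eta `^ p.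
Proof.
move=> p1 hH xi eta t u V t1 u0 V0.
have p0 : 0 < p by rewrite (lt_trans _ p1).
rewrite scalerBr !scalerA dotvBr !dotvZr flux_self//.
have tt : t * t = 1 by rewrite -expr2 -real_normK ?num_real// t1 expr1n.
rewrite (_ : t * ((p - 1) * u `^ p * V `^ (- p) * t) = (t * t) * ((p - 1) * u `^ p * V `^ (- p))); last ring.
rewrite tt mul1r (_ : t * (p * u `^ (p - 1) * V `^ (1 - p)) * _ =
  (p * u `^ (p - 1) * V `^ (1 - p)) * dotv (flux p H xi) (t *: eta)); last by rewrite dotvZr; ring.
have := young_powR p1 (mulr_ge0 (divr_ge0 u0 (ltW V0)) (FM_ge0 hH xi)) (FM_ge0 hH eta).
rewrite !powRM ?divr_ge0 ?(FM_ge0 hH) ?invr_ge0 ?(ltW V0)// !powR_inv// => Y.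
have VE : V `^ (1 - p) = (V `^ (p - 1))^-1 by rewrite -powRN opprB.
rewrite powRN VE lerBlDr.
apply: le_trans (_ : p * u `^ (p - 1) * (V `^ (p - 1))^-1 * (H xi `^ (p - 1) * H eta) <= _).
  rewrite ler_wpM2l ?mulr_ge0 ?invr_ge0 ?powR_ge0// ?(ltW p0)//.
  by rewrite (le_trans (flux_le p hH _ _))// (FM_homogeneous hH) t1 mul1r.
rewrite [leRHS]addrC; move: Y; rewrite !mulrA => Y; exact: Y.
Qed.

Lemma enorm0 (R : realType) (n : nat) : enorm (0 : 'rV[R]_n) = 0.
Proof. by rewrite /enorm dotv0l sqrtr0. Qed.

Lemma continuous_enorm (R : realType) (n : nat) : continuous (@enorm R n).
Proof.
move=> x; apply: continuous_comp; last exact: sqrt_continuous.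
have H : continuous (fun y : 'rV[R]_n => \sum_(i < n) y ord0 i * y ord0 i).
  apply: continuous_big => [z|i _ y]; first exact: add_continuous.
  by apply: continuousM; exact: coord_continuous.
exact: H.
Qed.

(** At the origin the C^1 hypothesis says nothing, and the comparison with the
    Euclidean norm is used. *)
Lemma continuous_FM (R : realType) (n : nat) (H : 'rV[R]_n -> R) :
  Finsler_Minkowski H -> continuous H.
Proof.
move=> hH x; have [->|x0] := eqVneq x 0; last first.
  by apply: differentiable_continuous; have [] := FM_C1 hH x0.
have [C1 [C2 [_ _ HC]]] := FM_equiv hH.
rewrite /continuous_at (_ : H 0 = 0); last exact/(FM_eq0 hH).
have cE : (fun y => C2 * enorm y) @ nbhs (0 : 'rV[R]_n) --> (0 : R).
  rewrite -[X in _ --> X](mulr0 C2) -(enorm0 R n).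
  apply: cvgM; first exact: cvg_cst.
  exact: continuous_enorm.
suff : H @ nbhs (0 : 'rV[R]_n) --> (0 : R) by [].
apply: (squeeze_cvgr _ (cvg_cst 0) cE).
by apply: nearW => y; rewrite (FM_ge0 hH)/=; have /andP[] := HC y.
Qed.

Lemma measurable_FM (R : realType) (n : nat) (H : 'rV[R]_n -> R) :
  Finsler_Minkowski H -> measurable_fun setT H.
Proof. by move=> hH; apply: continuous_measurable_rV; exact: continuous_FM. Qed.

Lemma measurable_enorm (R : realType) (n : nat) : measurable_fun setT (@enorm R n).
Proof. by apply: continuous_measurable_rV; exact: continuous_enorm. Qed.

(** * The test function for the equation of v *)

Lemma cvg_powR_seq (R : realType) (q a : R) (a_ : nat -> R) :
  0 <= a -> (0 < a \/ 0 < q) -> (forall k, 0 <= a_ k) -> a_ @ \oo --> a ->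
  (fun k => a_ k `^ q) @ \oo --> a `^ q.
Proof.
move=> a0 aq ak0 aka; have [a00|a00] := eqVneq a 0.
  move: aka aq; rewrite a00 => aka [|q0]; first by rewrite ltxx.
  rewrite powR0 ?gt_eqF//; apply/cvgrPdist_lt => e e0.
  have /cvgrPdist_lt/(_ _ (powR_gt0 q^-1 e0)) := aka.
  apply: filterS => k; rewrite !sub0r !normrN !ger0_norm ?powR_ge0// => H.
  rewrite -[ltRHS](powRr1 (ltW e0)) -(mulVf (lt0r_neq0 q0)) powRrM.
  by apply: gt0_ltr_powR; rewrite ?nnegrE ?powR_ge0.
have {a00}a0 : 0 < a by rewrite lt_neqAle eq_sym a00.
apply: (cvg_comp a_ (@powR R ^~ q) aka).
suff : {for a, continuous (@powR R ^~ q)} by [].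
apply: differentiable_continuous.
by apply/derivable1_diffP; apply: derivable_powR; rewrite in_itv/= a0.
Qed.

(** The supporting lines at x and at y bound f y - f x from both sides. *)
Lemma supported_lipschitz (R : realType) (E : R -> Prop) (f f' : R -> R) (L : R) :
  (forall x y, E x -> E y -> f' x * (y - x) <= f y - f x) ->
  (forall x, E x -> `|f' x| <= L) ->
  forall x y, E x -> E y -> `|f y - f x| <= L * `|y - x|.
Proof.
move=> sf bf x y Ex Ey.
have key a b : E a -> E b -> f a - f b <= L * `|b - a|.
  move=> Ea Eb; rewrite -opprB lerNl (le_trans _ (sf _ _ Ea Eb))//.
  rewrite lerNl -mulNr (le_trans (ler_norm _))// normrM normrN ler_wpM2r//.
  exact: bf.
by rewrite ler_norml lerNl opprB key// distrC key.
Qed.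

(** The difference quotients of f lie between the slopes at the two ends.  This
    argument stays inside E, of which a may be a boundary point, as 0 is for x^p
    on the half-line. *)
Lemma supported_seq_derive (R : realType) (E : R -> Prop) (f f' : R -> R)
    (a alpha : R) (a_ : nat -> R) :
  (forall x y, E x -> E y -> f' x * (y - x) <= f y - f x) ->
  E a -> (forall k, E (a_ k)) ->
  (fun k => k.+1%:R * (a_ k - a)) @ \oo --> alpha ->
  (fun k => f' (a_ k)) @ \oo --> f' a ->
  (fun k => k.+1%:R * (f (a_ k) - f a)) @ \oo --> f' a * alpha.
Proof.
move=> sf Ea Eak ca cf'.
apply: (@squeeze_cvgr _ _ _ _ (fun k => f' a * (k.+1%:R * (a_ k - a)))
  (fun k => f' (a_ k) * (k.+1%:R * (a_ k - a)))).
- apply: nearW => k; rewrite !(mulrCA _ k.+1%:R) !ler_pM2l// sf//=.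
  by rewrite -opprB lerNl -mulrN opprB sf.
- by apply: cvgM => //; exact: cvg_cst.
- exact: cvgM.
Qed.

Lemma cvg_of_scaled (R : realType) (a alpha : R) (a_ : nat -> R) :
  (fun k => k.+1%:R * (a_ k - a)) @ \oo --> alpha -> a_ @ \oo --> a.
Proof.
move=> H; rewrite (_ : a_ = (fun k => harmonic k * (k.+1%:R * (a_ k - a)) + a)).
  rewrite -[X in _ --> X]add0r -(mul0r alpha); apply: cvgD; last exact: cvg_cst.
  by apply: cvgM => //; exact: cvg_harmonic.
by apply/funext => k; rewrite /harmonic/= mulrA mulVf ?mul1r ?subrK// pnatr_eq0.
Qed.

Lemma powR_supported (R : realType) (p x y : R) : 1 < p -> 0 <= x -> 0 <= y ->
  p * x `^ (p - 1) * (y - x) <= y `^ p - x `^ p.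
Proof.
move=> p1 x0 y0; have p0 : 0 < p by rewrite (lt_trans _ p1).
have := young_powR p1 x0 y0; have := mulr_powRB1 x0 p0.
move: (x `^ (p - 1)) (x `^ p) (y `^ p) => A B C H.
by rewrite -H => H'; rewrite mulrBr; nra.
Qed.

Lemma powR_onem_supported (R : realType) (p x y : R) : 1 < p -> 0 < x -> 0 < y ->
  (1 - p) * x `^ (- p) * (y - x) <= y `^ (1 - p) - x `^ (1 - p).
Proof.
move=> p1 x0 y0; have p0 : 0 < p by rewrite (lt_trans _ p1).
have := young_powR p1 (divr_ge0 (ltW y0) (ltW x0)) ler01.
rewrite powR1 mulr1 !powR_div ?(ltW y0)//.
rewrite !(powRN, powR_onem)// => H.
have E z : 0 < z -> z `^ (p - 1) = z `^ p / z.
  by move=> z0; rewrite -(mulr_powRB1 (ltW z0) p0) mulrC mulKf// gt_eqF.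
move: H; rewrite !E//; have := powR_gt0 p x0; have := powR_gt0 p y0.
move: (x `^ p) (y `^ p) => A B B0 A0.
rewrite (_ : p * (B / y / (A / x)) = (B / y) * (p * (x / A))); last first.
  by field; rewrite !gt_eqF.
rewrite (_ : (p - 1) * (B / A) + 1 = (B / y) * ((p - 1) * (y / A) + y / B)); last first.
  by field; rewrite !gt_eqF.
rewrite ler_pM2l ?divr_gt0// => H.
rewrite (_ : (1 - p) / A * (y - x) = p * (x / A) - (p - 1) * (y / A) - x / A).
  lra.
by ring.
Qed.

(** Here t, of absolute value 1, is the sign of b; e > 0 keeps t b + e away
    from 0. *)
Definition picone_fun (R : realType) (p t e a b : R) : R :=
  t * (a `^ p * (t * b + e) `^ (1 - p)).

Definition picone_d1 (R : realType) (p t e a b : R) : R :=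
  t * (p * a `^ (p - 1) * (t * b + e) `^ (1 - p)).

(** The two factors t, one in front and one from t * b + e, have product 1. *)
Definition picone_d2 (R : realType) (p t e a b : R) : R :=
  - ((p - 1) * a `^ p * (t * b + e) `^ (- p)).

Lemma powR_neg_le (R : realType) (e V q : R) : 0 < e -> e <= V -> 0 <= q ->
  V `^ (- q) <= e `^ (- q).
Proof.
move=> e0 eV q0; rewrite !powRN lef_pV2 ?posrE ?powR_gt0//; last exact: lt_le_trans eV.
by apply: ge0_ler_powR; rewrite ?nnegrE//; rewrite ltW// (lt_le_trans e0).
Qed.

Lemma picone_fun_lipschitz (R : realType) (p t e M : R) : 1 < p -> `|t| = 1 ->
  0 < e -> 0 <= M ->
  exists2 L : R, 0 <= L & forall a b a' b' : R,
   (0 <= a <= M) /\ 0 <= t * b -> (0 <= a' <= M) /\ 0 <= t * b' ->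
     `|picone_fun p t e a' b' - picone_fun p t e a b|
     <= L * (`|a' - a| + `|b' - b|).
Proof.
move=> p1 t1 e0 M0; have p0 : 0 < p by rewrite (lt_trans _ p1).
pose LA := p * M `^ (p - 1); pose LB := (p - 1) * e `^ (- p).
have LA0 : 0 <= LA by rewrite mulr_ge0 ?powR_ge0// ltW.
have LB0 : 0 <= LB by rewrite mulr_ge0 ?powR_ge0// subr_ge0 ltW.
have hA (x y : R) : 0 <= x <= M -> 0 <= y <= M -> `|y `^ p - x `^ p| <= LA * `|y - x|.
  apply: (@supported_lipschitz _ (fun x => 0 <= x <= M) (@powR R ^~ p)
    (fun x => p * x `^ (p - 1))) => {x y} [x y|x].
    by move=> /andP[x0 _] /andP[y0 _]; exact: powR_supported.
  move=> /andP[x0 xM]; rewrite ger0_norm ?mulr_ge0 ?powR_ge0 ?(ltW p0)//.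
  by rewrite ler_wpM2l ?(ltW p0)// ge0_ler_powR ?nnegrE// subr_ge0 ltW.
have hB x y : e <= x -> e <= y -> `|y `^ (1 - p) - x `^ (1 - p)| <= LB * `|y - x|.
  apply: (@supported_lipschitz _ (fun x => e <= x) (@powR R ^~ (1 - p))
    (fun x => (1 - p) * x `^ (- p))) => {x y} [x y ex ey|x ex].
    by apply: powR_onem_supported => //; exact: lt_le_trans e0 _.
  rewrite normrM ler0_norm ?subr_le0 ?(ltW p1)// opprB.
  rewrite ger0_norm ?powR_ge0// ler_wpM2l ?subr_ge0 ?(ltW p1)//.
  by apply: powR_neg_le => //; exact: ltW.
pose BM := e `^ (1 - p).
exists (LA * BM + M `^ p * LB).
  by rewrite addr_ge0// mulr_ge0 ?powR_ge0.
move=> a b a' b' [aM b0] [aM' b0'].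
rewrite /picone_fun -mulrBr normrM t1 mul1r.
set V := t * b + e; set V' := t * b' + e.
have eV : e <= V by rewrite lerDr.
have eV' : e <= V' by rewrite lerDr.
have BV' : `|V' `^ (1 - p)| <= BM.
  rewrite ger0_norm ?powR_ge0// /BM -opprB.
  by apply: powR_neg_le => //; rewrite subr_ge0 ltW.
have EV : `|V' - V| = `|b' - b|.
  rewrite (_ : V' - V = t * (b' - b)) ?normrM ?t1 ?mul1r//.
  by rewrite /V /V'; ring.
have AM : `|a `^ p| <= M `^ p.
  rewrite ger0_norm ?powR_ge0//; move: aM => /andP[a0 aM].
  by rewrite ge0_ler_powR ?nnegrE// ltW.
rewrite (_ : _ - _ = (a' `^ p - a `^ p) * V' `^ (1 - p) +
  a `^ p * (V' `^ (1 - p) - V `^ (1 - p))); last by ring.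
have H1 : `|(a' `^ p - a `^ p) * V' `^ (1 - p)| <= LA * BM * `|a' - a|.
  rewrite normrM mulrAC ler_pM//; exact: hA.
have H2 : `|a `^ p * (V' `^ (1 - p) - V `^ (1 - p))| <= M `^ p * LB * `|b' - b|.
  by rewrite normrM -mulrA ler_pM// -EV; exact: hB.
rewrite (le_trans (ler_normD _ _))// (le_trans (lerD H1 H2))//.
rewrite mulrDr !mulrDl lerD//.
  by rewrite lerDl mulr_ge0// mulr_ge0 ?powR_ge0.
by rewrite lerDr mulr_ge0// mulr_ge0 ?powR_ge0.
Qed.

Lemma picone_fun_seq_derive (R : realType) (p t e a b alpha beta : R)
    (a_ b_ : nat -> R) : 1 < p -> t * t = 1 -> 0 < e ->
  0 <= a -> 0 <= t * b -> (forall k, 0 <= a_ k) -> (forall k, 0 <= t * b_ k) ->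
  (fun k => k.+1%:R * (a_ k - a)) @ \oo --> alpha ->
  (fun k => k.+1%:R * (b_ k - b)) @ \oo --> beta ->
  (fun k => k.+1%:R * (picone_fun p t e (a_ k) (b_ k) - picone_fun p t e a b))
    @ \oo --> picone_d1 p t e a b * alpha + picone_d2 p t e a b * beta.
Proof.
move=> p1 tt e0 a0 b0 ak0 bk0 ca cb.
have p0 : 0 < p by rewrite (lt_trans _ p1).
pose V := t * b + e; pose V_ k := t * b_ k + e.
have V0 : 0 < V by rewrite ltr_wpDl.
have Vk0 k : 0 < V_ k by rewrite ltr_wpDl.
have cV : (fun k => k.+1%:R * (V_ k - V)) @ \oo --> t * beta.
  rewrite (_ : (fun k => _) = (fun k => t * (k.+1%:R * (b_ k - b)))).
    by apply: cvgM => //; exact: cvg_cst.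
  by apply/funext => k; rewrite /V_ /V; ring.
have cV0 := cvg_of_scaled cV; have ca0 := cvg_of_scaled ca.
have H1 : (fun k => k.+1%:R * (a_ k `^ p - a `^ p)) @ \oo --> p * a `^ (p - 1) * alpha.
  apply: (@supported_seq_derive _ (fun x => 0 <= x) (@powR R ^~ p)
    (fun x => p * x `^ (p - 1))) => //.
    by move=> x y; exact: powR_supported.
  apply: cvgM; first exact: cvg_cst.
  by apply: cvg_powR_seq => //; right; rewrite subr_gt0.
have H2 : (fun k => k.+1%:R * (V_ k `^ (1 - p) - V `^ (1 - p))) @ \oo -->
    (1 - p) * V `^ (- p) * (t * beta).
  apply: (@supported_seq_derive _ (fun x => 0 < x) (@powR R ^~ (1 - p))
    (fun x => (1 - p) * x `^ (- p))) => //.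
    by move=> x y; exact: powR_onem_supported.
  apply: cvgM; first exact: cvg_cst.
  apply: cvg_powR_seq => //; first exact: ltW.
    by left.
  by move=> k; exact: ltW.
have H3 : (fun k => V_ k `^ (1 - p)) @ \oo --> V `^ (1 - p).
  apply: cvg_powR_seq => //; first exact: ltW.
    by left.
  by move=> k; exact: ltW.
rewrite (_ : (fun k => _) = (fun k => t * ((k.+1%:R * (a_ k `^ p - a `^ p)) * V_ k `^ (1 - p)
  + a `^ p * (k.+1%:R * (V_ k `^ (1 - p) - V `^ (1 - p)))))); last first.
  by apply/funext => k; rewrite /picone_fun -/V -/(V_ k); ring.
rewrite (_ : _ + _ = t * (p * a `^ (p - 1) * alpha * V `^ (1 - p)
  + a `^ p * ((1 - p) * V `^ (- p) * (t * beta)))).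
  apply: cvgM; first exact: cvg_cst.
  apply: cvgD; first exact: cvgM.
  by apply: cvgM => //; exact: cvg_cst.
rewrite /picone_d1 /picone_d2 -/V mulrDr; congr (_ + _); first by ring.
rewrite (_ : t * _ = t * t * (a `^ p * ((1 - p) * V `^ (- p) * beta))); last by ring.
by rewrite tt; ring.
Qed.


Lemma picone_coef_le (R : realType) (t e M a b q q' : R) :
  0 < e -> 0 <= a <= M -> 0 <= t * b -> 0 <= q -> 0 <= q' ->
  0 <= a `^ q * (t * b + e) `^ (- q') <= M `^ q * e `^ (- q').
Proof.
move=> e0 /andP[a0 aM] b0 q0 q'0.
rewrite mulr_ge0 ?powR_ge0//= ler_pM ?powR_ge0//.
  by rewrite ge0_ler_powR ?nnegrE// (le_trans a0).
by apply: powR_neg_le => //; rewrite lerDr.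
Qed.

Lemma measurable_picone_fun d (T : measurableType d) (R : realType)
    (t e q q' : R) (u v : T -> R) :
  measurable_fun setT u -> measurable_fun setT v ->
  measurable_fun setT (fun x => u x `^ q * (t * v x + e) `^ q').
Proof.
move=> mu mv; apply: measurable_funM.
  by apply: (measurableT_comp (measurable_powR _)).
apply: (measurableT_comp (measurable_powR _)).
by apply: measurable_funD => //; exact: measurable_funM.
Qed.

(** [0, M] x {t b >= 0} is a range of (u, v) on which [picone_fun] is Lipschitz. *)
Lemma picone_test (R : realType) n (p t e M : R) (Omega : set 'rV[R]_n)
    (u v : 'rV[R]_n -> R) : 1 < p -> `|t| = 1 -> 0 < e ->
  W01p p Omega u -> W1p p v ->
  {ae leb, forall x, 0 <= u x <= M} -> {ae leb, forall x, 0 <= t * v x} ->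
  let phi x := picone_fun p t e (u x) (v x) in
  W01p p Omega phi /\
  {ae leb, forall x, wgrad p phi x =
    t *: ((p * u x `^ (p - 1) * (t * v x + e) `^ (1 - p)) *: wgrad p u x
      - ((p - 1) * u x `^ p * (t * v x + e) `^ (- p)) *: (t *: wgrad p v x))}.
Proof.
move=> p1 t1 e0 [Wu u0] Wv uM v0 phi; have p0 : 0 < p by rewrite (lt_trans _ p1).
have p10 : 0 <= p - 1 by rewrite subr_ge0 ltW.
have tt : t * t = 1 by rewrite -expr2 -real_normK ?num_real// t1 expr1n.
have [gup gu] := wgradP Wu; have [gvp gv] := wgradP Wv.
have up := Wu.1; have vp := Wv.1.
have [mu _] := Lfun_powR_integrable p1 up; have [mv _] := Lfun_powR_integrable p1 vp.
pose g x := t *: ((p * u x `^ (p - 1) * (t * v x + e) `^ (1 - p)) *: wgrad p u x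
      - ((p - 1) * u x `^ p * (t * v x + e) `^ (- p)) *: (t *: wgrad p v x)).
have mphi : measurable_fun setT phi.
  by apply: measurable_funM => //; exact: measurable_picone_fun.
have phip : phi \in Lfun leb p%:E.
  apply: (Lfun_dominated (C := M `^ (p - 1) * e `^ (- (p - 1))) p1 up mphi).
  apply: filterS2 uM v0 => x ux vx.
  have /andP[H0 H] := picone_coef_le e0 ux vx p10 p10.
  have /andP[ux0 _] := ux.
  rewrite /phi /picone_fun normrM t1 mul1r -(mulr_powRB1 ux0 p0) -(opprB p 1).
  by rewrite -mulrA normrM mulrC ler_wpM2r// ger0_norm.
have gE i x : g x ord0 i = picone_d1 p t e (u x) (v x) * wgrad p u x ord0 i
    + picone_d2 p t e (u x) (v x) * wgrad p v x ord0 i.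
  rewrite /g !mxE /picone_d1 /picone_d2 mulrDr; congr (_ + _); first by ring.
  rewrite (_ : t * _ = t * t * (- ((p - 1) * u x `^ p * (t * v x + e) `^ (- p) * wgrad p v x ord0 i))).
    by rewrite tt; ring.
  by ring.
have gp i : (fun x => g x ord0 i) \in Lfun leb p%:E.
  rewrite (_ : (fun x => _) = (fun x => picone_d1 p t e (u x) (v x) * wgrad p u x ord0 i
    + picone_d2 p t e (u x) (v x) * wgrad p v x ord0 i)); last by apply/funext => x.
  have [mgu _] := Lfun_powR_integrable p1 (gup i).
  have [mgv _] := Lfun_powR_integrable p1 (gvp i).
  apply: LfunD => //.
  - apply: (Lfun_dominated (C := p * (M `^ (p - 1) * e `^ (- (p - 1)))) p1 (gup i)).
      apply: measurable_funM => //; rewrite /picone_d1.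
      under eq_fun do rewrite -mulrA.
      apply: measurable_funM => //; apply: measurable_funM => //.
      exact: measurable_picone_fun.
    apply: filterS2 uM v0 => x ux vx.
    have /andP[H0 H] := picone_coef_le e0 ux vx p10 p10.
    rewrite /picone_d1 normrM ler_wpM2r// normrM t1 mul1r -(opprB p 1) -mulrA normrM.
    by rewrite ger0_norm ?(ltW p0)// ger0_norm// ler_wpM2l// ltW.
  - apply: (Lfun_dominated (C := (p - 1) * (M `^ p * e `^ (- p))) p1 (gvp i)).
      apply: measurable_funM => //; rewrite /picone_d2; apply: measurable_funN.
      under eq_fun do rewrite -mulrA.
      by apply: measurable_funM => //; exact: measurable_picone_fun.
    apply: filterS2 uM v0 => x ux vx.
    have /andP[H0 H] := picone_coef_le e0 ux vx (ltW p0) (ltW p0).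
    rewrite /picone_d2 normrM ler_wpM2r// normrN -mulrA normrM.
    by rewrite ger0_norm ?p10// ger0_norm// ler_wpM2l.
have wg : weak_gradient p phi g.
  split=> // psi i tpsi.
  have gpi := gp i.
  have M0 : 0 <= `|M| := normr_ge0 M.
  have [L L0 HL] := picone_fun_lipschitz p1 t1 e0 M0.
  have E : (fun x => g x ord0 i) = (fun x => picone_d1 p t e (u x) (v x) * wgrad p u x ord0 i
    + picone_d2 p t e (u x) (v x) * wgrad p v x ord0 i) by apply/funext => x.
  suff : weak_partial i phi (fun x => g x ord0 i) by apply.
  rewrite E in gpi *.
  apply: (@weak_partial_chain R n i u _ v _ (picone_fun p t e) (picone_d1 p t e)
    (picone_d2 p t e) (fun a b => (0 <= a <= `|M|) /\ 0 <= t * b) L) => //.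
  - exact: Lfun_loc_int up.
  - exact: Lfun_loc_int (gup i).
  - exact: Lfun_loc_int vp.
  - exact: Lfun_loc_int (gvp i).
  - by move=> ? ?; exact: gu.
  - by move=> ? ?; exact: gv.
  - apply: filterS2 uM v0 => x /andP[-> uxM] ->; split => //=.
    by rewrite (le_trans uxM)// ler_norm.
  - move=> a b a_ b_ alpha beta [/andP[a0 _] b0] ab ca cb.
    by apply: picone_fun_seq_derive => // k; have [/andP[]] := ab k.
  - exact: Lfun_loc_int phip.
  - exact: Lfun_loc_int gpi.
have Wphi : W1p p phi by split => //; exists g.
split; last exact: weak_gradient_unique p1 (wgradP Wphi) wg.
split=> //; apply: filterS u0 => x ux nx.
by rewrite /phi /picone_fun ux// powR0 ?gt_eqF// mul0r mulr0.
Qed.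

Import HBNNSimple.

(** * Integral inequalities *)

(** The positive part of f is integrated as a supremum over simple functions below
    it, and each of these is below g almost everywhere; so f may be any function.
    In [picone_comparison] it involves the gradient of H. *)
Lemma le_integral_dominated d (T : measurableType d) (R : realType)
    (mu : {measure set T -> \bar R}) (D : set T) (f g : T -> \bar R) :
  measurable D -> measurable_fun D g -> (forall x, D x -> 0 <= g x)%E ->
  {ae mu, forall x, D x -> (f x <= g x)%E} ->
  (\int[mu]_(x in D) f x <= \int[mu]_(x in D) g x)%E.
Proof.
move=> mD mg g0 fg; rewrite integralE.
apply: (@le_trans _ _ (\int[mu]_(x in D) (f ^\+)%E x)%E).
  by rewrite -[leRHS]sube0; apply: leeB => //; exact: integral_ge0.
rewrite ge0_integralE//; apply: ge_ereal_sup => _ [h /= hf <-].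
have := integral_nnsfun mu measurableT h; rewrite patch_setT => <-.
rewrite (integral_mkcond D g); apply: ae_ge0_le_integral => //.
- by move=> x _; rewrite lee_fin; exact: fun_ge0.
- exact/measurable_EFinP.
- by move=> x _; exact: erestrict_ge0.
- exact/(measurable_restrictT _ _).1.
- apply: filterS fg => x fgx _; apply: (le_trans (hf x)).
  rewrite !patchE; case: ifPn => // /set_mem Dx.
  by rewrite funeposE ge_max fgx// g0.
Qed.

Lemma ae_product_fst d1 d2 (T1 : measurableType d1) (T2 : measurableType d2)
    (R : realType) (m1 : {sigma_finite_measure set T1 -> \bar R})
    (m2 : {sigma_finite_measure set T2 -> \bar R}) (P : T1 -> Prop) :
  {ae m1, forall x, P x} -> {ae (m1 \x m2)%E, forall z, P z.1}.
Proof.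
move=> [N [mN N0 NP]]; exists (N `*` setT); split; first exact: measurableX.
  by have := product_measure1E m1 m2 mN measurableT; rewrite /= N0 mul0e.
by move=> z /= Pz; split => //; exact: NP.
Qed.

Lemma ae_product_snd d1 d2 (T1 : measurableType d1) (T2 : measurableType d2)
    (R : realType) (m1 : {sigma_finite_measure set T1 -> \bar R})
    (m2 : {sigma_finite_measure set T2 -> \bar R}) (P : T2 -> Prop) :
  {ae m2, forall x, P x} -> {ae (m1 \x m2)%E, forall z, P z.2}.
Proof.
move=> [N [mN N0 NP]]; exists (setT `*` N); split; first exact: measurableX.
  by have := product_measure1E m1 m2 measurableT mN; rewrite /= N0 mule0.
by move=> z /= Pz; split => //; exact: NP.
Qed.

Lemma measurable_kernel (R : realType) n (p s : R) :
  measurable_fun setT (fun z : 'rV[R]_n * 'rV[R]_n => Defs.kernel p s z.1 z.2).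
Proof.
apply: (measurableT_comp (measurable_powR _)).
apply: (measurableT_comp (@measurable_enorm R n)).
apply: measurable_fun_rVP => i.
rewrite (_ : (fun z => _) = (fun z : 'rV[R]_n * 'rV[R]_n => z.1 ord0 i - z.2 ord0 i)); last first.
  by apply/funext => z; rewrite !mxE.
by apply: measurable_funB; apply: (measurableT_comp (measurable_coord_rV i)).
Qed.

Lemma spow_self (R : realType) (p x : R) : 1 < p -> spow p x * x = `|x| `^ p.
Proof.
move=> p1; have [->|x0] := eqVneq x 0.
  by rewrite mulr0 normr0 powR0// gt_eqF// (lt_trans _ p1).
rewrite /spow -mulrA -expr2 -real_normK ?num_real// -powR_mulrn// -powRD.
  by congr (_ `^ _); ring.
by rewrite normr_eq0 (negbTE x0) implybT.
Qed.

Lemma spow_unit (R : realType) (p t x : R) : `|t| = 1 -> spow p (t * x) = t * spow p x.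
Proof. by move=> t1; rewrite /spow normrM t1 mul1r mulrCA. Qed.

Lemma Linfty_bounded (R : realType) n (Omega : set 'rV[R]_n) (u : 'rV[R]_n -> R) :
  Linfty Omega u -> exists M : R, {ae leb, forall x, Omega x -> `|u x| <= M}.
Proof.
rewrite /Linfty => /andP[_]; rewrite inE/= /finite_norm unlock /Lnorm.
(* On a null space the norm is 0 by convention; the essential supremum is not. *)
case: ifPn => [_|]; last first.
  rewrite -leNgt => leb0 _; exists 0; exists setT; split => //.
  by apply/eqP; rewrite eq_le leb0 measure_ge0.
set S := ess_sup _ _ => Soo.
have [SNy|SNy] := eqVneq S -oo%E.
  exists 0; move/ess_sup_eqNyP : SNy; apply: filterS => x /=.
  by [].
exists (fine S); have := ess_sup_ge leb (abse \o (EFin \o (u \_ Omega))).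
rewrite -/S; apply: filterS => x; rewrite -(@fineK _ S); last first.
  by rewrite fin_numE SNy -ltey.
by rewrite /= lee_fin patchE => + Ox; rewrite mem_set.
Qed.

(** Fatou's lemma, applied to f_k - f + |f| >= 0, shows that the integral of
    l - f > 0 over D is at most 0.  The norm in the auxiliary sequence makes it
    nonnegative everywhere, and the lower limit is used instead of l because it
    is measurable. *)
Lemma fatou_strict d (T : measurableType d) (R : realType)
    (mu : {measure set T -> \bar R}) (D : set T) (f_ : nat -> T -> R) (f l : T -> R) :
  measurable D ->
  (forall k, mu.-integrable D (EFin \o f_ k)) -> mu.-integrable D (EFin \o f) ->
  (forall k, \int[mu]_(x in D) (f_ k x)%:E <= \int[mu]_(x in D) (f x)%:E)%E ->
  {ae mu, forall x, D x -> forall k, - `|f x| <= f_ k x - f x} ->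
  {ae mu, forall x, D x -> (fun k => f_ k x) @ \oo --> l x} ->
  {ae mu, forall x, D x -> f x < l x} ->
  {ae mu, forall x, ~ D x}.
Proof.
move=> mD if_ iff lef lb cf fl.
pose h (k : nat) (x : T) : R := `|f_ k x - f x + `|f x| |.
have mf : measurable_fun D f by exact/measurable_EFinP/measurable_int/iff.
have mf_ k : measurable_fun D (f_ k) by exact/measurable_EFinP/measurable_int/if_.
have mh k : measurable_fun D (EFin \o h k).
  apply/measurable_EFinP; apply: measurableT_comp => //.
  by apply: measurable_funD; [exact: measurable_funB|exact: measurableT_comp].
have ia : mu.-integrable D (fun x => (`|f x|)%:E) by exact: integrable_abse iff.
have lim_h : (\int[mu]_(x in D) limn_einf (fun k => (h k x)%:E) <=
    \int[mu]_(x in D) (`|f x|)%:E)%E.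
  have h0 k x : D x -> (0 <= (EFin \o h k) x)%E by move=> _; rewrite lee_fin normr_ge0.
  apply: (le_trans (fatou mu mD mh h0)).
  rewrite limn_einf_lim; apply: lime_le; first exact: is_cvg_einfs.
  apply: nearW => k; apply: ge_ereal_inf; exists (\int[mu]_(x in D) (h k x)%:E)%E.
    by exists k => /=.
  have -> : (\int[mu]_(x in D) (h k x)%:E =
      \int[mu]_(x in D) ((f_ k x)%:E - (f x)%:E + (`|f x|)%:E))%E.
    apply: ae_eq_integral => //.
      exact: mh.
      exact: measurable_int (integrableD mD (integrableB mD (if_ k) iff) ia).
    apply: filterS lb => x H Dx; congr EFin.
    by rewrite /h ger0_norm// -lerBlDr sub0r H.
  rewrite (integralD mD (integrableB mD (if_ k) iff) ia).
  rewrite (integralB mD (if_ k) iff) -[leRHS]add0e leeD2r//.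
  by rewrite sube_le0 lef.
pose G x := limn_einf (fun k => (h k x)%:E).
have mG : measurable_fun D G.
  apply: measurableT_comp => //; apply: measurable_fun_limn_esup => k.
  by apply: measurableT_comp => //; exact: mh.
have G0 x : D x -> (0 <= G x)%E.
  move=> _; rewrite /G limn_einf_lim; apply: lime_ge; first exact: is_cvg_einfs.
  by apply: nearW => k; apply: le_ereal_inf_tmp => _ [m _ <-]; rewrite lee_fin normr_ge0.
have iG : mu.-integrable D G.
  apply/integrableP; split => //.
  under eq_integral => x Dx do rewrite gee0_abs ?(G0 x (set_mem Dx))//.
  apply: le_lt_trans lim_h _; have /integrableP[_] := iff.
  by [].
have iGf := integrableB mD iG ia.
have fG : {ae mu, forall x, D x -> ((`|f x|)%:E < G x)%E}.
  apply: filterS3 lb cf fl => x Hlb Hcf Hfl Dx.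
  have hc : (fun k => (h k x)%:E) @ \oo --> (`|l x - f x + `|f x| |)%:E.
    apply: cvg_EFin; first exact: nearW.
    apply: cvg_norm; apply: cvgD; last exact: cvg_cst.
    by apply: cvgB; [exact: Hcf|exact: cvg_cst].
  rewrite /G (cvg_limn_einf_sup hc).1 lte_fin (lt_le_trans _ (ler_norm _))//.
  by rewrite ltrDr subr_gt0 Hfl.
have : (\int[mu]_(x in D) `|G x - (`|f x|)%:E| = 0)%E.
  apply/eqP; rewrite eq_le integral_ge0 ?andbT//.
  rewrite (_ : \int[mu]_(x in D) _ = \int[mu]_(x in D) (G x - (`|f x|)%:E))%E.
    by rewrite (integralB mD iG ia) sube_le0.
  apply: ae_eq_integral => //.
  - by apply: measurableT_comp => //; exact: measurable_int iGf.
  - exact: measurable_int iGf.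
  - by apply: filterS fG => x H Dx; rewrite gee0_abs// sube_ge0 ?ltW ?H.
move/ae_eq_integral_abs => /(_ mD (measurable_int _ iGf)).
apply: filterS2 fG => x H H' Dx; have := H Dx.
by rewrite -sube_gt0 (H' Dx) ltxx.
Qed.

(** * Comparison of the two equations *)

Lemma nonlocal_picone (R : realType) (p t e a1 a2 b1 b2 : R) : 1 < p -> `|t| = 1 ->
  0 < e -> 0 <= a1 -> 0 <= a2 -> 0 <= t * b1 -> 0 <= t * b2 ->
  spow p (b1 - b2) * (picone_fun p t e a1 b1 - picone_fun p t e a2 b2)
  <= `|a1 - a2| `^ p.
Proof.
move=> p1 t1 e0 a10 a20 b10 b20.
rewrite /picone_fun -mulrBr mulrCA mulrA -(spow_unit _ _ t1).
rewrite (_ : t * (b1 - b2) = (t * b1 + e) - (t * b2 + e)); last by ring.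
by apply: discrete_picone => //; rewrite ltr_wpDl.
Qed.

Lemma picone_comparison (R : realType) n (p s t e : R) (Omega : set 'rV[R]_n)
    (H : 'rV[R]_n -> R) (f1 f2 : 'rV[R]_n -> R -> R) (u v : 'rV[R]_n -> R) :
  1 < p -> `|t| = 1 -> 0 < e -> measurable Omega -> Finsler_Minkowski H ->
  Linfty Omega u ->
  weak_solution p s Omega H f1 u -> weak_solution p s Omega H f2 v ->
  {ae leb, forall x, Omega x -> 0 <= u x} ->
  {ae leb, forall x, Omega x -> 0 <= t * v x} ->
  [/\ leb.-integrable Omega (fun x => (f1 x (u x) * u x)%:E),
    leb.-integrable Omega (fun x => (f2 x (v x) * picone_fun p t e (u x) (v x))%:E) &
  (\int[leb]_(x in Omega) (f2 x (v x) * picone_fun p t e (u x) (v x))%:E <=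
   \int[leb]_(x in Omega) (f1 x (u x) * u x)%:E)%E].
Proof.
move=> p1 t1 e0 mO hH ub [Wu eu] [Wv ev] u0 v0.
have p0 : 0 < p by rewrite (lt_trans _ p1).
have [M uM] := Linfty_bounded ub.
have uM' : {ae leb, forall x, 0 <= u x <= `|M|}.
  apply: filterS3 u0 uM Wu.2 => x H1 H2 H3.
  have [Ox|Ox] := pselect (Omega x); last by rewrite H3// lexx normr_ge0.
  by rewrite H1//= (le_trans (ler_norm _))// (le_trans (H2 Ox))// ler_norm.
have v0' : {ae leb, forall x, 0 <= t * v x}.
  apply: filterS2 v0 Wv.2 => x H1 H2.
  have [Ox|Ox] := pselect (Omega x); first exact: H1.
  by rewrite H2// mulr0.
have [Wphi gphi] := picone_test p1 t1 e0 Wu Wv.1 uM' v0'.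
have [iu Eu] := eu _ Wu; have [iv Ev] := ev _ Wphi.
split => //; rewrite -Eu -Ev; apply: leeD.
- rewrite [leRHS](_ : _ = \int[leb]_(x in Omega) (H (wgrad p u x) `^ p)%:E)%E; last first.
    by apply: eq_integral => x _; rewrite flux_self.
  apply: le_integral_dominated => //.
  + apply/measurable_EFinP/measurable_funTS.
    apply: (measurableT_comp (measurable_powR _)).
    apply: (measurableT_comp (measurable_FM hH)).
    apply: measurable_fun_rVP => i.
    have [gup _] := wgradP Wu.1.
    by have [] := Lfun_powR_integrable p1 (gup i).
  + by move=> x _; rewrite lee_fin powR_ge0.
  + apply: filterS3 gphi uM' v0' => x -> /andP[ux _] vx _.
    by rewrite lee_fin; apply: local_picone => //; rewrite ltr_wpDl.
- rewrite [leRHS](_ : _ = \int[leb \x leb]_z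
      (`|u z.1 - u z.2| `^ p * Defs.kernel p s z.1 z.2)%:E)%E; last first.
    by apply: eq_integral => x _; rewrite spow_self.
  apply: le_integral_dominated => //.
  + apply/measurable_EFinP; apply: measurable_funM; last exact: measurable_kernel.
    apply: (measurableT_comp (measurable_powR _)); apply: measurableT_comp => //.
    have [mu _] := Lfun_powR_integrable p1 Wu.1.1.
    by apply: measurable_funB; apply: (measurableT_comp mu).
  + by move=> z _; rewrite lee_fin mulr_ge0 ?powR_ge0.
  + have uv : {ae leb, forall x, 0 <= u x /\ 0 <= t * v x}.
      by apply: filterS2 uM' v0' => x /andP[].
    apply: filterS2 (ae_product_fst leb uv) (ae_product_snd leb uv).
    move=> z [u1 v1] [u2 v2] _; rewrite lee_fin ler_wpM2r ?powR_ge0//.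
    exact: nonlocal_picone.
Qed.

Lemma picone_source (R : realType) (p t e a b : R) : 1 < p -> `|t| = 1 ->
  0 < t * b ->
  spow p b * picone_fun p t e a b =
  a `^ p * ((t * b) `^ (p - 1) * (t * b + e) `^ (1 - p)).
Proof.
move=> p1 t1 tb; rewrite -(spow_gt0 _ tb) spow_unit// /picone_fun; ring.
Qed.

(** The factor (t v)^(p-1) (t v + e)^(1-p) of [picone_source] lies in [0, 1] and
    tends to 1.  Since a1 < a2, the integrands a2 |v|^(p-2) v phi_e - a1 u^p are
    bounded below by -|a1| u^p whatever the sign of a2. *)
Lemma no_signed_solution (R : realType) n (p s t : R) (Omega : set 'rV[R]_n)
    (H : 'rV[R]_n -> R) (a1 a2 u v : 'rV[R]_n -> R) :
  1 < p -> `|t| = 1 -> measurable Omega -> Finsler_Minkowski H ->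
  (forall x, Omega x -> a1 x < a2 x) ->
  Linfty Omega u ->
  weak_solution p s Omega H (fun x t => a1 x * t `^ (p - 1)) u ->
  {ae leb, forall x, Omega x -> 0 < u x} ->
  weak_solution p s Omega H (fun x t => a2 x * spow p t) v ->
  {ae leb, forall x, Omega x -> 0 < t * v x} ->
  {ae leb, forall x, ~ Omega x}.
Proof.
move=> p1 t1 mO hH a12 ub hu u0 hv v0.
have p0 : 0 < p by rewrite (lt_trans _ p1).
have u0' : {ae leb, forall x, Omega x -> 0 <= u x}.
  by apply: filterS u0 => x ux Ox; rewrite ltW// ux.
have v0' : {ae leb, forall x, Omega x -> 0 <= t * v x}.
  by apply: filterS v0 => x vx Ox; rewrite ltW// vx.
pose e k : R := k.+1%:R^-1.
have e0 k : 0 < e k by rewrite invr_gt0.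
have C k := picone_comparison p1 t1 (e0 k) mO hH ub hu hv u0' v0'.
apply: (@fatou_strict _ _ _ leb Omega
  (fun k x => a2 x * spow p (v x) * picone_fun p t (e k) (u x) (v x))
  (fun x => a1 x * u x `^ (p - 1) * u x) (fun x => a2 x * u x `^ p)) => //.
- by move=> k; have [] := C k.
- by have [] := C 0.
- by move=> k; have [] := C k.
- apply: filterS2 u0 v0 => x ux vx Ox k.
  have {}ux := ux Ox; have {}vx := vx Ox; have ax := a12 x Ox.
  rewrite -(mulrA (a2 x)) -(mulrA (a1 x)) picone_source// (mulrC (u x `^ (p - 1))) mulr_powRB1 ?(ltW ux)//.
  set th := _ `^ (p - 1) * _; have th0 : 0 <= th by rewrite mulr_ge0 ?powR_ge0.
  have th1 : th <= 1.
    have y0 : 0 < t * v x + e k by rewrite addr_gt0.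
    rewrite /th -(opprB p 1) powRN ler_pdivrMr ?powR_gt0// mul1r.
    by rewrite ge0_ler_powR ?nnegrE ?subr_ge0 ?(ltW p1) ?(ltW vx) ?(ltW y0)// lerDl ltW.
  have up := powR_gt0 p ux.
  rewrite normrM [`|_ `^ _|]ger0_norm ?(ltW up)// mulrA (mulrAC (a2 x)) -mulrBl -mulNr.
  rewrite ler_wpM2r ?(ltW up)// lerBrDr.
  have [a20|a20] := leP 0 (a2 x).
    by apply: (@le_trans _ _ 0); [rewrite addrC subr_le0 ler_norm|exact: mulr_ge0].
  apply: (@le_trans _ _ (a1 x)); first by rewrite gerDr oppr_le0.
  by rewrite (le_trans (ltW ax))// -{1}(mulr1 (a2 x)) ler_nM2l.
- apply: filterS2 u0 v0 => x ux vx Ox.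
  have {}ux := ux Ox; have {}vx := vx Ox.
  rewrite (_ : (fun k => _) = (fun k => a2 x * (u x `^ p *
    ((t * v x) `^ (p - 1) * (t * v x + e k) `^ (1 - p))))); last first.
    by apply/funext => k; rewrite -(mulrA (a2 x)) picone_source.
  apply: cvgM; first exact: cvg_cst.
  rewrite -[X in _ --> X]mulr1; apply: cvgM; first exact: cvg_cst.
  have E : (t * v x) `^ (p - 1) * (t * v x) `^ (1 - p) = 1.
    by rewrite -powRD ?(gt_eqF vx) ?implybT// (_ : _ + _ = 0) ?powRr0//; ring.
  rewrite -[X in _ --> X]E.
  apply: cvgM; first exact: cvg_cst.
  apply: cvg_powR_seq; [exact: ltW|by left| |].
    by move=> k; rewrite addr_ge0 ?ltW.
  rewrite -[X in _ --> X]addr0; apply: cvgD; first exact: cvg_cst.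
  exact: cvg_harmonic.
- apply: filterS u0 => x ux Ox; have {}ux := ux Ox.
  rewrite -mulrA (mulrC (_ `^ _)) mulr_powRB1 ?(ltW ux)//.
  by rewrite ltr_pM2r ?powR_gt0// a12.
Qed.

Theorem theorem2p11 (R : realType) (N : nat) (hN : (2 <= N)%N)
    (p s : R) (hp : 1 < p) (hs0 : 0 < s) (hs1 : s < 1)
    (Omega : set 'rV[R]_N) (hOmega : bounded_C1_domain Omega)
    (H : 'rV[R]_N -> R) (hH : Finsler_Minkowski H)
    (a1 a2 : 'rV[R]_N -> R)
    (ha1 : {within Omega, continuous a1})
    (ha2 : {within Omega, continuous a2})
    (ha : forall x, Omega x -> a1 x < a2 x)
    (u : 'rV[R]_N -> R)
    (hub : Linfty Omega u)
    (hu : weak_solution p s Omega H (fun x t => a1 x * t `^ (p - 1)) u)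
    (hu0 : {ae leb, forall x, Omega x -> 0 < u x})
    (v : 'rV[R]_N -> R)
    (hv : weak_solution p s Omega H (fun x t => a2 x * spow p t) v)
    (hv0 : ~ {ae leb, forall x, Omega x -> v x = 0}) :
  ~ {ae leb, forall x, Omega x -> 0 < v x} /\
  ~ {ae leb, forall x, Omega x -> v x < 0}.
Proof.
have mO : measurable Omega := open_measurable_rV (domain_open hOmega).
have sign (t : R) : `|t| = 1 -> ~ {ae leb, forall x, Omega x -> 0 < t * v x}.
  move=> t1 tv; apply: hv0.
  have := no_signed_solution hp t1 mO hH ha hub hu hu0 hv tv.
  by apply: filterS => x Ox /Ox.
split => [v0|v0].
- by apply: (sign 1); [exact: normr1|]; apply: filterS v0 => x; rewrite mul1r.
- by apply: (sign (-1)); [exact: normrN1|]; apply: filterS v0 => x; rewrite mulN1r oppr_gt0.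
Qed.
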